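(* There exists an analytic orientation-preserving diffeomorphism $f$ of $\mathbb{S}^1$ with rotation number $0$, with no hyperbolic fixed point, such that $f$ is $C^{1+AC}$-undistorted (and hence $C^k$-undistorted for all integers $k\geq 2$). Moreover, such a diffeomorphism may be taken arbitrarily close to the identity in the $C^{1+AC}$ topology; that is, every neighborhood of the identity in $\mathrm{Diff}_+^{1+AC}(\mathbb{S}^1)$ contains such an $f$.
   Context: $\mathbb{S}^1$ is $[0,1]$ with endpoints identified (i.e. $\mathbb{R}/\mathbb{Z}$); derivatives are taken in the standard coordinate. $\mathrm{Diff}_+^k(\mathbb{S}^1)$ is the group (under composition) of orientation-preserving $C^k$ diffeomorphisms of $\mathbb{S}^1$, a Polish group with the uniform $C^k$ topology. $\mathrm{Diff}_+^{1+AC}(\mathbb{S}^1)$ is the subgroup of $\mathrm{Diff}_+^1(\mathbb{S}^1)$ of diffeomorphisms whose first derivative is absolutely continuous; it is a Polish group whose topology (the $C^{1+AC}$ topology) is given by the metric $\rho(f,g)=\sup_{x\in\mathbb{S}^1}|f(x)-g(x)|+\sup_{x\in\mathbb{S}^1}|f'(x)-g'(x)|+\int_{\mathbb{S}^1}|f''-g''|$ (where $|f(x)-g(x)|$ denotes distance in $\mathbb{S}^1$). A hyperbolic fixed point of $f$ is a point $x$ with $f(x)=x$ and $f'(x)\ne1$. A pseudometric $d$ on a topological group $G$ is maximal if it is continuous, right-invariant, and for every continuous right-invariant pseudometric $\sigma$ on $G$ there are constants $K,C$ with $\sigma\le K\cdot d+C$. Any two maximal pseudometrics on $G$ are quasi-isometrically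 equivalent, and the groups $\mathrm{Diff}_+^k(\mathbb{S}^1)$ ($k\ge1$ integer) and $\mathrm{Diff}_+^{1+AC}(\mathbb{S}^1)$ admit maximal pseudometrics; for the latter, $d(f,g)=\int_{\mathbb{S}^1}\left|\frac{f''}{f'}-\frac{g''}{g'}\right|$ is one. For $G$ with a maximal pseudometric $d$, an element $f\in G$ is distorted in $G$ if the inclusion $\langle f\rangle\hookrightarrow G$ is not a quasi-isometric embedding (with respect to a right-invariant Cayley metric on $\langle f\rangle$ and $d$ on $G$), and undistorted otherwise; this is independent of the choice of $d$. For non-torsion $f$, the limit $\lim_{n\to\infty} d(f^n,e)/n$ exists, and $f$ is distorted if and only if it equals $0$. For $k$ a positive integer or $k=1+AC$, $f$ is called $C^k$-distorted if it is distorted in the Polish group $\mathrm{Diff}_+^k(\mathbb{S}^1)$ or is a torsion element; otherwise it is $C^k$-undistorted. *)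

(* Defs.v *)
From HB Require Import structures.
From mathcomp Require Import all_boot all_order all_algebra.
From mathcomp Require Import all_classical all_reals all_analysis.

Set Implicit Arguments.
Unset Strict Implicit.
Unset Printing Implicit Defensive.

Import Order.TTheory GRing.Theory Num.Theory.
Import numFieldNormedType.Exports.

Local Open Scope classical_set_scope.
Local Open Scope ring_scope.

Record bijection (T : Type) := Bijection {
  bij_fun :> T -> T;
  bij_inv : T -> T;
  bij_funK : cancel bij_fun bij_inv;
  bij_invK : cancel bij_inv bij_fun }.

Section BijectionGroup.
Variable T : Type.
Implicit Types f g h : bijection T.

Lemma bijection_eq f g : bij_fun f = bij_fun g -> f = g.
Proof.
case: f g => [f f' fK f'K] [g g' gK g'K] /= fg.
have fg' : f' = g'.
  by apply/funext => x; apply: (can_inj gK); rewrite g'K -fg f'K.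
by subst g g'; rewrite (Prop_irrelevance fK gK) (Prop_irrelevance f'K g'K).
Qed.

Definition bij_one : bijection T :=
  @Bijection T idfun idfun (fun=> erefl) (fun=> erefl).

(* The product is composition in the usual order, [(f * g) x = f (g x)], the
   opposite of the convention that MathComp uses for permutations. *)
Definition bij_mul f g : bijection T :=
  @Bijection T (f \o g) (bij_inv g \o bij_inv f)
    (can_comp (@bij_funK _ f) (@bij_funK _ g))
    (can_comp (@bij_invK _ g) (@bij_invK _ f)).

Definition bij_opp f : bijection T :=
  Bijection (@bij_invK _ f) (@bij_funK _ f).

Lemma bij_mulA : associative bij_mul.
Proof. by move=> f g h; apply: bijection_eq. Qed.

Lemma bij_mul1 : left_id bij_one bij_mul.
Proof. by move=> f; apply: bijection_eq. Qed.

Lemma bij_mulr1 : right_id bij_one bij_mul.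
Proof. by move=> f; apply: bijection_eq. Qed.

Lemma bij_mulV : left_inverse bij_one bij_opp bij_mul.
Proof. by move=> f; apply: bijection_eq; apply/funext; exact: bij_funK. Qed.

Lemma bij_mulrV : right_inverse bij_one bij_opp bij_mul.
Proof. by move=> f; apply: bijection_eq; apply/funext; exact: bij_invK. Qed.

HB.instance Definition _ := gen_eqMixin (bijection T).
HB.instance Definition _ := gen_choiceMixin (bijection T).
HB.instance Definition _ := isGroup.Build (bijection T)
  bij_mulA bij_mul1 bij_mulr1 bij_mulV bij_mulrV.

End BijectionGroup.

(* In this section a topological group is a subgroup [H] of an abstract group
   [G], with the topology of a (possibly infinite-valued) metric [rho]; nothing
   is required of [rho], or of a pseudometric, outside [H]. *)
Section Distortion.
Context {R : realType} {G : groupType}.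
Variables (H : set G) (rho : G -> G -> \bar R).
Implicit Types (d : G -> G -> R) (f g h : G).

Definition nbhs_in (f : G) : set_system G :=
  filter_from [set e : R | 0 < e]
    (fun e => [set g | H g /\ (rho f g < e%:E)%E]).

Definition pseudometric d : Prop :=
  [/\ forall f g, H f -> H g -> 0 <= d f g,
      forall f, H f -> d f f = 0,
      forall f g, H f -> H g -> d f g = d g f
    & forall f g h, H f -> H g -> H h -> d f h <= d f g + d g h].

Definition right_invariant d : Prop :=
  forall f g h, H f -> H g -> H h -> d (f * h)%g (g * h)%g = d f g.

Definition jointly_continuous d : Prop :=
  forall f g, H f -> H g ->
    (fun p : G * G => d p.1 p.2) @ filter_prod (nbhs_in f) (nbhs_in g) --> d f g.

Definition admissible d : Prop :=
  [/\ pseudometric d, right_invariant d & jointly_continuous d].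

Definition maximal_pseudometric d : Prop :=
  admissible d /\
  forall s : G -> G -> R, admissible s ->
    exists K C : R, forall f g, H f -> H g -> s f g <= K * d f g + C.

Definition zexp f (n : int) : G :=
  match n with Posz m => (f ^+ m)%g | Negz m => (f ^- m.+1)%g end.

(* The right-invariant word metric of the cyclic group [<f>] for the generating
   set [{f, f^-1}]; it is bounded when [f] is a torsion element. *)
Definition cayley_dist f g h : R :=
  inf [set (`|n|%N)%:R | n in [set n : int | zexp f n = (g / h)%g]].

Definition cyclic_qi_embedding d f : Prop :=
  exists K C : R, [/\ 1 <= K, 0 <= C & forall m n : int,
    K^-1 * cayley_dist f (zexp f m) (zexp f n) - C <= d (zexp f m) (zexp f n)
    /\ d (zexp f m) (zexp f n)
       <= K * cayley_dist f (zexp f m) (zexp f n) + C].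

(* Independent of the maximal pseudometric [d], since any two are
   quasi-isometrically equivalent. *)
Definition distorted f : Prop :=
  exists d, maximal_pseudometric d /\ ~ cyclic_qi_embedding d f.

Definition torsion f : Prop := exists2 n : nat, (0 < n)%N & (f ^+ n)%g = 1%g.

End Distortion.

Definition integers (R : realType) : zmodClosed R :=
  GRing.ZmodClosed.clone R (@Num.int_num_subdef R) _.

Notation circle R := (Quotient.quot (integers R)).

Definition to_circle {R : realType} (x : R) : circle R := (\pi_(circle R) x)%qT.

Section Circle.
Context {R : realType}.
Implicit Types (F : R -> R) (f g : bijection (circle R)) (p q : circle R).

Definition circle_dist p q : R :=
  inf [set `|x| | x in [set x : R | to_circle x = p - q]].

Definition is_lift F f : Prop :=
  continuous F /\ forall x, to_circle (F x) = f (to_circle x).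

(* Two lifts of [f] differ by an integer constant. *)
Definition lift f : R -> R := xget (fun x : R => x) [set F : R -> R | is_lift F f].

Definition orientation_preserving f : Prop :=
  exists F, is_lift F f /\ {homo F : x y / x < y}.

Definition Ck (k : nat) F : Prop :=
  (forall j, (j < k)%N -> forall x, derivable (derive1n j F) x 1) /\
  continuous (derive1n k F).

Definition real_analytic F : Prop :=
  forall x, exists (a : nat -> R) (r : R), 0 < r /\
    forall y, `|y - x| < r -> pseries a (y - x) @ \oo --> F y.

Definition absolutely_continuous (a b : R) F : Prop :=
  forall e : R, 0 < e -> exists2 delta : R, 0 < delta &
    forall s : seq (R * R),
      all (fun I => [&& a <= I.1, I.1 <= I.2 & I.2 <= b]) s ->
      pairwise (fun I J => (I.2 <= J.1) || (J.2 <= I.1)) s ->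
      \sum_(I <- s) (I.2 - I.1) < delta ->
      \sum_(I <- s) `|F I.2 - F I.1| < e.

Definition Ck_map k f : Prop := exists F, is_lift F f /\ Ck k F.

Definition analytic_map f : Prop := exists F, is_lift F f /\ real_analytic F.

Definition analytic_diffeo f : Prop :=
  [/\ orientation_preserving f, analytic_map f & analytic_map f^-1%g].

Definition Diffk (k : nat) : set (bijection (circle R)) :=
  [set f | [/\ orientation_preserving f, Ck_map k f & Ck_map k f^-1%g]].

(* The [n]-th derivative ([n >= 1]) in the standard coordinate; wherever it does
   not exist (for [n = 2] and [f'] absolutely continuous, only on a null set),
   it takes a default value. *)
Definition circle_derive (n : nat) f p : R := derive1n n (lift f) (repr p).

Definition Diff1AC : set (bijection (circle R)) :=
  [set f | Diffk 1 f /\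
    absolutely_continuous 0 1 (fun x => circle_derive 1 f (to_circle x))].

Definition sup_dist f g : \bar R :=
  ereal_sup [set (circle_dist (f p) (g p))%:E | p in setT].

Definition sup_derive_dist (n : nat) f g : \bar R :=
  ereal_sup [set `|circle_derive n f p - circle_derive n g p|%:E | p in setT].

(* A metric for the uniform [C^k] topology. *)
Definition rhok (k : nat) f g : \bar R :=
  (sup_dist f g + \sum_(1 <= j < k.+1) sup_derive_dist j f g)%E.

Definition rho1AC f g : \bar R :=
  (sup_dist f g + sup_derive_dist 1 f g +
   \int[lebesgue_measure]_(x in `[0%R, 1%R])
     `|circle_derive 2 f (to_circle x) - circle_derive 2 g (to_circle x)|%:E)%E.

Definition rotation_number f : circle R :=
  to_circle (limn (fun n : nat => iter n (lift f) 0 / n%:R)).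

Definition hyperbolic_fixed_point f p : Prop :=
  f p = p /\ circle_derive 1 f p <> 1.

Inductive regularity := Cint of nat | C1AC.

Definition Diff (r : regularity) : set (bijection (circle R)) :=
  match r with Cint k => Diffk k | C1AC => Diff1AC end.

Definition rho (r : regularity) :
    bijection (circle R) -> bijection (circle R) -> \bar R :=
  match r with Cint k => rhok k | C1AC => rho1AC end.

Definition C_distorted (r : regularity) f : Prop :=
  Diff r f /\ (distorted (Diff r) (rho r) f \/ torsion f).

Definition C_undistorted (r : regularity) f : Prop :=
  Diff r f /\ ~ C_distorted r f.

End Circle.

(* Main.v *)
(* In the coordinate u = - cot (pi x) on the circle minus one point, take
   phi(u) = u + tau + eps (1 + u^2)^-(m+1). It extends to an analytic
   diffeomorphism f of the circle whose only fixed point is parabolic, and whose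
   second derivative is O(tau), so that f is close to the identity in C^(1+AC).
   For undistortedness it suffices that the right-invariant pseudometric
   s(f, g) = variation over the circle of ln f' - ln g', which is continuous on
   Diff^(1+AC) and hence on Diff^k for k >= 2, grows linearly along the powers of
   f. The hump of phi is so thin that of the orbits in u only those close to the
   orbit of 0 collect a displacement of order eps from it. Hence, on each
   fundamental interval between the two sides of the fixed point, f^n is far from
   being affine, with a distortion bounded below independently of n: each of
   about n disjoint intervals contributes a definite amount to the variation of
   ln (f^n)'. *)
Require Import Defs.
From HB Require Import structures.
From mathcomp Require Import all_boot all_order all_algebra.
From mathcomp Require Import all_classical all_reals all_analysis.
From mathcomp Require Import zify ring lra.

Set Implicit Arguments.
Unset Strict Implicit.
Unset Printing Implicit Defensive.

Import Order.TTheory GRing.Theory Num.Theory.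
Import numFieldNormedType.Exports.

Local Open Scope classical_set_scope.
Local Open Scope ring_scope.

(** The parameters are fixed in the order tau, m, eps. The size of tau decides the distance to the
    identity. The bump at u is at most 1 / ((m+1) u^2), so its sum along an orbit that advances by
    tau and avoids 0 is of order 1 / (m tau^2); taking m of order tau^-2 makes it at most 1/4,
    whereas the orbit of 0 collects 1 in one step. Differentiating the bump twice costs (m+1)^2,
    which forces eps <= tau / (8 (m+1)^2); the smallness of eps does no harm, as the growth rate
    only has to be positive. Refuting distortion means treating an arbitrary maximal pseudometric
    [d]. Domination of [log_var] by [d] suffices, so [log_var] is shown to be admissible, not
    maximal. As a supremum of finite sums, the variation is bounded below by exhibiting points. The
    cost is its continuity: [rho1AC] integrates a pointwise second derivative, and relating that
    integral to increments requires Radon-Nikodym densities and Lebesgue differentiation. Since (1 +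
    u^2)^-1 = sin(pi x)^2, the derivative of the lift is rational in sin(pi x) and cos(pi x).
    Analyticity, also of the inverse, comes from factorial bounds on derivatives in a polynomial
    differential system. *)

(** * Total variation of absolutely continuous functions *)

Section AbsolutelyContinuousVariation.
Context {R : realType}.
Implicit Types (a b e : R) (u : R -> R) (s t L : seq (R * R)).

Definition disjoint_itvs a b s : bool :=
  all (fun I => [&& a <= I.1, I.1 <= I.2 & I.2 <= b]) s &&
  pairwise (fun I J => (I.2 <= J.1) || (J.2 <= I.1)) s.

Lemma partition_itvs a b u (s : seq R) : itv_partition a b s ->
  exists L, [/\ disjoint_itvs a b L, \sum_(I <- L) (I.2 - I.1) = b - a
    & \sum_(I <- L) `|u I.2 - u I.1| = variation a b u s].
Proof.
elim: s a => [|x s IH] a abs.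
  exists [::]; rewrite (itv_partition_nil abs) !big_nil subrr variation_nil.
  by split.
have xbs := itv_partition_cons abs.
have [L [/andP[Lall Lpw] Llen Lvar]] := IH _ xbs.
have ax : a < x by case: abs => /= /andP[].
have xb := itv_partition_le xbs.
exists ((a, x) :: L); split.
- rewrite /disjoint_itvs /= lexx (ltW ax) xb /= Lpw andbT; apply/andP; split.
    apply: sub_all Lall => I /and3P[xI -> ->]; rewrite !andbT.
    by rewrite (le_trans _ xI)// ltW.
  by apply: sub_all Lall => I /and3P[-> _ _].
- by rewrite big_cons Llen /=; ring.
rewrite big_cons Lvar /= -cat1s (@variation_cat _ x) ?(ltW ax)//; last first.
  exact: itv_partition1.
by rewrite /variation/= big_nat1.
Qed.

Lemma disjoint_itvs_refine a b t J s L : disjoint_itvs a b (t ++ J :: s) ->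
  disjoint_itvs J.1 J.2 L -> disjoint_itvs a b ((t ++ L) ++ s).
Proof.
rewrite /disjoint_itvs !all_cat !pairwise_cat /= allrel_consr.
rewrite allrel_catl.
move=> /andP[/and3P[ta Ja sa] /and3P[/andP[tJ ts] tp /andP[Js sp]]].
move=> /andP[La Lp]; rewrite ta sa tp sp Lp ts !andbT /=; apply/and3P; split.
- apply: sub_all La => I /and3P[JI -> IJ] /=.
  case/and3P: Ja => aJ JJ Jb.
  by rewrite (le_trans aJ JI) (le_trans IJ Jb).
- apply/allrelP => K I KL Is; have /allP/(_ _ Is)/= := Js.
  have /allP/(_ _ KL)/and3P[JK KK KJ] := La.
  by case/orP => [JI|IJ]; rewrite ?(le_trans KJ JI)// (le_trans IJ JK) orbT.
apply/allrelP => I K It KL; have /allP/(_ _ It)/= := tJ.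
have /allP/(_ _ KL)/and3P[JK KK KJ] := La.
by case/orP => [IJ|JI]; rewrite ?(le_trans IJ JK)// (le_trans KJ JI) orbT.
Qed.

(** The intervals of [t] are measured by increments, those of [s] by total variation. One interval
    of [s] at a time is cut along a partition and joins [t], which keeps the total length; the
    supremum over its partitions can be taken because the sum over the rest is finite. *)
Lemma sum_total_variation_le a b u e delta t s :
  (forall r, disjoint_itvs a b r -> \sum_(I <- r) (I.2 - I.1) < delta ->
    \sum_(I <- r) `|u I.2 - u I.1| < e) ->
  disjoint_itvs a b (t ++ s) ->
  \sum_(I <- t ++ s) (I.2 - I.1) < delta ->
  ((\sum_(I <- t) `|u I.2 - u I.1|)%:E +
   \sum_(I <- s) total_variation I.1 I.2 u <= e%:E)%E.
Proof.
move=> ue; elim: s t => [|J s IH] t dts lts.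
  rewrite big_nil adde0 lee_fin ltW//; apply: ue; last by rewrite cats0 in lts.
  by rewrite cats0 in dts.
have JJ : J.1 <= J.2.
  by have := dts; rewrite /disjoint_itvs all_cat => /andP[/and3P[_ /and3P[]]].
have sge0 : (0 <= \sum_(I <- s) total_variation I.1 I.2 u)%E.
  have : all (fun I => I.1 <= I.2) s.
    have := dts; rewrite /disjoint_itvs all_cat => /andP[/and3P[_ _ sa] _].
    by apply: sub_all sa => I /and3P[].
  move=> /allP sle; rewrite big_seq; apply: sume_ge0 => I Is.
  by apply: total_variation_ge0; exact: sle.
have step (p : seq R) : itv_partition J.1 J.2 p ->
    ((\sum_(I <- t) `|u I.2 - u I.1|)%:E + ((variation J.1 J.2 u p)%:E +
    \sum_(I <- s) total_variation I.1 I.2 u) <= e%:E)%E.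
  move=> Jp; have [L [dL lL vL]] := partition_itvs u Jp.
  have lts' : \sum_(I <- (t ++ L) ++ s) (I.2 - I.1) < delta.
    by move: lts; rewrite !big_cat /= big_cons lL addrA.
  have := IH _ (disjoint_itvs_refine dts dL) lts'.
  by rewrite big_cat /= vL EFinD -addeA.
rewrite big_cons.
have sfin : (\sum_(I <- s) total_variation I.1 I.2 u)%E \is a fin_num.
  rewrite ge0_fin_numE//.
  have [p Jp] : exists p, itv_partition J.1 J.2 p.
    have [JE|JN] := eqVneq J.1 J.2; last first.
      by exists [:: J.2]; apply: itv_partition1; rewrite lt_neqAle JN.
    by exists [::]; split => //=; rewrite JE.
  by have := step p Jp; case: (\sum_(I <- s) _)%E sge0 => //= x; rewrite ltry.
rewrite -(fineK sfin); set S := fine _.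
rewrite addeCA -EFinD -leeBrDr// -EFinB.
apply: ge_ereal_sup => _ [_ [p Jp <-] <-].
have := step p Jp; rewrite -(fineK sfin) -/S -!EFinD !lee_fin.
by lra.
Qed.

Lemma ac_disjoint_itvs a b u : absolutely_continuous a b u ->
  forall e, 0 < e -> exists2 delta, 0 < delta & forall r, disjoint_itvs a b r ->
    \sum_(I <- r) (I.2 - I.1) < delta -> \sum_(I <- r) `|u I.2 - u I.1| < e.
Proof.
move=> ac e /ac[delta d0 H]; exists delta => // r /andP[]; exact: H.
Qed.

(** For [e = 1], equal pieces shorter than the corresponding [delta] have total variation at most 1
    each. *)
Lemma ac_bounded_variation a b u : a <= b ->
  absolutely_continuous a b u -> bounded_variation a b u.
Proof.
move=> ab /ac_disjoint_itvs/(_ 1 ltr01)[delta d0 H].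
apply/(bounded_variationP _ ab); rewrite ge0_fin_numE ?total_variation_ge0//.
pose n := Num.bound ((b - a) / delta).
have nlt : (b - a) / delta < n%:R.
  by rewrite archi_boundP// divr_ge0 ?subr_ge0// ltW.
have n0 : (0 : R) < n%:R by apply: le_lt_trans nlt; rewrite divr_ge0 ?subr_ge0// ltW.
pose h := (b - a) / n%:R.
have h0 : 0 <= h by rewrite divr_ge0 ?subr_ge0// ltW.
have hd : h < delta by rewrite /h ltr_pdivrMr// mulrC -ltr_pdivrMr.
have hn : a + n%:R * h = b by rewrite /h mulrC divfK ?gt_eqF//; ring.
suff : forall k, (k <= n)%N -> (total_variation a (a + k%:R * h) u <= (k%:R)%:E)%E.
  by move/(_ n (leqnn _)); rewrite hn => /le_lt_trans; apply; exact: ltry.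
elim=> [_|k IH kn]; first by rewrite mul0r addr0 total_variationxx.
have kh : 0 <= k%:R * h by rewrite mulr_ge0.
rewrite (@total_variationD _ _ _ (a + k%:R * h)); last 2 first.
- by rewrite lerDl.
- by rewrite lerD2l ler_wpM2r// ler_nat.
rewrite -natr1 EFinD leeD ?IH 1?ltnW//.
have := @sum_total_variation_le a b u 1 delta [::]
  [:: (a + k%:R * h, a + (k%:R + 1) * h)] H.
rewrite /= !big_cons !big_nil /= add0e adde0; apply.
- rewrite /disjoint_itvs /= !andbT; apply/and3P; split.
  + by rewrite lerDl.
  + by rewrite lerD2l ler_wpM2r// lerDl.
  + by rewrite -hn lerD2l ler_wpM2r// natr1 ler_nat.
- by apply: le_lt_trans hd; rewrite addr0 mulrDl mul1r; lra.
Qed.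

(** Jordan decomposition inside the absolutely continuous functions: [V] is the total variation from
    [a]. The modulus is taken for [e / 2] because the bound on sums of total variations is not
    strict. *)
Lemma ac_variation_function a b u : a <= b -> absolutely_continuous a b u ->
  exists2 V : R -> R, absolutely_continuous a b V &
    forall x y, a <= x -> x <= y -> y <= b -> `|u y - u x| <= V y - V x.
Proof.
move=> ab ac; have bv := ac_bounded_variation ab ac.
pose V x := fine (total_variation a x u).
have Vfin x : a <= x -> x <= b -> total_variation a x u \is a fin_num.
  move=> ax xb; apply/bounded_variationP => //.
  exact: bounded_variationl ax xb bv.
have VD x y : a <= x -> x <= y -> y <= b ->
    (V y - V x)%:E = total_variation x y u.
  move=> ax xy yb; rewrite EFinB !fineK ?Vfin// ?(le_trans ax)//; last first.
    exact: le_trans xy yb.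
  rewrite (total_variationD _ ax xy) addeC addeA addeC.
  by rewrite [X in _ + X]addeC subee ?adde0// Vfin// (le_trans xy).
exists V; last first.
  by move=> x y ax xy yb; rewrite -lee_fin VD// total_variation_ge.
move=> e e0; have e20 : 0 < e / 2 by rewrite divr_gt0.
have [delta d0 H] := ac_disjoint_itvs ac e20; exists delta => // s sa sp sd.
have := @sum_total_variation_le a b u (e / 2) delta [::] s H.
rewrite /= big_nil add0e => /(_ _ sd); rewrite /disjoint_itvs sa sp => /(_ isT).
rewrite (_ : (\sum_(I <- s) _)%E = (\sum_(I <- s) `|V I.2 - V I.1|)%:E).
  by rewrite lee_fin => /le_lt_trans; apply; rewrite ltr_pdivrMr// mulr2n; lra.
rewrite -sumEFin; apply: eq_big_seq => I Is.
have /allP/(_ _ Is)/and3P[aI II Ib] := sa.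
by rewrite -VD// ger0_norm// -lee_fin VD// total_variation_ge0.
Qed.

End AbsolutelyContinuousVariation.

(** * Stieltjes measures of absolutely continuous functions *)

Section AbsolutelyContinuousMeasure.
Context {R : realType}.
Implicit Types (a b : R) (P : R -> R) (U : set R).

Lemma ac_dist a b P : absolutely_continuous a b P -> forall e, 0 < e ->
  exists2 delta, 0 < delta & forall x y, a <= x -> x <= y -> y <= b ->
    y - x < delta -> `|P y - P x| < e.
Proof.
move=> ac e /ac[delta d0 H]; exists delta => // x y ax xy yb yx.
have := H [:: (x, y)]; rewrite /= !big_cons !big_nil !addr0 /=; apply => //.
by rewrite ax xy yb.
Qed.

(** Composition with [clamp] extends a function from [[a, b]] to the line by constants, as a
    Stieltjes function has to be defined everywhere. *)
Definition clamp a b x : R := Num.max a (Num.min x b).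

Lemma clamp_ge a b x : a <= clamp a b x.
Proof. by rewrite /clamp le_max lexx. Qed.

Lemma clamp_le a b x : a <= b -> clamp a b x <= b.
Proof. by move=> ab; rewrite /clamp ge_max ab ge_min lexx orbT. Qed.

Lemma le_clamp a b : {homo clamp a b : x y / x <= y}.
Proof.
move=> x y xy; rewrite /clamp ge_max !le_max lexx /=; apply/orP; right.
by rewrite le_min !ge_min xy lexx !orbT.
Qed.

Lemma clampE a b x : a <= x -> x <= b -> clamp a b x = x.
Proof. by move=> ax xb; rewrite /clamp (min_idPl xb) (max_idPr ax). Qed.

Lemma clamp_lip a b x y : x <= y -> clamp a b y - clamp a b x <= y - x.
Proof.
move=> xy; rewrite /clamp /Num.max /Num.min.
by do !case: ifPn; rewrite -?leNgt => *; lra.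
Qed.

Lemma ac_clamp_continuous a b P : a <= b -> absolutely_continuous a b P ->
  continuous (P \o clamp a b).
Proof.
move=> ab ac x; apply/cvgrPdist_lt => e e0.
have [delta d0 H] := ac_dist ac e0.
near=> y.
have xy : `|x - y| < delta by near: y; exact: cvgr_dist_lt.
have [le_xy|/ltW le_yx] := leP x y.
  rewrite distrC; apply: H; rewrite ?clamp_ge ?clamp_le ?le_clamp//.
  apply: le_lt_trans xy; rewrite distrC ger0_norm ?subr_ge0//.
  exact: clamp_lip.
apply: H; rewrite ?clamp_ge ?clamp_le ?le_clamp//.
by apply: le_lt_trans xy; rewrite ger0_norm ?subr_ge0//; exact: clamp_lip.
Unshelve. all: by end_near. Qed.

Lemma stieltjes_itv (F : cumulative R R) x y : x <= y ->
  lebesgue_stieltjes_measure F `]x, y] = (F y - F x)%:E.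
Proof.
move=> xy; rewrite /lebesgue_stieltjes_measure /measure_extension.
by rewrite measurable_mu_extE/=; [rewrite wlength_itv_bnd|exact: is_ocitv].
Qed.

Definition part a b (n i : nat) : R := a + (b - a) * (i%:R / n.+1%:R).

Lemma le_part a b n : a <= b -> {homo part a b n : i j / (i <= j)%N >-> i <= j}.
Proof.
move=> ab i j ij; rewrite lerD2l ler_wpM2l ?subr_ge0//.
by rewrite ler_pM2r ?invr_gt0 ?ltr0n// ler_nat.
Qed.

Lemma part_max a b n : part a b n n.+1 = b.
Proof. by rewrite /part divff ?pnatr_eq0//; ring. Qed.

Lemma part_cover a b n x : a < b -> a < x -> x <= b ->
  exists i : 'I_n.+1, part a b n i < x <= part a b n i.+1.
Proof.
move=> ab ax xb.
have ex : exists m, x <= part a b n m by exists n.+1; rewrite part_max.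
case: (ex_minnP ex) => -[|m] xm mmin.
  by move: xm; rewrite /part mul0r mulr0 addr0 leNgt ax.
have mn : (m < n.+1)%N by rewrite mmin// part_max.
exists (Ordinal mn); rewrite /= xm andbT ltNge; apply/negP => /mmin.
by rewrite ltnn.
Qed.

Lemma part_itvs a b n (s : seq 'I_n.+1) : a <= b -> uniq s ->
  disjoint_itvs a b [seq (part a b n i, part a b n i.+1) | i : 'I_n.+1 <- s].
Proof.
move=> ab us; apply/andP; split.
  rewrite all_map; apply/allP => i _ /=; apply/and3P; split.
  - by rewrite -[leLHS]addr0 lerD2l mulr_ge0 ?subr_ge0// divr_ge0.
  - exact: le_part.
  - by rewrite -[leRHS](part_max a b n) le_part.
rewrite pairwise_map; elim: s us => //= i s IH /andP[nis us].
rewrite IH// andbT; apply/allP => j js /=.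
have : i != j by apply: contraNneq nis => ->.
by rewrite neq_ltn => /orP[ij|ij]; rewrite ?(le_part n ab ij)// orbT.
Qed.

(** A null set lies in an open [U] of Lebesgue measure less than [delta]. The cells of a subdivision
    that are contained in [U] have total length less than [delta], hence Stieltjes measure at most
    [e]. The subdivisions are not nested, so the sets [V n], which form the lower limit of these
    unions, provide the increasing family; it exhausts the part of [U] in []a, b]] because the mesh
    tends to 0. *)
Lemma ac_stieltjes_null (F : cumulative R R) a b (A : set R) : a < b ->
  absolutely_continuous a b F -> measurable A -> lebesgue_measure A = 0%E ->
  lebesgue_stieltjes_measure F (A `&` `]a, b]) = 0%E.
Proof.
move=> ab ac mA A0; have leab := ltW ab.
pose mu : {measure set (measurableTypeR R) -> \bar R} :=
  lebesgue_stieltjes_measure F.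
change (mu (A `&` `]a, b]) = 0%E).
apply/eqP; rewrite eq_le measure_ge0 andbT.
apply/lee_addgt0Pr => e e0; rewrite add0e.
have [delta d0 H] := ac_disjoint_itvs ac e0.
have Afin : (lebesgue_measure A < +oo)%E by rewrite A0 ltry.
have [U [oU AU UA]] := lebesgue_regularity_outer mA Afin d0.
have mU : measurable U by exact: measurable_realfun.open_measurable.
have Ud : (lebesgue_measure U < delta%:E)%E.
  rewrite -(setDUK AU) (le_lt_trans (measureU2 _ _ _))//.
    exact: measurableD.
  by rewrite [X in (X + _ < _)%E](_ : _ = 0%E) ?add0e//; exact: A0.
pose G n (i : 'I_n.+1) := `]part a b n i, part a b n i.+1]%classic.
pose p n (i : 'I_n.+1) := `[< G n i `<=` U >].
pose Un n := \big[setU/set0]_(i < n.+1 | p n i) G n i.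
have mG n i : measurable (G n i) by exact: measurable_itv.
have mUn n : measurable (Un n) by exact: bigsetU_measurable.
have Gtriv n : trivIset [set: 'I_n.+1] (G n).
  move=> i j _ _ [x []]; rewrite /G /= !in_itv/= => /andP[ix xi] /andP[jx xj].
  apply: val_inj; apply/eqP; rewrite eqn_leq.
  have lt_ji : part a b n j < part a b n i.+1 by exact: lt_le_trans jx xi.
  have lt_ij : part a b n i < part a b n j.+1 by exact: lt_le_trans ix xj.
  apply/andP; split; rewrite leqNgt; apply/negP => hlt.
    by have := le_part n leab hlt; rewrite leNgt lt_ij.
  by have := le_part n leab hlt; rewrite leNgt lt_ji.
have Gle n (i : 'I_n.+1) : part a b n i <= part a b n i.+1 by exact: le_part.
have muUn n : (mu (Un n) <= e%:E)%E.
  rewrite /Un (measure_bigsetU_ord mu)//; last exact: mG.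
  rewrite (eq_bigr (fun i : 'I_n.+1 =>
    (F (part a b n i.+1) - F (part a b n i))%:E)); last first.
    by move=> i _; exact: stieltjes_itv.
  have lU : (\sum_(i < n.+1 | p n i) (part a b n i.+1 - part a b n i)%:E < delta%:E)%E.
    apply: le_lt_trans Ud.
    under eq_bigr => i _.
      rewrite (_ : _%:E = lebesgue_measure (G n i)); last first.
        rewrite /G lebesgue_measure_itv/= lte_fin; case: ltP => // ij.
        by have /eqP -> : part a b n i.+1 == part a b n i;
          [rewrite eq_le ij Gle|rewrite subrr].
      over.
    rewrite -(measure_bigsetU_ord (@lebesgue_measure R))//; last exact: mG.
    apply: (@le_measure _ _ _ (@lebesgue_measure R)).
    - by rewrite inE; exact: mUn.
    - by rewrite inE; exact: mU.
    apply: (big_ind (fun X => X `<=` U)) => [//|X Y XU YU z [/XU|/YU]//|].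
    by move=> i /asboolP.
  rewrite sumEFin lte_fin in lU; rewrite sumEFin lee_fin.
  have := H [seq (part a b n i, part a b n i.+1) | i : 'I_n.+1 <- enum (p n)].
  rewrite !big_map /= !big_enum_cond/=.
  under eq_bigl do rewrite andbT; move=> /(_ _ lU).
  under eq_bigl do rewrite andbT.
  move=> /(_ (part_itvs leab (enum_uniq _)))/ltW; apply: le_trans.
  by apply: ler_sum => i _; exact: ler_norm.
pose V n := \bigcap_(k in [set k | (n <= k)%N]) Un k.
have mV n : measurable (V n).
  by apply: bigcap_measurable => //; exists n => /=.
have muV n : (mu (V n) <= e%:E)%E.
  apply: le_trans (muUn n); apply: (@le_measure _ _ _ mu).
  - by rewrite inE; exact: mV.
  - by rewrite inE; exact: mUn.
  by move=> x; apply => /=.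
have mbV : measurable (\bigcup_n V n) by exact: bigcup_measurable.
have Vnd : {homo V : n m / (n <= m)%N >-> (n <= m)%O}.
  move=> n m nm; rewrite subsetEset => x Vx k /= mk.
  by apply: Vx => /=; exact: leq_trans nm mk.
have : (mu (\bigcup_n V n) <= e%:E)%E.
  have := nondecreasing_cvg_mu (mu := mu) mV mbV Vnd.
  by apply: cvge_le; exact: nearW.
apply: le_trans; apply: (@le_measure _ _ _ mu).
- by rewrite inE; apply: measurableI => //; exact: measurable_itv.
- by rewrite inE; exact: mbV.
move=> x [/AU Ux /=]; rewrite in_itv/= => /andP[ax xb].
have /nbhs_ballP[r /= r0 xr] : nbhs x U by rewrite openE in oU; exact: oU.
exists (Num.bound ((b - a) / r)) => // k /= hk.
have [i /andP[ix xi]] := part_cover k ab ax xb.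
have Gx : G k i x by rewrite /G /= in_itv /= ix xi.
have pi : p k i.
  apply/asboolP => y; rewrite /G /= in_itv /= => /andP[iy yi].
  have step : part a b k i.+1 - part a b k i < r.
    have -> : part a b k i.+1 - part a b k i = (b - a) / k.+1%:R.
      by rewrite /part -[i.+1%:R]natr1 mulrDl; ring.
    rewrite ltr_pdivrMr ?ltr0n// mulrC -ltr_pdivrMr//.
    rewrite (@lt_le_trans _ _ (Num.bound ((b - a) / r))%:R)//.
      by rewrite archi_boundP// divr_ge0 ?subr_ge0// ltW.
    by rewrite ler_nat ltnW.
  by apply: xr; rewrite /ball /= ltr_distl; apply/andP; split; lra.
by rewrite /Un (bigD1 i)//=; left.
Qed.

End AbsolutelyContinuousMeasure.

(** * Densities of absolutely continuous functions *)

Section AbsolutelyContinuousDensity.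
Context {R : realType}.
Notation leb := (@lebesgue_measure R).
Implicit Types (a b : R) (P u d : R -> R).

(** The density is the Radon-Nikodym derivative of the Stieltjes measure of the clamped [P],
    restricted to []a, b]]. *)
Lemma ac_monotone_density a b P : a < b -> absolutely_continuous a b P ->
  (forall x y, a <= x -> x <= y -> y <= b -> P x <= P y) ->
  exists p : R -> R, leb.-integrable [set: R] (EFin \o p) /\
    forall x y, a <= x -> x <= y -> y <= b ->
      P y - P x = \int[leb]_(t in `]x, y]) p t.
Proof.
move=> ab ac Pnd; have leab := ltW ab.
have cnd : {homo P \o clamp a b : x y / x <= y}.
  by move=> x y xy /=; apply: Pnd; rewrite ?clamp_ge ?clamp_le ?le_clamp.
have crc : right_continuous (P \o clamp a b).
  by apply: right_continuousW; exact: ac_clamp_continuous.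
pose F : cumulative R R :=
  HB.pack (P \o clamp a b) (isCumulative.Build R _ R (P \o clamp a b) cnd crc).
have FE x : a <= x -> x <= b -> F x = P x by move=> ax xb; rewrite /F /= clampE.
have Fac : absolutely_continuous a b F.
  move=> e /ac[delta d0 H]; exists delta => // s sa sp sd.
  rewrite (eq_big_seq (fun I => `|P I.2 - P I.1|)); first exact: H.
  move=> I Is; have /allP/(_ _ Is)/and3P[aI II Ib] := sa.
  by rewrite !FE// ?(le_trans aI)// (le_trans II).
pose mu : {measure set (measurableTypeR R) -> \bar R} :=
  lebesgue_stieltjes_measure F.
pose D : set (measurableTypeR R) := `]a, b]%classic.
have mD : measurable D by exact: measurable_itv.
have muD : (mu D < +oo)%E.
  by have -> : mu D = _ := stieltjes_itv F leab; rewrite ltry.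
pose nu : {finite_measure set (measurableTypeR R) -> \bar R} := mfrestr mD muD.
have nuleb : nu `<< leb.
  apply/null_content_dominatesP => A mA A0.
  exact: (ac_stieltjes_null ab Fac mA A0).
have [f [f0 ffin fint fE]] := radon_nikodym_sigma_finite nuleb.
have fint' : leb.-integrable [set: R] f by exact: fint.
exists (fine \o f); split.
  rewrite (_ : EFin \o (fine \o f) = f); first exact: fint.
  by apply/funext => x /=; rewrite fineK//; exact: ffin.
move=> x y ax xy yb; apply: EFin_inj.
transitivity (mu `]x, y]%classic).
  by have -> : mu `]x, y]%classic = _ := stieltjes_itv F xy;
    rewrite !FE// ?(le_trans ax)// (le_trans xy).
have -> : mu `]x, y]%classic = nu `]x, y]%classic.
  rewrite /nu /mfrestr /= /mrestr; congr (mu _); apply/esym/setIidl.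
  by apply: subset_itv; rewrite bnd_simp.
rewrite fE; last exact: measurable_itv.
have fxy : leb.-integrable `]x, y] f.
  by apply: integrableS fint' => //; exact: measurable_itv.
rewrite /Rintegral fineK.
  by apply: eq_integral => t _ /=; rewrite fineK//; exact: ffin.
rewrite (_ : (fun t => _) = f); first exact: integrable_fin_num fxy.
by apply/funext => t /=; rewrite fineK//; exact: ffin.
Qed.

(** With [V] the variation function, [V + u] and [V] are nondecreasing and absolutely continuous,
    and [d] is the difference of their densities. The last clause is Lebesgue differentiation; it
    ties [d] to the pointwise derivative, in terms of which [rho1AC] is defined. *)
Lemma ac_density a b u : a < b -> absolutely_continuous a b u ->
  exists d : R -> R, [/\ leb.-integrable [set: R] (EFin \o d),
    forall x y, a <= x -> x <= y -> y <= b ->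
      u y - u x = \int[leb]_(t in `]x, y]) d t
    & {ae leb, forall x, x \in `]a, b[ -> derive1 u x = d x}].
Proof.
move=> ab ac; have leab := ltW ab.
have [V Vac uV] := ac_variation_function leab ac.
have Vnd x y : a <= x -> x <= y -> y <= b -> V x <= V y.
  by move=> ax xy yb; rewrite -subr_ge0 (le_trans _ (uV _ _ ax xy yb)).
have Wac : absolutely_continuous a b (fun x => V x + u x).
  move=> e e0; have e20 : 0 < e / 2 by rewrite divr_gt0.
  have [d1 d10 H1] := ac _ e20; have [d2 d20 H2] := Vac _ e20.
  exists (Num.min d1 d2); first by rewrite lt_min d10.
  move=> s sa sp; rewrite lt_min => /andP[s1 s2].
  have := ltrD (H1 s sa sp s1) (H2 s sa sp s2).
  rewrite -big_split/= (_ : e / 2 + e / 2 = e); last by lra.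
  apply: le_lt_trans; apply: ler_sum => I _.
  rewrite (_ : _ - _ = (u I.2 - u I.1) + (V I.2 - V I.1)); last by ring.
  exact: ler_normD.
have Wnd x y : a <= x -> x <= y -> y <= b -> V x + u x <= V y + u y.
  move=> ax xy yb; have := uV _ _ ax xy yb; rewrite ler_norml => /andP[+ _].
  by lra.
have [p [pint pE]] := ac_monotone_density ab Wac Wnd.
have [q [qint qE]] := ac_monotone_density ab Vac Vnd.
have dint : leb.-integrable [set: R] (EFin \o (p \- q)).
  exact: (integrableB measurableT pint qint).
have dE x y : a <= x -> x <= y -> y <= b ->
    u y - u x = \int[leb]_(t in `]x, y]) (p \- q) t.
  move=> ax xy yb; rewrite RintegralB//; last 2 first.
  - exact: integrableS pint.
  - exact: integrableS qint.
  by rewrite -pE// -qE//; ring.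
exists (p \- q); split => //.
have dinty y : leb.-integrable `]a, y] (EFin \o (p \- q)).
  by apply: integrableS dint => //; exact: measurable_itv.
have ftc := @FTC1 R (p \- q) (BRight a) dinty
  (open_integrable_locally openT dint).
move: ftc; apply: filterS; first exact: (ae_filter_ringOfSetsType leb).
move=> x xF; rewrite in_itv/= => /andP[ax xb].
have [|dF FE] := xF; first by rewrite lte_fin.
rewrite -[RHS]/((p \- q) x) -FE; set I := fun _ => _ in dF *.
rewrite !derive1E (_ : 'D_1 I x = 'D_1 (I + cst (u a)) x); last first.
  by rewrite deriveD// derive_cst addr0.
apply: near_eq_derive; near=> y.
have ay : a < y by near: y; exact: lt_nbhsr.
have yb : y < b by near: y; exact: lt_nbhsl.
by rewrite /= -[(I + _) y]/(I y + u a) /I -dE ?lexx ?(ltW ay) ?(ltW yb)// subrK.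
Unshelve. all: by end_near. Qed.

End AbsolutelyContinuousDensity.

(** The integral of a nonnegative function is a supremum over the simple functions below it, which
    is monotone for arbitrary functions. This covers integrands such as pointwise derivatives with
    default values. *)
Lemma ge0_le_integral_subset d (T : measurableType d) (R : realType)
    (mu : {measure set T -> \bar R}) (D E : set T) (f g : T -> \bar R) :
  (forall x, D x -> [/\ E x, (0 <= f x)%E & (f x <= g x)%E]) ->
  (forall x, E x -> (0 <= g x)%E) ->
  (\int[mu]_(x in D) f x <= \int[mu]_(x in E) g x)%E.
Proof.
move=> Df Eg; rewrite integral_mkcond [leRHS]integral_mkcond.
have f0 x : (0 <= (f \_ D) x)%E.
  by rewrite patchE; case: ifPn => //; rewrite inE => /Df[].
have g0 x : (0 <= (g \_ E) x)%E.
  by rewrite patchE; case: ifPn => //; rewrite inE => /Eg.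
rewrite !ge0_integralTE//; apply: le_ereal_sup => _ [h hf <-]; exists h => // x.
apply: le_trans (hf x) _; rewrite !patchE; case: ifPn => [|_].
  by rewrite inE => /Df[Ex _ fg]; rewrite ifT// inE.
by case: ifPn => //; rewrite inE => /Eg.
Qed.

(** * Increments controlled by the L1 distance of derivatives *)

Section VariationControl.
Context {R : realType}.
Notation leb := (@lebesgue_measure R).
Implicit Types (a b : R) (A B : R -> R).

(** [W] is the integral of [|p - q|] for densities [p] of [A] and [q] of [B]. It turns the integral
    term of [rho1AC] into a bound on increments of [A - B], the form that variation sums use. *)
Lemma ac_variation_control a b A B : a < b ->
  absolutely_continuous a b A -> absolutely_continuous a b B ->
  exists W : R -> R,
    (forall x y, a <= x -> x <= y -> y <= b ->
      `|(A y - B y) - (A x - B x)| <= W y - W x) /\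
    ((W b - W a)%:E <=
      \int[leb]_(t in `[a, b]) `|derive1 A t - derive1 B t|%:E)%E.
Proof.
move=> ab /(ac_density ab)[p [pint pE pae]] /(ac_density ab)[q [qint qE qae]].
have dint : leb.-integrable [set: R] (EFin \o (p \- q)).
  exact: (integrableB measurableT pint qint).
have nint : leb.-integrable [set: R] (EFin \o (fun t => `|p t - q t|)).
  exact: (integrable_norm dint).
have sub x y (f : R -> R) : leb.-integrable [set: R] (EFin \o f) ->
    leb.-integrable `]x, y] (EFin \o f).
  by move=> fi; apply: integrableS fi => //; exact: measurable_itv.
pose W x := \int[leb]_(t in `]a, x]) `|p t - q t|.
have WD x y : a <= x -> x <= y -> y <= b ->
    W y - W x = \int[leb]_(t in `]x, y]) `|p t - q t|.
  move=> ax xy yb; rewrite /W.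
  have -> : `]a, y]%classic = `]a, x]%classic `|` `]x, y]%classic.
    by rewrite -itv_bndbnd_setU// bnd_simp.
  rewrite Rintegral_setU//; first by ring.
  - by apply: integrableS nint => //; exact: measurableU.
  - apply/disj_setPRL => t /=; rewrite !in_itv/= => /andP[xt _].
    by apply/negP; rewrite negb_and -leNgt -ltNge xt orbT.
exists W; split.
  move=> x y ax xy yb; rewrite WD//.
  rewrite (_ : _ - _ = \int[leb]_(t in `]x, y]) (p \- q) t).
    by apply: le_normr_Rintegral => //; exact: sub.
  rewrite RintegralB//; [|exact: sub|exact: sub].
  by rewrite -pE// -qE//; ring.
rewrite WD ?(ltW ab)//.
have [N1 [mN1 N10 bad1]] := pae; have [N2 [mN2 N20 bad2]] := qae.
(* The point [b] belongs to []a, b]], while densities and derivatives are compared only inside []a,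
   b[]. *)
pose N := N1 `|` N2 `|` [set b].
have mN : measurable N by apply: measurableU => //; exact: measurableU.
have N0 : leb N = 0%E.
  apply/eqP; rewrite eq_le measure_ge0 andbT.
  apply: le_trans (measureU2 _ _ _) _ => //; first exact: measurableU.
  rewrite [X in (_ + X)%E]lebesgue_measure_set1 adde0.
  by apply: le_trans (measureU2 _ _ _) _ => //; rewrite [X in (X + _)%E]N10 add0e [leLHS]N20.
rewrite /Rintegral fineK; last first.
  by apply: integrable_fin_num => //; exact: sub.
rewrite (@negligible_integral _ _ _ leb _ N)//; last exact: sub.
apply: ge0_le_integral_subset => t; last by rewrite lee_fin normr_ge0.
move=> [/= + Nt]; rewrite !in_itv/= => /andP[at_ tb].
have tab : t \in `]a, b[.
  rewrite in_itv/= at_ lt_neqAle tb andbT; apply/eqP => tE.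
  by apply: Nt; right.
rewrite (ltW at_) tb; split => //; rewrite ?lee_fin ?normr_ge0//.
have -> : derive1 A t = p t.
  by apply: contra_notP Nt => H; left; left; apply: bad1 => /(_ tab).
have -> // : derive1 B t = q t.
by apply: contra_notP Nt => H; left; right; apply: bad2 => /(_ tab).
Qed.

End VariationControl.

(** * Lifts of circle maps to the line *)

Section Lifts.
Context {R : realType}.
Implicit Types (F G : R -> R) (f g h : bijection (circle R)) (x y : R) (n : int).

Lemma to_circleP x y : to_circle x = to_circle y <-> exists n, x = y + n%:~R.
Proof.
have -> : to_circle x = to_circle y <-> x - y \is a Num.int.
  rewrite /to_circle; split.
    by move/eqP; rewrite -Quotient.idealrBE.
  by move=> H; apply/eqP; rewrite -Quotient.idealrBE.
split=> [/intrP[n xy]|[n ->]]; first by exists n; rewrite -xy; ring.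
by rewrite addrAC subrr add0r; apply/intrP; exists n.
Qed.

Lemma to_circleD_int x n : to_circle (x + n%:~R) = to_circle x.
Proof. by apply/to_circleP; exists n. Qed.

Lemma to_circle1 x : to_circle (x + 1) = to_circle x.
Proof. exact: (to_circleD_int x 1). Qed.

Lemma reprK_circle (p : circle R) : to_circle (repr p) = p.
Proof. exact: reprK. Qed.

Lemma repr_to_circle x : exists n, repr (to_circle x) = x + n%:~R.
Proof. by apply/to_circleP; rewrite reprK_circle. Qed.

Lemma to_circleB x y : to_circle (x - y) = to_circle x - to_circle y.
Proof. by rewrite /to_circle !piE. Qed.

(** A change of value would make the intermediate value theorem produce [l + 1/2] for some integer
    [l]. *)
Lemma continuous_int_valued_cst F : continuous F ->
  (forall x, exists n, F x = n%:~R) -> forall x y, F x = F y.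
Proof.
move=> cF Fint; suff le x y : x <= y -> F x = F y.
  move=> x y; have [/le//|/ltW yx] := leP x y; exact/esym/le.
move=> xy; apply/eqP/negP => /negP FN.
have [m Fx] := Fint x; have [k Fy] := Fint y.
have mk : m != k by apply: contra FN => /eqP mk; rewrite Fx Fy mk.
have [l [lmin lmax]] : exists l : int,
    Num.min (F x) (F y) <= l%:~R /\ (l + 1)%:~R <= Num.max (F x) (F y).
  have [mk'|km|/eqP] := ltgtP m k; last by rewrite (negPf mk).
    by exists m; rewrite Fx Fy ge_min le_max lexx !ler_int !lezD1 mk' orbT.
  by exists k; rewrite Fx Fy ge_min le_max lexx orbT !ler_int !lezD1 km.
rewrite intrD in lmax.
have midv : Num.min (F x) (F y) <= l%:~R + 2^-1 <= Num.max (F x) (F y).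
  by apply/andP; split; lra.
have [z _ Fz] := IVT xy (continuous_subspaceT cF) midv.
have [j Fj] := Fint z.
have : (2 * j)%:~R = (2 * l + 1)%:~R :> R.
  by rewrite intrD !intrM -Fj Fz; lra.
by move/eqP; rewrite eqr_int => /eqP; lia.
Qed.

Lemma is_lift_uniq F G f : is_lift F f -> is_lift G f ->
  exists n, forall x, G x = F x + n%:~R.
Proof.
move=> [cF Ff] [cG Gf].
have int x : exists n, G x - F x = n%:~R.
  have /to_circleP[n ->] : to_circle (G x) = to_circle (F x) by rewrite Gf Ff.
  by exists n; ring.
have cGF : continuous (fun x => G x - F x).
  by move=> x; apply: cvgB; [exact: cG|exact: cF].
have cst := continuous_int_valued_cst cGF int.
have [n n0] := int 0; exists n => x.
by rewrite -n0 (cst 0 x); ring.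
Qed.

Lemma is_lift_lift F f : is_lift F f -> is_lift (Defs.lift f) f.
Proof.
by move=> Ff; apply: (@xgetPex _ _ [set G | is_lift G f]); exists F.
Qed.

Lemma liftE F f : is_lift F f -> exists n, forall x, Defs.lift f x = F x + n%:~R.
Proof. by move=> Ff; apply: (is_lift_uniq Ff); exact: is_lift_lift Ff. Qed.

Lemma is_lift_comp F G f g : is_lift F f -> is_lift G g ->
  is_lift (F \o G) (f * g)%g.
Proof.
move=> [cF Ff] [cG Gg]; split=> [x|x /=]; last by rewrite Ff Gg.
by apply: continuous_comp; [exact: cG|exact: cF].
Qed.

Lemma is_lift_one : is_lift (@idfun R) 1%g.
Proof. by split=> // x; exact: cvg_id. Qed.

Lemma lift_increasing f : orientation_preserving f ->
  {homo Defs.lift f : x y / x < y}.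
Proof.
by move=> [F [Ff Finc]] x y xy; have [n E] := liftE Ff; rewrite !E ltrD2r Finc.
Qed.

Lemma op_lift f : orientation_preserving f -> is_lift (Defs.lift f) f.
Proof. by move=> [F [Ff _]]; exact: is_lift_lift Ff. Qed.

Lemma bijection_inj (T : Type) (u : bijection T) : injective u.
Proof. exact: can_inj (@bij_funK _ u). Qed.

(* An increasing lift of degree at least two would take the value F x + 1
   strictly inside [x, x + 1], against injectivity. *)
Lemma increasing_lift1 F f x : is_lift F f -> {homo F : x y / x < y} ->
  F (x + 1) = F x + 1.
Proof.
move=> [cF Ff] Finc.
have : to_circle (F (x + 1)) = to_circle (F x) by rewrite !Ff to_circle1.
move=> /to_circleP[n Fn]; have lt1 : F x < F (x + 1) by apply: Finc; rewrite ltrDl.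
have n1 : 1 <= n.
  by rewrite -gtz0_ge1 -(ltr_int R); move: lt1; rewrite Fn ltrDl.
have n1R : 1 <= n%:~R :> R by rewrite -[1]/(1%:~R) ler_int.
have x1 : x <= x + 1 by rewrite lerDl.
have mid : Num.min (F x) (F (x + 1)) <= F x + 1 <= Num.max (F x) (F (x + 1)).
  apply/andP; split; first by rewrite ge_min lerDl ler01.
  by rewrite le_max Fn; apply/orP; right; rewrite lerD2l.
have [y] := IVT x1 (continuous_subspaceT cF) mid.
rewrite in_itv/= => /andP[xy yx1] Fy.
have : to_circle y = to_circle x.
  by apply: (@bijection_inj _ f); rewrite -!Ff Fy to_circle1.
move=> /to_circleP[m ym].
have m0 : 0 <= m by rewrite -(ler_int R) -(lerD2l x) addr0 -ym.
have m1 : m <= 1 by rewrite -(ler_int R) -(lerD2l x) -ym.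
have [mE|mE] : m = 0 \/ m = 1 by lia.
  by move: Fy; rewrite ym mE addr0; lra.
by rewrite -Fy ym mE.
Qed.

Lemma lift1 f x : orientation_preserving f ->
  Defs.lift f (x + 1) = Defs.lift f x + 1.
Proof.
by move=> fop; apply: increasing_lift1 (op_lift fop) (lift_increasing fop).
Qed.

Lemma op_one : orientation_preserving (1%g : bijection (circle R)).
Proof. by exists idfun; split; [exact: is_lift_one|]. Qed.

Lemma op_mul f g : orientation_preserving f -> orientation_preserving g ->
  orientation_preserving (f * g)%g.
Proof.
move=> [F [Ff Finc]] [G [Gg Ginc]]; exists (F \o G); split.
  exact: is_lift_comp.
by move=> x y /Ginc/Finc.
Qed.

Lemma lift_mul f g : orientation_preserving f -> orientation_preserving g ->
  exists n, forall x,
    Defs.lift (f * g)%g x = Defs.lift f (Defs.lift g x) + n%:~R.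
Proof.
by move=> /op_lift Ff /op_lift Gg; have := liftE (is_lift_comp Ff Gg).
Qed.

End Lifts.

(** * Calculus of C^k functions *)

Section CkCalculus.
Context {R : realType}.
Implicit Types (F G : R -> R) (k : nat) (x c l : R).

Lemma derivable_is_derive1 F x : derivable F x 1 -> is_derive x 1 F (derive1 F x).
Proof. by move=> dF; rewrite derive1E; exact/derivableP. Qed.

Lemma is_derive_derive1 F x l : is_derive x 1 F l -> derive1 F x = l.
Proof. by move=> dF; rewrite derive1E derive_val. Qed.

Lemma is_derive_derivable F x l : is_derive x 1 F l -> derivable F x 1.
Proof. by case. Qed.

Lemma derivable_continuous F : (forall x, derivable F x 1) -> continuous F.
Proof. by move=> dF x; apply/differentiable_continuous/derivable1_diffP. Qed.

Lemma derive1nSr j F : derive1n j.+1 F = derive1n j (derive1 F).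
Proof. by elim: j => [|j IH]; rewrite ?derive1n1 ?derive1n0// derive1nS IH derive1nS. Qed.

Lemma CkS k F : Ck k.+1 F <-> (forall x, derivable F x 1) /\ Ck k (derive1 F).
Proof.
split=> [[dF cF]|[dF [dF' cF']]].
  split; first by move=> x; have := dF 0 isT x; rewrite derive1n0.
  split=> [j jk x|]; rewrite -derive1nSr//; exact: dF.
split=> [[|j] jk x|]; rewrite ?derive1n0 ?derive1nSr//; exact: dF'.
Qed.

Lemma Ck0 F : Ck 0 F <-> continuous F.
Proof. by rewrite /Ck derive1n0; split=> [[]|]. Qed.

Lemma CkW k F : Ck k.+1 F -> Ck k F.
Proof.
elim: k F => [|k IH] F /CkS[dF kF].
  by apply/Ck0; exact: derivable_continuous.
by apply/CkS; split=> //; exact: IH.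
Qed.

Lemma Ck_le j k F : (j <= k)%N -> Ck k F -> Ck j F.
Proof.
move=> jk; rewrite -(subnK jk); elim: (k - j)%N => // n IH H.
exact/IH/CkW.
Qed.

Lemma CkD k F G : Ck k F -> Ck k G -> Ck k (fun x => F x + G x).
Proof.
elim: k F G => [|k IH] F G.
  move=> /Ck0 cF /Ck0 cG; apply/Ck0 => x.
  by apply: cvgD; [exact: cF|exact: cG].
move=> /CkS[dF kF] /CkS[dG kG]; apply/CkS.
have FG x : is_derive x 1 (fun x => F x + G x) (derive1 F x + derive1 G x).
  by apply: is_deriveD; exact: derivable_is_derive1.
split=> [x|]; first exact: is_derive_derivable.
rewrite (_ : derive1 _ = fun x => derive1 F x + derive1 G x); first exact: IH.
by apply/funext => x; apply: is_derive_derive1.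
Qed.

Lemma CkM k F G : Ck k F -> Ck k G -> Ck k (fun x => F x * G x).
Proof.
elim: k F G => [|k IH] F G.
  move=> /Ck0 cF /Ck0 cG; apply/Ck0 => x.
  by apply: cvgM; [exact: cF|exact: cG].
move=> kF' kG'; have [dF kF] := (CkS _ _).1 kF'; have [dG kG] := (CkS _ _).1 kG'.
have FG x : is_derive x 1 (fun x => F x * G x)
    (F x * derive1 G x + G x * derive1 F x).
  by apply: is_deriveM; exact: derivable_is_derive1.
apply/CkS; split=> [x|]; first exact: is_derive_derivable.
rewrite (_ : derive1 _ = fun x => F x * derive1 G x + G x * derive1 F x).
  by apply: CkD; apply: IH => //; exact: CkW.
by apply/funext => x; apply: is_derive_derive1.
Qed.

Lemma Ck_comp k F G : Ck k F -> Ck k G -> Ck k (F \o G).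
Proof.
elim: k F G => [|k IH] F G.
  move=> /Ck0 cF /Ck0 cG; apply/Ck0 => x.
  by apply: continuous_comp; [exact: cG|exact: cF].
move=> kF' kG'; have [dF kF] := (CkS _ _).1 kF'; have [dG kG] := (CkS _ _).1 kG'.
have FG x : is_derive x 1 (F \o G) (derive1 F (G x) * derive1 G x).
  by apply: is_derive1_comp; exact: derivable_is_derive1.
apply/CkS; split=> [x|]; first exact: is_derive_derivable.
rewrite (_ : derive1 _ = fun x => (derive1 F \o G) x * derive1 G x).
  by apply: CkM => //; apply: IH => //; exact: CkW.
by apply/funext => x; apply: is_derive_derive1.
Qed.

Lemma Ck_cst k c : Ck k (cst c : R -> R).
Proof.
elim: k c => [|k IH] c; first by apply/Ck0; exact: cst_continuous.
apply/CkS; split=> [x|]; first exact: derivable_cst.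
rewrite (_ : derive1 _ = cst (0 : R)); first exact: IH.
by apply/funext => x; exact: derive1_cst.
Qed.

Lemma Ck_id k : Ck k (@idfun R).
Proof.
case: k => [|k]; first by apply/Ck0 => x; exact: cvg_id.
have d1 x : is_derive x 1 (@idfun R) 1 by exact: is_derive_id.
apply/CkS; split=> [x|]; first exact: is_derive_derivable.
rewrite (_ : derive1 _ = cst (1 : R)); first exact: Ck_cst.
by apply/funext => x; apply: is_derive_derive1.
Qed.

Lemma is_derive_addc F x l c : is_derive x 1 F l ->
  is_derive x 1 (fun y => F y + c) l.
Proof.
move=> dF; rewrite -[l]addr0.
by apply: is_deriveD => //; exact: is_derive_cst.
Qed.

(** The difference quotients at [x + t] and at [x] are the same function, so the limits agree even
    where they take a default value, as the derivative of [dlift f] may. *)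
Lemma derive1_translate F (t c : R) : (forall x, F (x + t) = F x + c) ->
  forall x, derive1 F (x + t) = derive1 F x.
Proof.
move=> Ft x; rewrite /derive1; congr (lim _).
rewrite (_ : (fun h => h^-1 *: (F (h + (x + t)) - F (x + t))) =
  (fun h => h^-1 *: (F (h + x) - F x)))//.
by apply/funext => h; rewrite addrA !Ft; congr (_ *: _); ring.
Qed.

End CkCalculus.

(** * Derivatives of lifts and the chain rule *)

Section LiftDerivative.
Context {R : realType}.
Implicit Types (F G : R -> R) (f g h : bijection (circle R)) (x y : R) (n : int).

Definition dlift f : R -> R := derive1 (Defs.lift f).

Lemma Ck_lift k f : Ck_map k f -> Ck k (Defs.lift f).
Proof.
move=> [F [Ff kF]]; have [n E] := liftE Ff.
rewrite (_ : Defs.lift f = fun x => F x + n%:~R); last exact/funext.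
by apply: CkD => //; exact: Ck_cst.
Qed.

Lemma Diffk_le j k f : (j <= k)%N -> Diffk k f -> Diffk j f.
Proof.
move=> jk [fop [F [Ff kF]] [G [Gf kG]]]; split=> //.
- by exists F; split=> //; exact: Ck_le kF.
- by exists G; split=> //; exact: Ck_le kG.
Qed.

Lemma Diffk_one k : Diffk k (1%g : bijection (circle R)).
Proof.
have one : Ck_map k (1%g : bijection (circle R)).
  by exists idfun; split; [exact: is_lift_one|exact: Ck_id].
by split; rewrite ?invg1//; exact: op_one.
Qed.

Lemma Diffk_mul k f g : Diffk k f -> Diffk k g -> Diffk k (f * g)%g.
Proof.
move=> [fop [F [Ff kF]] [F' [Ff' kF']]] [gop [G [Gg kG]] [G' [Gg' kG']]].
split; first exact: op_mul.
  by exists (F \o G); split; [exact: is_lift_comp|exact: Ck_comp].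
exists (G' \o F'); split; last exact: Ck_comp.
by rewrite invgM; exact: is_lift_comp.
Qed.

Lemma op_inv f : orientation_preserving f -> (exists G, is_lift G f^-1%g) ->
  orientation_preserving f^-1%g.
Proof.
move=> fop [G Gf]; exists G; split=> //.
have [n GF] : exists n, forall x, Defs.lift f (G x) = x + n%:~R.
  apply: (is_lift_uniq (is_lift_one (R := R))).
  by rewrite -(mulgV f); apply: is_lift_comp => //; exact: op_lift.
move=> x y xy; rewrite ltNge; apply/negP => yx.
have : Defs.lift f (G y) <= Defs.lift f (G x).
  by move: yx; rewrite le_eqVlt => /predU1P[->//|/(lift_increasing fop)/ltW].
by rewrite !GF lerD2r leNgt xy.
Qed.

Lemma Diffk_inv k f : Diffk k f -> Diffk k f^-1%g.
Proof.
move=> [fop fk fk']; split; rewrite ?invgK//.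
by apply: op_inv => //; have [G [Gf _]] := fk'; exists G.
Qed.

Lemma derivable_lift f x : Diffk 1 f -> derivable (Defs.lift f) x 1.
Proof. by move=> [_ /Ck_lift/CkS[]]. Qed.

Lemma is_derive_lift f x : Diffk 1 f -> is_derive x 1 (Defs.lift f) (dlift f x).
Proof. by move=> f1; apply: derivable_is_derive1; exact: derivable_lift. Qed.

Lemma dlift_continuous f : Diffk 1 f -> continuous (dlift f).
Proof. by move=> [_ /Ck_lift/CkS[_ /Ck0]]. Qed.

Lemma dliftD_int f x n : Diffk 1 f -> dlift f (x + n%:~R) = dlift f x.
Proof.
move=> [fop _ _]; have [m E] : exists m, forall y,
    Defs.lift f (y + n%:~R) = Defs.lift f y + m%:~R.
  apply: (is_lift_uniq (op_lift fop)); have [cF Ff] := op_lift fop.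
  split=> [y|y]; last by rewrite Ff to_circleD_int.
  apply: (@continuous_comp _ _ _ (fun y => y + n%:~R) (Defs.lift f)) (cF _).
  by apply: cvgD; [exact: cvg_id|exact: cvg_cst].
exact: derive1_translate E x.
Qed.

Lemma dlift1 f x : Diffk 1 f -> dlift f (x + 1) = dlift f x.
Proof. exact: (@dliftD_int f x 1). Qed.

Lemma dlift_mul f g x : Diffk 1 f -> Diffk 1 g ->
  dlift (f * g)%g x = dlift f (Defs.lift g x) * dlift g x.
Proof.
move=> f1 g1; have [fop _ _] := f1; have [gop _ _] := g1.
have [n E] := lift_mul fop gop.
apply: is_derive_derive1.
rewrite (_ : Defs.lift _ = fun x => (Defs.lift f \o Defs.lift g) x + n%:~R).
  by apply/is_derive_addc/is_derive1_comp; exact: is_derive_lift.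
exact/funext.
Qed.

Lemma dlift_one x : dlift 1%g x = 1.
Proof.
have [n E] := liftE (is_lift_one (R := R)).
apply: is_derive_derive1; rewrite (_ : Defs.lift _ = fun x => x + n%:~R).
  by apply: is_derive_addc; exact: is_derive_id.
exact/funext.
Qed.

Lemma dlift_gt0 f x : Diffk 1 f -> 0 < dlift f x.
Proof.
move=> f1; have [fop _ _] := f1; rewrite lt_neqAle; apply/andP; split.
  have := dlift_one x; rewrite -(mulVg f) dlift_mul//; last exact: Diffk_inv.
  move=> H; apply/eqP => f0.
  by move: H; rewrite -f0 mulr0 => /eqP; rewrite eq_sym oner_eq0.
apply: (@incr_derive1_ge0_itv _ (Defs.lift f) true false (x - 1) (x + 1)).
- by move=> y _; exact: derivable_lift.
- by move=> y z _ _; exact: lift_increasing.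
- by rewrite in_itv/=; apply/andP; split; lra.
Qed.

Lemma circle_derive1E f x : Diffk 1 f -> circle_derive 1 f (to_circle x) = dlift f x.
Proof.
move=> f1; rewrite /circle_derive; have [n ->] := repr_to_circle x.
by rewrite derive1n1; exact: dliftD_int.
Qed.

Lemma circle_derive2E f x : Diffk 1 f ->
  circle_derive 2 f (to_circle x) = derive1 (dlift f) x.
Proof.
move=> f1; rewrite /circle_derive; have [n ->] := repr_to_circle x.
rewrite derive1nSr derive1n1 -/(dlift f).
by apply: (@derive1_translate _ _ n%:~R 0) => y; rewrite addr0 dliftD_int.
Qed.

End LiftDerivative.

(** * Variation of periodic functions *)

Section CircleVariation.
Context {R : realType}.
Implicit Types (psi chi H W : R -> R) (v w : nat -> R) (n : nat) (M : R).

(* The intervals [v i, w i], for i < n, are arranged in increasing order within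
   one turn of the circle; functions on the circle are 1-periodic functions. *)
Definition turn v w n : Prop :=
  (forall i, v i <= w i <= v i.+1) /\ v n <= v 0%N + 1.

Definition turn_sum psi v w n : R := \sum_(i < n) `|psi (w i) - psi (v i)|.

Definition turn_sums psi : set R :=
  [set x | exists v w n, turn v w n /\ x = turn_sum psi v w n].

Definition circle_bv psi : Prop := has_ubound (turn_sums psi).

Definition circle_var psi : R := sup (turn_sums psi).

Lemma turn_sums_nonempty psi : turn_sums psi !=set0.
Proof.
exists (turn_sum psi (cst 0) (cst 0) 0); exists (cst 0), (cst 0), 0%N.
by split=> //; split=> [i /=|/=]; rewrite ?lexx// add0r.
Qed.

Lemma circle_var_ge psi v w n : circle_bv psi -> turn v w n ->
  turn_sum psi v w n <= circle_var psi.
Proof. by move=> bv t; apply: ub_le_sup => //; exists v, w, n. Qed.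

Lemma circle_var_le psi M : (forall v w n, turn v w n -> turn_sum psi v w n <= M) ->
  circle_var psi <= M.
Proof.
move=> H; apply: ge_sup; first exact: turn_sums_nonempty.
by move=> _ [v [w [n [t ->]]]]; exact: H.
Qed.

Lemma circle_bv_le psi M : (forall v w n, turn v w n -> turn_sum psi v w n <= M) ->
  circle_bv psi.
Proof. by move=> H; exists M => _ [v [w [n [t ->]]]]; exact: H. Qed.

Lemma circle_var_ge0 psi : 0 <= circle_var psi.
Proof.
have [bv|nbv] := pselect (circle_bv psi); last first.
  by rewrite /circle_var sup_out// => -[_ /nbv].
have t : @turn (cst 0) (cst 0) 0.
  by split=> [i /=|/=]; rewrite ?lexx// add0r.
by have := circle_var_ge bv t; rewrite /turn_sum big_ord0.
Qed.

Lemma circle_var0 : circle_var (fun=> 0) = 0.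
Proof.
apply/eqP; rewrite eq_le circle_var_ge0 andbT; apply: circle_var_le => v w n _.
by rewrite /turn_sum big1// => i _; rewrite subrr normr0.
Qed.

Lemma turn_sumN psi v w n : turn_sum (fun x => - psi x) v w n = turn_sum psi v w n.
Proof. by apply: eq_bigr => i _; rewrite -opprD normrN. Qed.

Lemma circle_varN psi : circle_var (fun x => - psi x) = circle_var psi.
Proof.
rewrite /circle_var; congr sup; apply/seteqP; split=> x.
  by move=> [v [w [n [t ->]]]]; exists v, w, n; rewrite turn_sumN.
by move=> [v [w [n [t ->]]]]; exists v, w, n; rewrite turn_sumN.
Qed.

Lemma turn_sumD psi chi v w n :
  turn_sum (fun x => psi x + chi x) v w n <= turn_sum psi v w n + turn_sum chi v w n.
Proof.
rewrite /turn_sum -big_split/=; apply: ler_sum => i _.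
by rewrite opprD addrACA; exact: ler_normD.
Qed.

Lemma circle_bvD psi chi : circle_bv psi -> circle_bv chi ->
  circle_bv (fun x => psi x + chi x).
Proof.
move=> bp bc; apply: (@circle_bv_le _ (circle_var psi + circle_var chi)).
move=> v w n t; apply: le_trans (turn_sumD _ _ _ _ _) _.
by apply: lerD; exact: circle_var_ge.
Qed.

Lemma circle_bvN psi : circle_bv psi -> circle_bv (fun x => - psi x).
Proof.
move=> bp; apply: (@circle_bv_le _ (circle_var psi)) => v w n t.
by rewrite turn_sumN; exact: circle_var_ge.
Qed.

Lemma circle_varD psi chi : circle_bv psi -> circle_bv chi ->
  circle_var (fun x => psi x + chi x) <= circle_var psi + circle_var chi.
Proof.
move=> bp bc; apply: circle_var_le => v w n t.
apply: le_trans (turn_sumD _ _ _ _ _) _.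
by apply: lerD; exact: circle_var_ge.
Qed.

Lemma turn_reparam H v w n : {homo H : x y / x <= y} ->
  (forall x, H (x + 1) = H x + 1) -> turn v w n -> turn (H \o v) (H \o w) n.
Proof.
move=> Hnd H1 [vw vn]; split=> [i|]; last by rewrite /= -H1 Hnd.
by have /andP[vwi wvi] := vw i; rewrite /= !Hnd.
Qed.

(** Turns may begin at any point of the line, so a monotone map commuting with the unit translation
    carries turns to turns; [H'] provides the inclusion in the other direction. *)
Lemma circle_var_reparam psi H H' : {homo H : x y / x <= y} ->
  {homo H' : x y / x <= y} -> (forall x, H (x + 1) = H x + 1) ->
  (forall x, H' (x + 1) = H' x + 1) -> cancel H' H ->
  circle_var (psi \o H) = circle_var psi.
Proof.
move=> Hnd H'nd H1 H'1 H'K; rewrite /circle_var; congr sup; apply/seteqP; split.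
  move=> _ [v [w [n [t ->]]]]; exists (H \o v), (H \o w), n.
  by split=> //; exact: turn_reparam.
move=> _ [v [w [n [t ->]]]]; exists (H' \o v), (H' \o w), n.
split; first exact: turn_reparam.
by apply: eq_bigr => i _ /=; rewrite !H'K.
Qed.

Lemma turn_le v w n i : turn v w n -> (i < n)%N -> w i <= v i + 1.
Proof.
move=> [vw vn] iN.
have vnd : {homo v : i j / (i <= j)%N >-> i <= j}.
  apply: homo_leq => [x|x y z|j]; [exact: lexx|exact: le_trans|].
  by have /andP[] := vw j; exact: le_trans.
have /andP[_ wv] := vw i; apply: le_trans wv _; apply: le_trans (vnd _ _ iN) _.
by apply: le_trans vn _; rewrite lerD2r vnd.
Qed.

(* Intervals of length at most 1 are all that occurs in a turn, so they meet at
   most one integer. *)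
Lemma turn_sum_control psi W v w n :
  (forall x, psi (x + 1) = psi x) ->
  (forall x y : R, 0 <= x -> x <= y -> y <= 1 -> `|psi y - psi x| <= W y - W x) ->
  turn v w n -> turn_sum psi v w n <= W 1 - W 0.
Proof.
move=> psi1 psiW t.
have psiz x (m : int) : psi (x + m%:~R) = psi x.
  have nat k y : psi (y + k%:R) = psi y.
    elim: k y => [|k IH] y; first by rewrite addr0.
    by rewrite -natr1 addrA psi1 IH.
  case: m => k; first exact: nat.
  rewrite NegzE mulrNz.
  by have := nat k.+1 (x - k.+1%:R); rewrite subrK => ->.
have intS1 (m : int) : (m + 1)%:~R = m%:~R + 1 :> R by rewrite intrD.
pose fl (x : R) : int := Num.floor x.
have flP x : (fl x)%:~R <= x < (fl x)%:~R + 1.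
  by have := floor_itv x; rewrite intS1.
(* [V] continues [W] from [[0, 1]] to the line so that a unit translation adds [W 1 - W 0]; the sum
   over a turn then telescopes. *)
pose V x := W (x - (fl x)%:~R) + (fl x)%:~R * (W 1 - W 0).
have VE x (m : int) : m%:~R <= x < m%:~R + 1 ->
    V x = W (x - m%:~R) + m%:~R * (W 1 - W 0).
  move=> mx; have -> // : V x = W (x - m%:~R) + m%:~R * (W 1 - W 0).
  by rewrite /V /fl (floor_def (m := m))// intS1.
have V1 x : V (x + 1) = V x + (W 1 - W 0).
  have /andP[h1 h2] := flP x; rewrite (VE (x + 1) (fl x + 1)); last first.
    by rewrite intS1; apply/andP; split; lra.
  by rewrite intS1 /V (_ : x + 1 - _ = x - (fl x)%:~R); last ring; ring.
have Vle1 x y (m : int) : m%:~R <= x -> x <= y -> y <= m%:~R + 1 ->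
    `|psi y - psi x| <= W (y - m%:~R) - W (x - m%:~R).
  move=> mx xy ym; rewrite -(psiz y (- m)) -(psiz x (- m)) mulrNz.
  by apply: psiW; lra.
have VP x y : x <= y -> y <= x + 1 -> `|psi y - psi x| <= V y - V x.
  move=> xy yx1; have /andP[h1 h2] := flP x; set m := fl x in h1 h2.
  rewrite (VE x m) ?h1 ?h2//.
  have [ym|my] := ltP y (m%:~R + 1).
    rewrite (VE y m); last by apply/andP; split; lra.
    rewrite [leRHS](_ : _ = W (y - m%:~R) - W (x - m%:~R)); last by ring.
    by apply: Vle1; lra.
  rewrite (VE y (m + 1)); last by rewrite intS1; apply/andP; split; lra.
  rewrite (_ : psi y - psi x =
    (psi y - psi (m + 1)%:~R) + (psi (m + 1)%:~R - psi x)); last by ring.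
  apply: le_trans (ler_normD _ _) _.
  have h3 := Vle1 (m + 1)%:~R y (m + 1); have h4 := Vle1 x (m + 1)%:~R m.
  rewrite subrr intS1 in h3; rewrite intS1 in h4.
  have {}h3 := h3 (lexx _) my ltac:(lra).
  have {}h4 := h4 h1 ltac:(lra) (lexx _).
  rewrite !intS1; move: h3 h4.
  rewrite (_ : m%:~R + 1 - m%:~R = 1); last by ring.
  by lra.
apply: (@le_trans _ _ (\sum_(i < n) (V (v i.+1) - V (v i)))).
  apply: ler_sum => i _; have /andP[vw wv] := t.1 i.
  have := VP _ _ vw (turn_le t (ltn_ord i)).
  have : 0 <= V (v i.+1) - V (w i).
    apply: le_trans (normr_ge0 _) (VP _ _ wv _).
    have vnd : {homo v : i j / (i <= j)%N >-> i <= j}.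
      apply: homo_leq => [x|x y z|j]; [exact: lexx|exact: le_trans|].
      by have /andP[] := t.1 j; exact: le_trans.
    apply: le_trans (vnd _ _ (ltn_ord i)) _; apply: le_trans t.2 _.
    by rewrite lerD2r (le_trans (vnd _ _ (leq0n i))).
  by lra.
rewrite -(big_mkord xpredT (fun i => V (v i.+1) - V (v i))) telescope_sumr//.
have vnd : v 0%N <= v n.
  elim: (n) => // k /le_trans; apply.
  by have /andP[] := t.1 k; exact: le_trans.
have h : V (v n) <= V (v 0%N + 1).
  rewrite -subr_ge0; apply: le_trans (normr_ge0 _) (VP _ _ t.2 _).
  by rewrite lerD2r.
by rewrite lerBlDr (le_trans h)// V1 addrC.
Qed.

End CircleVariation.

(** * The logarithmic variation as a pseudometric *)

Section LogVariation.
Context {R : realType}.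
Implicit Types (f g h : bijection (circle R)) (H : set (bijection (circle R))).

(** For absolutely continuous derivatives this is the integral of |f''/f' - g''/g'|. *)
Definition log_var f g : R :=
  circle_var (fun x => ln (dlift f x) - ln (dlift g x)).

Lemma log_var_xx f : log_var f f = 0.
Proof.
rewrite /log_var (_ : (fun x => _) = fun=> 0); first exact: circle_var0.
by apply/funext => x; rewrite subrr.
Qed.

Lemma log_var_sym f g : log_var f g = log_var g f.
Proof.
rewrite -[RHS]circle_varN; congr circle_var.
by apply/funext => x; rewrite opprB.
Qed.

Lemma circle_bv_log_ratio f g : circle_bv (fun x => ln (dlift f x)) ->
  circle_bv (fun x => ln (dlift g x)) -> circle_bv (fun x => ln (dlift f x) - ln (dlift g x)).
Proof. by move=> bf bg; apply: circle_bvD => //; exact: circle_bvN. Qed.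

Lemma log_var_triangle f g h : circle_bv (fun x => ln (dlift f x)) ->
  circle_bv (fun x => ln (dlift g x)) -> circle_bv (fun x => ln (dlift h x)) ->
  log_var f h <= log_var f g + log_var g h.
Proof.
move=> bf bg bh.
apply: le_trans (circle_varD (circle_bv_log_ratio bf bg) (circle_bv_log_ratio bg bh)).
rewrite le_eqVlt; apply/orP; left; apply/eqP; congr circle_var.
apply/funext => x.
by move: (ln (dlift f x)) (ln (dlift g x)) (ln (dlift h x)) => a b c; ring.
Qed.

(** By the chain rule the terms [ln h'] cancel, and what is left is [ln f' - ln g'] precomposed with
    the lift of [h]. *)
Lemma log_var_right_invariant f g h : Diffk 1 f -> Diffk 1 g -> Diffk 1 h ->
  log_var (f * h)%g (g * h)%g = log_var f g.
Proof.
move=> f1 g1 h1; have [hop _ _] := h1.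
have [h'op _ _] := Diffk_inv h1.
have [n E] : exists n : int, forall x, Defs.lift h (Defs.lift h^-1%g x) = x + n%:~R.
  apply: (is_lift_uniq (is_lift_one (R := R))).
  by rewrite -(mulgV h); apply: is_lift_comp; exact: op_lift.
have ndl (u : bijection (circle R)) : orientation_preserving u ->
    {homo Defs.lift u : x y / x <= y}.
  move=> uop x y; rewrite le_eqVlt => /predU1P[->//|/(lift_increasing uop)].
  exact: ltW.
(* The chosen lifts of [h] and its inverse are inverse to each other only up to the integer [n],
   which is corrected here. *)
pose H' x := Defs.lift h^-1%g (x - n%:~R).
rewrite -[RHS](@circle_var_reparam _ _ (Defs.lift h) H').
- congr circle_var; apply/funext => x; rewrite !dlift_mul//.
  have d1 := dlift_gt0 x h1; have d2 := dlift_gt0 (Defs.lift h x) f1.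
  have d3 := dlift_gt0 (Defs.lift h x) g1.
  rewrite !lnM//=.
  move: (ln (dlift h x)) (ln (dlift f _)) (ln (dlift g _)) => a b c.
  by ring.
- exact: ndl.
- by move=> x y xy; apply: ndl => //; rewrite lerD2r.
- by move=> x; exact: lift1.
- by move=> x; rewrite /H' addrAC lift1.
- by move=> x; rewrite /H' E subrK.
Qed.

(** [Hnear] speaks of one variable moving away from the diagonal; the triangle inequality turns it
    into joint continuity. *)
Lemma log_variation_admissible H (r : bijection (circle R) -> bijection (circle R) -> \bar R) :
  (forall f, H f -> Diffk 1 f) ->
  (forall f, H f -> circle_bv (fun x => ln (dlift f x))) ->
  (forall f, H f -> forall e, 0 < e -> exists2 delta, 0 < delta &
    forall g, H g -> (r f g < delta%:E)%E -> log_var f g < e) ->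
  admissible H r log_var.
Proof.
move=> H1 Hbv Hnear; split.
- split.
  + by move=> f g _ _; exact: circle_var_ge0.
  + by move=> f _; exact: log_var_xx.
  + by move=> f g _ _; exact: log_var_sym.
  + by move=> f g h Hf Hg Hh; apply: log_var_triangle; exact: Hbv.
- by move=> f g h Hf Hg Hh; apply: log_var_right_invariant; exact: H1.
move=> f g Hf Hg U /nbhs_ballP[e /= e0 eU].
have e20 : 0 < e / 2 by rewrite divr_gt0.
have [d1 d10 near1] := Hnear f Hf _ e20.
have [d2 d20 near2] := Hnear g Hg _ e20.
exists ([set f' | H f' /\ (r f f' < d1%:E)%E], [set g' | H g' /\ (r g g' < d2%:E)%E]).
  by split; [exists d1|exists d2].
move=> [f' g'] [/= [Hf' rf] [Hg' rg]].
have {}near1 := near1 f' Hf' rf; have {}near2 := near2 g' Hg' rg.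
have bf := Hbv _ Hf; have bf' := Hbv _ Hf'.
have bg := Hbv _ Hg; have bg' := Hbv _ Hg'.
have t1 := log_var_triangle bf bf' bg; have t2 := log_var_triangle bf' bg' bg.
have t3 := log_var_triangle bf' bf bg'; have t4 := log_var_triangle bf bg bg'.
rewrite (log_var_sym g' g) in t2; rewrite (log_var_sym f' f) in t3.
apply: eU; rewrite /ball /= ltr_norml.
move: near1 near2 t1 t2 t3 t4; clear; move: (log_var f g) (log_var f' g').
move: (log_var f f') (log_var g g') (log_var f' g) (log_var f g') => a b p q u v.
by move=> *; apply/andP; split; lra.
Qed.

End LogVariation.

(** * Linear growth and quasi-isometric embedding of cyclic groups *)

Section CyclicEmbedding.
Context {R : realType} {G : groupType}.
Variables (H : set G) (r : G -> G -> \bar R).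
Implicit Types (d s : G -> G -> R) (f : G) (m n : int) (k : nat).

Lemma zexpS f n : zexp f (n + 1) = (f * zexp f n)%g.
Proof.
case: n => k; first by rewrite -PoszD addn1 /= expgS.
case: k => [|k]; first by rewrite /= expg1 mulgV.
rewrite (_ : Negz k.+1 + 1 = Negz k); last by rewrite !NegzE; lia.
by rewrite /= [(f ^+ k.+2)%g]expgSr invgM mulgA mulgV mul1g.
Qed.

Lemma zexpP f n : zexp f (n - 1) = (f^-1 * zexp f n)%g.
Proof. by rewrite -[n in RHS](subrK 1) zexpS mulgA mulVg mul1g. Qed.

Lemma zexpD f m n : zexp f (m + n) = (zexp f m * zexp f n)%g.
Proof.
elim/int_rect: m => [|k IH|k IH]; first by rewrite add0r mul1g.
  by rewrite -addn1 PoszD addrAC zexpS IH zexpS mulgA.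
rewrite -addn1 PoszD opprD addrAC.
by rewrite zexpP IH mulgA -zexpP.
Qed.

Lemma zexpN f n : zexp f (- n) = (zexp f n)^-1%g.
Proof.
by apply: (mulgI (zexp f n)); rewrite -zexpD subrr mulgV.
Qed.

Lemma zexpB f m n : zexp f (m - n) = (zexp f m / zexp f n)%g.
Proof. by rewrite zexpD zexpN. Qed.

Lemma zexp_inj f : ~ torsion f -> injective (zexp f).
Proof.
move=> ntf; suff z0 n : zexp f n = 1%g -> n = 0.
  move=> m n mn; apply/eqP; rewrite -subr_eq0; apply/eqP/z0.
  by rewrite zexpB mn mulgV.
case: n => k.
  by case: k => // k fk; case: ntf; exists k.+1.
move=> /= /(congr1 (fun x => x^-1)%g); rewrite invgK invg1 => fk.
by case: ntf; exists k.+1.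
Qed.

Lemma cayley_distE f m n : ~ torsion f ->
  cayley_dist f (zexp f m) (zexp f n) = `|m - n|%:~R :> R.
Proof.
move=> ntf; rewrite /cayley_dist.
rewrite (_ : [set n0 : int | _] = [set m - n]); first last.
  apply/seteqP; split=> k /=; first by rewrite -zexpB => /(zexp_inj ntf).
  by move=> ->; rewrite zexpB.
by rewrite image_set1 inf1; case: (m - n).
Qed.

Section Growth.
Variables (d : G -> G -> R) (f : G).
Hypothesis Hz : forall n, H (zexp f n).
Hypothesis dP : pseudometric H d.
Hypothesis dR : right_invariant H d.

Lemma ri_zexp m n : d (zexp f m) (zexp f n) = d (zexp f (m - n)) 1%g.
Proof.
by rewrite zexpB -(mulgV (zexp f n)) -zexpN; apply/esym/dR.
Qed.

Lemma ri_zexpN n : d (zexp f (- n)) 1%g = d (zexp f n) 1%g.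
Proof.
have [_ _ sym _] := dP; have H1 : H 1%g := Hz 0.
rewrite -[LHS](dR _ _ (Hz n))// mul1g zexpN mulVg sym//.
Qed.

Lemma ri_zexp_abs n : d (zexp f n) 1%g = d (f ^+ `|n|)%g 1%g.
Proof. by case: n => k //; rewrite NegzE ri_zexpN. Qed.

Lemma ri_expg_le k : d (f ^+ k)%g 1%g <= k%:R * d f 1%g.
Proof.
have [_ d0 _ tri] := dP; have H1 : H 1%g := Hz 0.
have Hf : H f by have := Hz 1; rewrite /= expg1.
elim: k => [|k IH]; first by rewrite mul0r d0.
have Hk : H (f ^+ k)%g := Hz k.
have Hk1 : H (f ^+ k.+1)%g := Hz k.+1.
have := tri _ _ _ Hk1 Hk H1; rewrite -natr1 mulrDl mul1r.
have -> : d (f ^+ k.+1)%g (f ^+ k)%g = d f 1%g.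
  by rewrite expgS -[X in d _ X]mul1g; apply: dR.
by lra.
Qed.

End Growth.

(** For a torsion element [s (f ^+ n) 1] would return to 0 for arbitrarily large [n]. *)
Lemma linear_growth_not_torsion s f (c C : R) : (forall n, H (zexp f n)) ->
  pseudometric H s -> 0 < c ->
  (forall k, c * k%:R - C <= s (f ^+ k)%g 1%g) -> ~ torsion f.
Proof.
move=> Hz [_ s0 _ _] c0 grow [k k0 fk].
pose j := Num.bound (`|C| / c).
have jC : `|C| < c * j%:R.
  by rewrite mulrC -ltr_pdivrMr// archi_boundP// divr_ge0// ltW.
have := grow (k * j)%N; rewrite expgnA fk expg1n s0; last exact: Hz 0.
have : j%:R <= (k * j)%:R :> R by rewrite ler_nat leq_pmull.
by move=> /(ler_wpM2l (ltW c0)); have := ler_norm C; lra.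
Qed.

(** The upper bound is right invariance with the triangle inequality; the lower one holds because a
    maximal [d] dominates [s] coarsely and so inherits its linear growth. *)
Lemma linear_growth_qi d s f (c C : R) : (forall n, H (zexp f n)) ->
  maximal_pseudometric H r d -> admissible H r s -> 0 < c ->
  (forall k, c * k%:R - C <= s (f ^+ k)%g 1%g) -> cyclic_qi_embedding d f.
Proof.
move=> Hz [[dP dR _] dmax] sadm c0 grow.
have [sP _ _] := sadm; have ntf := linear_growth_not_torsion Hz sP c0 grow.
have [K [C' sd]] := dmax s sadm.
have H1 : H 1%g := Hz 0; have Hf : H f by have := Hz 1; rewrite /= expg1.
have [d0 _ _ _] := dP; have df0 := d0 _ _ Hf H1.
(* Maximality says nothing about the signs of [K] and [C'], hence the absolute values. [K0] then
   exceeds both [K1 / c], for the lower bound, and [d f 1], for the upper one. *)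
pose K1 := 1 + `|K|; have K1_ge1 : 1 <= K1 by rewrite lerDl.
have K1c : 0 < K1 / c by rewrite divr_gt0//; lra.
pose K0 := 1 + K1 / c + d f 1%g.
have K0_gt0 : 0 < K0 by rewrite /K0; lra.
exists K0, (`|C| + `|C'|); split; [by rewrite /K0; lra|exact: addr_ge0|].
move=> m n; rewrite cayley_distE// (ri_zexp Hz dR) (ri_zexp_abs Hz dP dR).
set k := `|m - n|%N; have -> : `|m - n|%:~R = k%:R :> R by rewrite -abszE.
have up := ri_expg_le Hz dP dR k.
have Hk : H (f ^+ k)%g := Hz k.
have := sd _ _ Hk H1; have := grow k.
set D := d _ _ in up *; have D0 : 0 <= D by exact: d0.
have k0 : 0 <= k%:R :> R by [].
move=> g1 g2.
have KD : K * D <= K1 * D.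
  by rewrite ler_wpM2r// /K1; have := ler_norm K; lra.
have nC := ler_norm C; have nC' := ler_norm C'.
split; last first.
  have : k%:R * d f 1%g <= K0 * k%:R.
    by rewrite mulrC ler_wpM2r// /K0; lra.
  by have := normr_ge0 C; have := normr_ge0 C'; lra.
have inv : K0^-1 <= c / K1.
  rewrite -[leRHS]invrK invf_div lef_pV2 ?posrE//.
  by rewrite /K0; lra.
apply: (@le_trans _ _ (c / K1 * k%:R - (`|C| + `|C'|))).
  by rewrite lerD2r ler_wpM2r.
have K1_gt0 : 0 < K1 by lra.
have key : c * k%:R <= K1 * (D + (`|C| + `|C'|)).
  rewrite mulrDr; have : `|C| + `|C'| <= K1 * (`|C| + `|C'|).
    by rewrite ler_peMl// addr_ge0.
  by lra.
rewrite lerBlDr (_ : c / K1 * k%:R = (c * k%:R) / K1); last by ring.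
by rewrite ler_pdivrMr// [leRHS]mulrC.
Qed.

End CyclicEmbedding.

(** * Continuity of the logarithmic variation *)

Section CoarseAdmissibility.
Context {R : realType}.
Implicit Types (f g : bijection (circle R)).

Lemma ln_lip (m x y : R) : 0 < m -> m <= x -> m <= y ->
  `|ln x - ln y| <= `|x - y| / m.
Proof.
move=> m0; wlog yx : x y / y <= x.
  by move=> H mx my; have [/H->//|/ltW xy] := leP y x;
    rewrite distrC (distrC x) H.
move=> mx my; have y0 : 0 < y by exact: lt_le_trans my.
have x0 : 0 < x by exact: lt_le_trans mx.
rewrite ger0_norm ?subr_ge0 ?ler_ln ?posrE// ger0_norm ?subr_ge0//.
rewrite -ln_div ?posrE//.
have xy : x / y = 1 + (x - y) / y by rewrite mulrBl divff ?gt_eqF//; ring.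
have t0 : 0 <= (x - y) / y by rewrite divr_ge0 ?subr_ge0// ltW.
rewrite xy (le_trans (le_ln1Dx _))//; first by lra.
by rewrite ler_wpM2l ?subr_ge0// lef_pV2 ?posrE.
Qed.

Lemma dlift_bounds f : Diffk 1 f ->
  exists m M : R, 0 < m /\ forall x, m <= dlift f x <= M.
Proof.
move=> f1; have cf := continuous_subspaceT (dlift_continuous f1).
have [c _ cmin] := EVT_min ler01 (cf `[0, 1]%classic).
have [d _ dmax] := EVT_max ler01 (cf `[0, 1]%classic).
exists (dlift f c), (dlift f d); split=> [|x]; first exact: dlift_gt0.
have /andP[h1 h2] := floor_itv x; rewrite intrD mulr1z in h2.
rewrite -(dliftD_int x (- Num.floor x) f1) mulrNz.
have xI : x - (Num.floor x)%:~R \in `[0, 1].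
  by rewrite in_itv/=; apply/andP; split; lra.
by rewrite cmin ?dmax.
Qed.

Lemma Diff1AC_ac f : Diff1AC f -> absolutely_continuous 0 1 (dlift f).
Proof.
move=> [f1]; rewrite (_ : (fun x => _) = dlift f)//.
by apply/funext => x; exact: circle_derive1E.
Qed.

(** Here [a], [b] stand for the values of [f'] at two points and [p], [q] for those of [g']. The
    numerator of [b / q - a / p] is [a ((b - q) - (a - p)) - (a - p) (b - a)], so small increments
    of [f' - g'] and a small [f' - g'] suffice. The constant is the product of 2, the Lipschitz
    constant of [ln] above 1/2, and of [4 / m ^ 2], which bounds [1 / (q p)]. *)
Lemma ln_ratio_diff (m M delta a b p q dW dV : R) : 0 < m ->
  m <= a <= M -> m <= b <= M -> m / 2 <= p -> m / 2 <= q -> delta <= m / 2 ->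
  `|a - p| <= delta -> `|b - q| <= delta ->
  `|(b - q) - (a - p)| <= dW -> `|b - a| <= dV ->
  `|(ln b - ln q) - (ln a - ln p)| <= 8 / m ^+ 2 * (M * dW + delta * dV).
Proof.
move=> m0 /andP[ma aM] /andP[mb bM] mp mq dm ap bq dw dv.
have m20 : 0 < m / 2 by rewrite divr_gt0.
have [a0 b0] : 0 < a /\ 0 < b by split; lra.
have [p0 q0] : 0 < p /\ 0 < q by split; lra.
rewrite -(ln_div b0 q0) -(ln_div a0 p0).
have half (x y : R) : m <= x -> 0 < y -> `|x - y| <= delta -> 2^-1 <= x / y.
  by move=> mx y0; rewrite ler_pdivlMr// ler_norml => /andP[]; lra.
have h20 : 0 < 2^-1 :> R by rewrite invr_gt0.
apply: le_trans (ln_lip h20 (half _ _ mb q0 bq) (half _ _ ma p0 ap)) _.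
have pq : (m / 2) * (m / 2) <= q * p by apply: ler_pM => //; exact: ltW.
have num : `|b * p - a * q| <= M * dW + delta * dV.
  rewrite (_ : b * p - a * q = a * ((b - q) - (a - p)) - (a - p) * (b - a)); last by ring.
  apply: le_trans (ler_normB _ _) _; rewrite !normrM (gtr0_norm a0).
  by apply: lerD; apply: ler_pM => //; exact: ltW.
have num0 : 0 <= M * dW + delta * dV by exact: le_trans num.
rewrite (_ : b / q - a / p = (b * p - a * q) / (q * p)); last first.
  by field; rewrite ?gt_eqF.
rewrite normrM normfV (gtr0_norm (mulr_gt0 q0 p0)) invrK.
rewrite (_ : 8 / m ^+ 2 * _ = (M * dW + delta * dV) / ((m / 2) * (m / 2)) * 2); last first.
  by field; rewrite ?gt_eqF.
rewrite ler_pM2r//; apply: ler_pM => //; first by rewrite invr_ge0 mulr_ge0 ?ltW.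
by rewrite lef_pV2 ?posrE ?mulr_gt0.
Qed.

Lemma Diff1AC_circle_bv f : Diff1AC f -> circle_bv (fun x => ln (dlift f x)).
Proof.
move=> fac; have [f1 _] := fac; have [m [M [m0 mM]]] := dlift_bounds f1.
have [V _ fV] := ac_variation_function ler01 (Diff1AC_ac fac).
apply: (@circle_bv_le _ _ (V 1 / m - V 0 / m)) => v w n.
apply: (@turn_sum_control _ _ (fun x => V x / m)) => [x|x y x0 xy y1].
  by rewrite dlift1.
have /andP[mx _] := mM x; have /andP[my _] := mM y.
apply: le_trans (ln_lip m0 my mx) _; rewrite -mulrBl.
by rewrite ler_wpM2r ?invr_ge0 ?(ltW m0)// fV.
Qed.

Lemma circle_dist_ge0 (p q : circle R) : 0 <= circle_dist p q.
Proof.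
rewrite /circle_dist; set S := [set _ | _ in _].
have [->|/set0P S0] := eqVneq S set0; first by rewrite inf0.
by apply: lb_le_inf => // _ [x _ <-].
Qed.

Lemma sup_dist_ge0 f g : (0 <= sup_dist f g)%E.
Proof.
apply: ereal_sup_ge; exists (circle_dist (f 0) (g 0))%:E; first by exists 0.
by rewrite lee_fin circle_dist_ge0.
Qed.

Lemma sup_derive_dist_ge0 n f g : (0 <= sup_derive_dist n f g)%E.
Proof.
apply: ereal_sup_ge; exists `|circle_derive n f 0 - circle_derive n g 0|%:E.
  by exists 0.
by rewrite lee_fin.
Qed.

Lemma sup_derive_dist_ge n f g (p : circle R) :
  (`|circle_derive n f p - circle_derive n g p|%:E <= sup_derive_dist n f g)%E.
Proof. by apply: ereal_sup_ubound; exists p. Qed.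

Definition dlift_L1_dist f g : \bar R :=
  (\int[lebesgue_measure]_(x in `[0%R, 1%R])
     `|derive1 (dlift f) x - derive1 (dlift g) x|%:E)%E.

Lemma dlift_L1_dist_ge0 f g : (0 <= dlift_L1_dist f g)%E.
Proof. by apply: integral_ge0 => x _; rewrite lee_fin. Qed.

Lemma dlift_L1_distE f g : Diffk 1 f -> Diffk 1 g ->
  (\int[lebesgue_measure]_(x in `[0%R, 1%R])
     `|circle_derive 2 f (to_circle x) - circle_derive 2 g (to_circle x)|%:E)%E =
  dlift_L1_dist f g.
Proof.
move=> f1 g1; rewrite /dlift_L1_dist; apply: eq_integral => x _.
by rewrite (circle_derive2E x f1) (circle_derive2E x g1).
Qed.

Lemma rho1ACE f g : Diffk 1 f -> Diffk 1 g ->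
  rho1AC f g = (sup_dist f g + sup_derive_dist 1 f g + dlift_L1_dist f g)%E.
Proof. by move=> f1 g1; rewrite /rho1AC dlift_L1_distE. Qed.

Lemma rho1AC_lt f g (e : R) : Diffk 1 f -> Diffk 1 g -> (rho1AC f g < e%:E)%E ->
  (forall x, `|dlift f x - dlift g x| < e) /\ (dlift_L1_dist f g < e%:E)%E.
Proof.
move=> f1 g1; rewrite rho1ACE//.
have I0 := dlift_L1_dist_ge0 f g.
have d0 := sup_dist_ge0 f g; have s0 := sup_derive_dist_ge0 1 f g.
move=> lt; split.
  move=> x; rewrite -lte_fin; apply: le_lt_trans lt.
  rewrite -!circle_derive1E//; apply: le_trans (sup_derive_dist_ge 1 f g _) _.
  by rewrite addeAC -[leLHS]add0e leeD// adde_ge0.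
by apply: le_lt_trans lt; rewrite -[leLHS]add0e leeD// adde_ge0.
Qed.

Lemma Diff1AC_log_var_near f : Diff1AC f -> forall e, 0 < e ->
  exists2 delta, 0 < delta & forall g, Diff1AC g ->
    (rho1AC f g < delta%:E)%E -> log_var f g < e.
Proof.
move=> fac e e0; have [f1 _] := fac; have [m [M [m0 mM]]] := dlift_bounds f1.
have [V _ fV] := ac_variation_function ler01 (Diff1AC_ac fac).
have V01 : 0 <= V 1 - V 0 by apply: le_trans (fV 0 1 _ _ _).
have M0 : 0 < M by have /andP[h1 h2] := mM 0; lra.
pose k := 8 / m ^+ 2.
have k0 : 0 < k by rewrite divr_gt0// exprn_gt0.
(* Once [W 1 - W 0 < delta], the control function below increases by at most [delta * C0] over
   [[0, 1]]. The other bound on [delta], by [m / 2], keeps [g'] above [m / 2]. *)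
pose C0 := k * (M + (V 1 - V 0)) + 1.
have C00 : 0 < C0 by rewrite /C0 addr_gt0// mulr_gt0// ltr_pwDl.
exists (Num.min (m / 2) (e / (2 * C0))).
  by rewrite lt_min !divr_gt0// mulr_gt0.
set delta := Num.min _ _ => g gac; have [g1 _] := gac.
move=> /(rho1AC_lt f1 g1)[sfg Ifg].
have [W [fgW W1]] := ac_variation_control ltr01 (Diff1AC_ac fac) (Diff1AC_ac gac).
have {}W1 : W 1 - W 0 < delta by rewrite -lte_fin; exact: le_lt_trans W1 Ifg.
have dm : delta <= m / 2 by rewrite ge_min lexx.
have de : delta <= e / (2 * C0) by rewrite ge_min lexx orbT.
have g_ge x : m / 2 <= dlift g x.
  have /andP[h1 _] := mM x; have := sfg x; rewrite ltr_norml => /andP[_]; lra.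
have d0 : 0 <= delta by apply: le_trans (normr_ge0 _) (ltW (sfg 0)).
have control x y : 0 <= x -> x <= y -> y <= 1 ->
    `|(ln (dlift f y) - ln (dlift g y)) - (ln (dlift f x) - ln (dlift g x))| <=
    k * (M * W y + delta * V y) - k * (M * W x + delta * V x).
  move=> x0 xy y1.
  rewrite -mulrBr.
  have -> : M * W y + delta * V y - (M * W x + delta * V x) =
      M * (W y - W x) + delta * (V y - V x) by clear; ring.
  apply: ln_ratio_diff => //.
  - exact/ltW/sfg.
  - exact/ltW/sfg.
  - exact: fgW.
  - exact: fV.
apply: le_lt_trans (_ : k * (M * W 1 + delta * V 1) - k * (M * W 0 + delta * V 0) < e).
  apply: circle_var_le => v w n.
  apply: (@turn_sum_control _ (fun x => ln (dlift f x) - ln (dlift g x))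
    (fun x => k * (M * W x + delta * V x))) => [x|//].
  by rewrite !dlift1.
apply: (@le_lt_trans _ _ (delta * C0)); last first.
  by move: de; rewrite ler_pdivlMr ?mulr_gt0// mulrA; lra.
have kM : M * (W 1 - W 0) <= M * delta by rewrite ler_wpM2l// ltW.
have : k * (M * (W 1 - W 0)) <= k * (M * delta) by rewrite ler_wpM2l// ltW.
by rewrite /C0; nra.
Qed.

Lemma lipschitz_ac (a b C : R) (F : R -> R) :
  (forall x y, a <= x -> x <= y -> y <= b -> `|F y - F x| <= C * (y - x)) ->
  absolutely_continuous a b F.
Proof.
move=> lip e e0; have C0 : 0 < `|C| + 1 by rewrite ltr_pwDr.
exists (e / (`|C| + 1)); first exact: divr_gt0.
move=> s /allP sa _; rewrite ltr_pdivlMr// => /(le_lt_trans _); apply.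
rewrite mulrC mulr_sumr big_seq [leRHS]big_seq; apply: ler_sum => I Is.
have /and3P[aI II Ib] := sa I Is; apply: le_trans (lip _ _ aI II Ib) _.
by rewrite ler_wpM2r ?subr_ge0//; have := ler_norm C; lra.
Qed.

Lemma Ck1_lipschitz (a b : R) (F : R -> R) : a <= b -> Ck 1 F ->
  exists C : R, forall x y, a <= x -> x <= y -> y <= b ->
    `|F y - F x| <= C * (y - x).
Proof.
move=> ab /CkS[dF /Ck0 cF].
have cnF : continuous (fun x => `|derive1 F x|).
  by move=> x; apply: cvg_norm; exact: cF.
have [c _ cmax] := EVT_max ab (continuous_subspaceT cnF).
exists `|derive1 F c| => x y ax xy yb.
have [||z zxy ->] := @MVT_segment R F (derive1 F) x y xy.
- by move=> z _; exact: derivable_is_derive1.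
- exact/continuous_subspaceT/derivable_continuous.
rewrite normrM (ger0_norm (_ : 0 <= y - x)) ?subr_ge0//.
rewrite ler_wpM2r ?subr_ge0// cmax// in_itv/=.
by move: zxy; rewrite in_itv/= => /andP[xz zy]; rewrite (le_trans ax) ?(le_trans zy).
Qed.

Lemma Diffk_Diff1AC k f : (2 <= k)%N -> Diffk k f -> Diff1AC f.
Proof.
move=> k2 fk; have f1 : Diffk 1 f by apply: Diffk_le fk; exact: ltnW.
split=> //; rewrite (_ : (fun x => _) = dlift f); last first.
  by apply/funext => x; exact: circle_derive1E.
have [_ /Ck_lift/(Ck_le k2)/CkS[_ d1] _] := fk.
by have [C] := Ck1_lipschitz ler01 d1; exact: lipschitz_ac.
Qed.

(** On an interval of length 1 an integral is at most a supremum. This reduces continuity of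
    [log_var] in the C^k topologies to the case of [rho1AC]. *)
Lemma rho1AC_le_rhok k f g : (2 <= k)%N -> (rho1AC f g <= rhok k f g)%E.
Proof.
move=> k2; rewrite /rho1AC /rhok -addeA leeD2l//.
rewrite big_ltn 1?ltnS ?(ltnW k2)// big_ltn 1?ltnS//.
rewrite leeD2l//.
have rest : (0 <= \sum_(3 <= i < k.+1) sup_derive_dist i f g)%E.
  by apply: sume_ge0 => i _; exact: sup_derive_dist_ge0.
rewrite -[leLHS]adde0 leeD//.
apply: (@le_trans _ _ (\int[lebesgue_measure]_(x in `[0%R, 1%R])
    cst (sup_derive_dist 2 f g) x)%E).
  apply: ge0_le_integral_subset => x xI; last exact: sup_derive_dist_ge0.
  by split=> //; exact: sup_derive_dist_ge.
rewrite integral_cst; last exact: measurable_itv.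
rewrite [X in (_ * X <= _)%E](_ : _ = 1%E) ?mule1//.
apply: etrans (lebesgue_measure_itv `[0%R, 1%R]) _.
by rewrite /= lte_fin ltr01 oppr0 adde0.
Qed.

Lemma log_var_admissible_Diff1AC : admissible (@Diff1AC R) rho1AC log_var.
Proof.
apply: log_variation_admissible => f fac.
- by case: fac.
- exact: Diff1AC_circle_bv.
- exact: Diff1AC_log_var_near.
Qed.

Lemma log_var_admissible_Diffk k : (2 <= k)%N ->
  admissible (@Diffk R k) (rhok k) log_var.
Proof.
move=> k2; apply: log_variation_admissible => f fk.
- by apply: Diffk_le fk; exact: ltnW.
- exact/Diff1AC_circle_bv/Diffk_Diff1AC/fk.
move=> e e0; have [d d0 H] := Diff1AC_log_var_near (Diffk_Diff1AC k2 fk) e0.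
exists d => // g gk gd; apply: H; first exact: Diffk_Diff1AC gk.
by apply: le_lt_trans gd; exact: rho1AC_le_rhok.
Qed.

End CoarseAdmissibility.

(** * Analyticity from factorial bounds on derivatives *)

Section TaylorSeries.
Context {R : realType}.
Implicit Types (F G : R -> R) (x y t h B C M : R) (n : nat).

Lemma is_derive_taylor_sum (c : nat -> R) h t n :
  is_derive t 1 (fun t => \sum_(i < n) c i * ((h * t) ^+ i.+1 / (i.+1)`!%:R))
    (h * \sum_(i < n) c i * ((h * t) ^+ i / i`!%:R)).
Proof.
elim: n => [|n IH].
  under eq_fun do rewrite big_ord0.
  by rewrite big_ord0 mulr0; exact: is_derive_cst.
under eq_fun do rewrite big_ord_recr/=.
rewrite big_ord_recr/= mulrDr; apply: is_deriveD.
have E : (fun t => c n * ((h * t) ^+ n.+1 / (n.+1)`!%:R)) =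
    (c n * h ^+ n.+1 / (n.+1)`!%:R) \*: ((@idfun R) ^+ n.+1).
  apply/funext => s /=; rewrite /GRing.scale/= exprMn fctE.
  by rewrite /idfun; ring.
rewrite E; apply: is_derive_eq => /=.
rewrite /GRing.scale/= mulr1 factS natrM exprMn exprS.
have nz : n`!%:R != 0 :> R by rewrite pnatr_eq0 -lt0n fact_gt0.
have : n.+1%:R != 0 :> R by rewrite pnatr_eq0.
by move: nz; move: (n.+1%:R : R) (n`!%:R : R) => N Nf N0 Nf0; field; rewrite N0.
Qed.

Lemma derivative_growth G (G' : R -> R) B n :
  (forall t, is_derive t 1 G (G' t)) -> G 0 = 0 ->
  (forall t, 0 <= t -> `|G' t| <= B * (t ^+ n / n`!%:R)) ->
  forall t, 0 <= t -> `|G t| <= B * (t ^+ n.+1 / (n.+1)`!%:R).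
Proof.
move=> dG G0 G'le t t0.
have dP (s : R) : is_derive s 1 (fun t => B * (t ^+ n.+1 / (n.+1)`!%:R))
    (B * (s ^+ n / n`!%:R)).
  (* A coefficient sequence with a single nonzero term makes the derivative of one monomial an
     instance of [is_derive_taylor_sum]. *)
  pose c i := if i == n then B else 0.
  have cE (a : nat -> R) : \sum_(i < n.+1) c i * a i = B * a n.
    rewrite big_ord_recr/= /c eqxx big1 ?add0r// => i _.
    by rewrite ltn_eqF// mul0r.
  have E : (fun t => B * (t ^+ n.+1 / (n.+1)`!%:R)) =
      fun t => \sum_(i < n.+1) c i * ((1 * t) ^+ i.+1 / (i.+1)`!%:R).
    by apply/funext => u; rewrite (cE (fun i => (1 * u) ^+ i.+1 / (i.+1)`!%:R)) mul1r.
  have E' : B * (s ^+ n / n`!%:R) =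
      1 * \sum_(i < n.+1) c i * ((1 * s) ^+ i / i`!%:R).
    by rewrite (cE (fun i => (1 * s) ^+ i / i`!%:R)) !mul1r.
  by rewrite E E'; exact: is_derive_taylor_sum.
have P0 : B * (0 ^+ n.+1 / (n.+1)`!%:R) = 0 by rewrite exprS !mul0r mulr0.
have incr (e : R) : `|e| = 1 ->
    0 <= B * (t ^+ n.+1 / (n.+1)`!%:R) + e * G t.
  move=> e1.
  pose H (t : R) := B * (t ^+ n.+1 / (n.+1)`!%:R) + e * G t.
  have dH (s : R) : is_derive s 1 H (B * (s ^+ n / n`!%:R) + e * G' s).
    by apply: is_deriveD; exact: (is_deriveZ e (dG s)).
  have H0 : H 0 = 0 by rewrite /H P0 G0 mulr0 addr0.
  rewrite -H0; apply: (@ger0_derive1_ndecr R H 0 t) => //.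
  - move=> s; rewrite in_itv/= => /andP[s0 _].
    rewrite (is_derive_derive1 (dH s)).
    have := G'le s (ltW s0); have := ler_norm (- (e * G' s)).
    by rewrite normrN normrM e1 mul1r; lra.
  - apply/continuous_subspaceT/derivable_continuous => s.
    exact: is_derive_derivable (dH s).
have := incr 1 (normr1 _); have := incr (-1) (normrN1 _).
by rewrite mul1r mulN1r ler_norml => h1 h2; apply/andP; split; lra.
Qed.

(** The derivative in [t] of the remainder of [F] is [h] times the remainder of [F'] with one term
    fewer, so the bound is integrated by [derivative_growth]. Moving along [x + h t] with [t >= 0]
    treats both signs of [h] at once. *)
Lemma taylor_remainder n F B x h : (forall k, Ck k F) ->
  (forall y, `|derive1n n F y| <= B) -> forall t, 0 <= t ->
  `|F (x + h * t) - \sum_(i < n) derive1n i F x * ((h * t) ^+ i / i`!%:R)| <=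
  B * `|h| ^+ n * (t ^+ n / n`!%:R).
Proof.
elim: n F => [|n IH] F sF FB t t0.
  rewrite big_ord0 subr0 !expr0 fact0 divr1 !mulr1.
  exact: FB.
have dF : forall y, derivable F y 1 by have /CkS[] := sF 1%N.
have sF' k : Ck k (derive1 F) by have /CkS[] := sF k.+1.
pose T t := \sum_(i < n) derive1n i (derive1 F) x * ((h * t) ^+ i / i`!%:R).
pose G t := F (x + h * t) - (F x +
  \sum_(i < n) derive1n i (derive1 F) x * ((h * t) ^+ i.+1 / (i.+1)`!%:R)).
have -> : F (x + h * t) - \sum_(i < n.+1) derive1n i F x * ((h * t) ^+ i / i`!%:R) = G t.
  rewrite /G big_ord_recl /= expr0 fact0 divr1 mulr1; congr (_ - (_ + _)).
  apply: eq_bigr => i _; congr (_ * _).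
  exact: (congr1 (fun f => f x) (derive1nSr i F)).
have FB' y : `|derive1n n (derive1 F) y| <= B by rewrite -derive1nSr.
have dG (s : R) : is_derive s 1 G (h * (derive1 F (x + h * s) - T s)).
  rewrite mulrBr; apply: is_deriveB.
    rewrite mulrC; apply: (@is_derive1_comp _ F (fun t => x + h * t)).
      exact: derivable_is_derive1.
    rewrite -[X in is_derive _ _ _ X]add0r; apply: is_deriveD.
    by have := is_deriveZ h (is_derive_id s 1); rewrite /GRing.scale/= mulr1.
  rewrite -[X in is_derive _ _ _ X]add0r; apply: is_deriveD.
  exact: (is_derive_taylor_sum (fun i => derive1n i (derive1 F) x)).
apply: (derivative_growth dG _ _ t0).
  rewrite /G mulr0 addr0 big1 ?addr0 ?subrr// => i _.
  by rewrite exprS !mul0r mulr0.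
move=> s s0; rewrite normrM exprS.
rewrite [leRHS](_ : _ = `|h| * (B * `|h| ^+ n * (s ^+ n / n`!%:R))); last by ring.
by rewrite ler_wpM2l//; exact: (IH _ sF' FB').
Qed.

(** Within the radius [(2 M)^-1] the factorials cancel and the Taylor remainder is at most
    [C |y - x| 2^-n]. *)
Lemma factorial_bound_analytic F C M : 0 < M -> 0 <= C -> (forall k, Ck k F) ->
  (forall n x, `|derive1n n.+1 F x| <= C * M ^+ n * n`!%:R) -> real_analytic F.
Proof.
move=> M0 C0 sF bF x.
exists (fun i => derive1n i F x / i`!%:R), (2 * M)^-1.
split; first by rewrite invr_gt0 mulr_gt0.
move=> y yx; set s := y - x in yx *.
have Ms : `|s| * M <= 2^-1.
  by rewrite -ler_pdivlMr// -invfM ltW// mulrC.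
have rem n : `|F y - pseries (fun i => derive1n i F x / i`!%:R) s n.+1| <=
    (C * `|s|) * (2^-1) ^+ n.
  have := taylor_remainder x s sF (bF n) ler01.
  rewrite !mulr1 /pseries /series/= big_mkord (_ : x + s = y); last by rewrite /s; ring.
  rewrite expr1n; under [in X in X -> _]eq_bigr do rewrite mulrCA mulrC.
  rewrite (eq_bigr (fun i : 'I_n.+1 => derive1n i F x / i`!%:R * s ^+ i)); last first.
    by move=> i _; ring.
  move=> /le_trans; apply.
  rewrite factS natrM exprS.
  have nf : n`!%:R != 0 :> R by rewrite pnatr_eq0 -lt0n fact_gt0.
  have n1 : n.+1%:R != 0 :> R by rewrite pnatr_eq0.
  rewrite (_ : _ * _ = (C * `|s|) * ((`|s| * M) ^+ n / n.+1%:R)); last first.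
    rewrite exprMn; move: nf n1; move: (n.+1%:R : R) (n`!%:R : R) => N Nf Nf0 N0.
    by field; rewrite ?Nf0 ?N0.
  rewrite ler_wpM2l ?mulr_ge0// ler_pdivrMr ?ltr0n//.
  apply: (@le_trans _ _ (2^-1 ^+ n)); last by rewrite ler_peMr ?exprn_ge0// ler1n.
  by apply: lerXn2r; rewrite ?nnegrE ?mulr_ge0// ltW.
rewrite -cvg_shiftS.
apply/cvgrPdist_le => e e0.
have half1 : `|2^-1 : R| < 1 by rewrite gtr0_norm// invf_lt1// ltr1n.
have := cvg_geometric (C * `|s|) half1.
move=> /cvgrPdist_le/(_ e e0); apply: filterS => n.
rewrite /= sub0r normrN => H; apply: le_trans (rem n) _.
by apply: le_trans (ler_norm _) H.
Qed.

End TaylorSeries.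

(** * Polynomial differential systems and growth of derivatives *)

(* Polynomial expressions in a family [gen] of generators: [gen_poly k c f] says
   that f has degree at most k and that the absolute values of its coefficients
   add up to at most c. *)
Section GeneratedPolynomials.
Context {R : realType}.
Variable gen : set (R -> R).
Implicit Types (f g h : R -> R) (c a : R) (d e k n : nat).

Inductive gen_mono : nat -> (R -> R) -> Prop :=
| GenMono0 : gen_mono 0 (fun=> 1)
| GenMonoS d g f of gen g & gen_mono d f : gen_mono d.+1 (fun x => g x * f x).

Inductive gen_poly : nat -> R -> (R -> R) -> Prop :=
| GenPoly0 d c of 0 <= c : gen_poly d c (fun=> 0)
| GenPolyS d e a c c' f h of (e <= d)%N & gen_mono e f & gen_poly d c h
    & `|a| + c <= c' : gen_poly d c' (fun x => a * f x + h x).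

Lemma gen_poly_ge0 d c f : gen_poly d c f -> 0 <= c.
Proof. by elim=> // {}d e a {}c c' {}f h _ _ _ c0; apply: le_trans; rewrite addr_ge0. Qed.

Lemma gen_polyW d d' c c' f : (d <= d')%N -> c <= c' ->
  gen_poly d c f -> gen_poly d' c' f.
Proof.
move=> dd' cc' H; elim: H c' dd' cc' => {d c f}.
  by move=> d c c0 c' _ cc'; apply: GenPoly0; exact: le_trans cc'.
move=> d e a c c1 f h ed ef _ IH ac c' dd' cc'.
apply: (@GenPolyS d' e a c) => //; first exact: leq_trans dd'.
  exact: IH.
exact: le_trans cc'.
Qed.

Lemma gen_polyD d c c' f h : gen_poly d c f -> gen_poly d c' h ->
  gen_poly d (c + c') (fun x => f x + h x).
Proof.
move=> H; elim: H c' h => {d c f}.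
  move=> d c c0 c' h hh; rewrite (_ : (fun x => _) = h).
    by apply: gen_polyW hh => //; rewrite lerDr.
  by apply/funext => x; rewrite add0r.
move=> d e a c c1 f h ed ef hh IH ac c' h' hh'.
rewrite (_ : (fun x => _) = fun x => a * f x + (h x + h' x)).
  by apply: GenPolyS ef (IH _ _ hh') _ => //; rewrite addrA lerD2r.
by apply/funext => x; rewrite addrA.
Qed.

Lemma gen_polyZ d a c f : gen_poly d c f -> gen_poly d (`|a| * c) (fun x => a * f x).
Proof.
elim=> {d c f} [d c c0|d e b c c1 f h ed ef hh IH ac].
  rewrite (_ : (fun x => _) = fun=> 0); first by apply: GenPoly0; rewrite mulr_ge0.
  by apply/funext => x; rewrite mulr0.
rewrite (_ : (fun x => _) = fun x => a * b * f x + a * h x).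
  by apply: GenPolyS ef IH _ => //; rewrite normrM -mulrDr ler_wpM2l.
by apply/funext => x; rewrite mulrDr mulrA.
Qed.

Lemma gen_monoM d e f h : gen_mono d f -> gen_mono e h ->
  gen_mono (d + e) (fun x => f x * h x).
Proof.
move=> H eh; elim: H => {d f} [|d g f gg df IH].
  by rewrite (_ : (fun x => _) = h)//; apply/funext => x; rewrite mul1r.
rewrite (_ : (fun x => _) = fun x => g x * (f x * h x)); first exact: GenMonoS.
by apply/funext => x; rewrite mulrA.
Qed.

Lemma gen_mono_poly d f : gen_mono d f -> gen_poly d 1 f.
Proof.
move=> df; rewrite (_ : f = fun x => 1 * f x + (fun=> 0) x).
  by apply: GenPolyS df (GenPoly0 d (lexx 0)) _ => //; rewrite normr1 addr0.
by apply/funext => x; rewrite mul1r addr0.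
Qed.

Lemma gen_poly_monoM d e c f h : gen_poly d c f -> gen_mono e h ->
  gen_poly (d + e) c (fun x => h x * f x).
Proof.
move=> H eh; elim: H => {d c f} [d c c0|d b a c c1 f g bd bf gg IH ac].
  rewrite (_ : (fun x => _) = fun=> 0); first exact: GenPoly0.
  by apply/funext => x; rewrite mulr0.
rewrite (_ : (fun x => _) = fun x => a * (f x * h x) + h x * g x).
  by apply: GenPolyS (gen_monoM bf eh) IH ac; rewrite leq_add2r.
by apply/funext => x; ring.
Qed.

Lemma gen_polyM d e c c' f h : gen_poly d c f -> gen_poly e c' h ->
  gen_poly (d + e) (c * c') (fun x => f x * h x).
Proof.
move=> H eh; have c'0 := gen_poly_ge0 eh.
elim: H => {d c f} [d c c0|d b a c c1 f g bd bf gg IH ac].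
  rewrite (_ : (fun x => _) = fun=> 0); first by apply: GenPoly0; rewrite mulr_ge0.
  by apply/funext => x; rewrite mul0r.
rewrite (_ : (fun x => _) = fun x => a * (f x * h x) + g x * h x).
  apply: (@gen_polyW (d + e) (d + e) (`|a| * c' + c * c')) => //.
    by rewrite -mulrDl ler_wpM2r.
  apply: gen_polyD IH; apply: gen_polyZ.
  by apply: gen_polyW (gen_poly_monoM eh bf) => //; rewrite addnC leq_add2r.
by apply/funext => x; ring.
Qed.

Definition generated f : Prop := exists d c, gen_poly d c f.

Lemma generated_gen g : gen g -> generated g.
Proof.
move=> gg; exists 1%N, 1; apply: gen_mono_poly.
rewrite (_ : g = fun x => g x * 1); first exact: GenMonoS GenMono0.
by apply/funext => x; rewrite mulr1.
Qed.

Lemma generated_cst a : generated (fun=> a).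
Proof.
exists 0%N, (`|a| * 1); rewrite (_ : (fun=> a) = fun x => a * (fun=> 1) x).
  exact/gen_polyZ/gen_mono_poly/GenMono0.
by apply/funext => x; rewrite mulr1.
Qed.

Lemma generatedD f h : generated f -> generated h -> generated (fun x => f x + h x).
Proof.
move=> [d [c df]] [e [c' eh]]; exists (d + e)%N, (c + c').
by apply: gen_polyD; [apply: gen_polyW df|apply: gen_polyW eh];
  rewrite // ?leq_addr ?leq_addl.
Qed.

Lemma generatedM f h : generated f -> generated h -> generated (fun x => f x * h x).
Proof.
by move=> [d [c df]] [e [c' eh]]; exists (d + e)%N, (c * c'); exact: gen_polyM.
Qed.

Lemma generatedN f : generated f -> generated (fun x => - f x).
Proof.
move=> gf; rewrite (_ : (fun x => _) = fun x => (fun=> -1) x * f x).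
  by apply: generatedM gf; exact: generated_cst.
by apply/funext => x; rewrite mulN1r.
Qed.

Lemma generatedX f n : generated f -> generated (fun x => f x ^+ n).
Proof.
move=> gf; elim: n => [|n IH]; first exact: generated_cst.
by under eq_fun do rewrite exprS; exact: generatedM.
Qed.

Section Bounded.
Hypothesis gen_le1 : forall g, gen g -> forall x, `|g x| <= 1.

Lemma gen_mono_bound d f x : gen_mono d f -> `|f x| <= 1.
Proof.
elim=> {d f} [|d g f gg _ IH]; first by rewrite normr1.
by rewrite normrM mulr_ile1// gen_le1.
Qed.

Lemma gen_poly_bound d c f x : gen_poly d c f -> `|f x| <= c.
Proof.
elim=> {d c f} [d c c0|d e a c c1 f h _ ef _ IH ac]; first by rewrite normr0.
apply: le_trans (ler_normD _ _) (le_trans _ ac).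
by rewrite lerD// normrM ler_piMr// (gen_mono_bound _ ef).
Qed.

Variables (k : nat) (K : R).
Hypothesis K0 : 0 <= K.
Hypothesis gen_derive : forall g, gen g ->
  exists2 g', gen_poly k K g' & forall x : R, is_derive x 1 g (g' x).

Lemma gen_mono_derive d f : gen_mono d f ->
  exists2 f', gen_poly (d + k) (d%:R * K) f' & forall x : R, is_derive x 1 f (f' x).
Proof.
elim=> {d f} [|d g f gg df [f' pf' Df]].
  exists (fun=> 0); first by apply: GenPoly0; rewrite mul0r.
  by move=> x; exact: is_derive_cst.
have [g' pg' Dg] := gen_derive gg.
exists (fun x => f x * g' x + g x * f' x); last first.
  by move=> x; rewrite addrC; exact: is_deriveM.
rewrite -natr1 mulrDl mul1r addrC; apply: gen_polyD.
  by apply: gen_polyW (gen_poly_monoM pg' df) => //; rewrite addnC leq_add2r.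
have g1 : gen_mono 1 g.
  rewrite (_ : g = fun x => g x * 1); first exact: GenMonoS GenMono0.
  by apply/funext => x; rewrite mulr1.
by apply: gen_polyW (gen_poly_monoM pf' g1) => //; rewrite addn1.
Qed.

Lemma gen_poly_derive d c f : gen_poly d c f ->
  exists2 f', gen_poly (d + k) (c * (d%:R * K)) f'
    & forall x : R, is_derive x 1 f (f' x).
Proof.
elim=> {d c f} [d c c0|d e a c c1 f h ed ef hh [h' ph' Dh] ac].
  exists (fun=> 0); first by apply: GenPoly0; rewrite !mulr_ge0.
  by move=> x; exact: is_derive_cst.
have [f' pf' Df] := gen_mono_derive ef.
exists (fun x => a * f' x + h' x); last first.
  by move=> x; apply: is_deriveD; exact: (is_deriveZ a (Df x)).
apply: (@gen_polyW (d + k) (d + k) (`|a| * (d%:R * K) + c * (d%:R * K))) => //.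
  by rewrite -mulrDl ler_wpM2r// mulr_ge0.
apply: gen_polyD => //; apply: gen_polyZ.
by apply: gen_polyW pf'; rewrite ?leq_add2r// ler_wpM2r// ler_nat.
Qed.

(** A derivation adds [k] to the degree and multiplies the sum of coefficients by at most the degree
    times [K]. Since [d + n k <= (d + k) (n + 1)], the successive factors multiply up to a geometric
    term times a factorial. *)
Lemma gen_poly_derive1n d c f n : gen_poly d c f ->
  gen_poly (d + n * k) (c * ((d + k)%:R * K) ^+ n * n`!%:R) (derive1n n f) /\
  forall x : R, derivable (derive1n n f) x 1.
Proof.
move=> df; have c0 := gen_poly_ge0 df.
suff H : gen_poly (d + n * k) (c * ((d + k)%:R * K) ^+ n * n`!%:R) (derive1n n f).
  split=> // x; have [f' _ /(_ x)] := gen_poly_derive H.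
  exact: is_derive_derivable.
elim: n => [|n IH]; first by rewrite addn0 expr0 fact0 !mulr1 derive1n0.
have [f' pf' Df] := gen_poly_derive IH.
rewrite derive1nS (_ : derive1 _ = f'); last first.
  by apply/funext => x; exact: is_derive_derive1.
apply: gen_polyW pf'; first by rewrite mulSn -addnA (addnC k).
rewrite exprS factS natrM.
set A := c * _ * _; rewrite (_ : c * _ * _ = A * (((d + k) * n.+1)%:R * K)).
  rewrite ler_wpM2l ?/A ?mulr_ge0 ?exprn_ge0 ?mulr_ge0// ler_wpM2r// ler_nat.
  rewrite mulnDl leq_add// ?leq_pmulr// mulnC leq_mul//.
by rewrite natrM /A; ring.
Qed.

End Bounded.

(** The condition is placed on the derivative of [f] because lifts are unbounded and cannot
    themselves be polynomials in bounded generators. *)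
Lemma generated_smooth f : (forall g, gen g -> forall x, `|g x| <= 1) ->
  (exists k K, forall g, gen g ->
    exists2 g', gen_poly k K g' & forall x : R, is_derive x 1 g (g' x)) ->
  generated (derive1 f) -> (forall x : R, derivable f x 1) ->
  (forall n, Ck n f) /\ real_analytic f.
Proof.
move=> g1 [k [K gD]] [d [c pf]] df.
pose K1 := `|K| + 1; have K10 : 0 < K1 by rewrite ltr_wpDl.
have gD1 g : gen g ->
    exists2 g', gen_poly k K1 g' & forall x : R, is_derive x 1 g (g' x).
  move=> /gD[g' pg' Dg]; exists g' => //; apply: gen_polyW pg' => //.
  by have := ler_norm K; rewrite /K1; lra.
(* Raising the degree by one makes the geometric ratio [(d.+1 + k) * K1] positive. *)
have pf1 : gen_poly d.+1 c (derive1 f) by apply: gen_polyW pf.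
have H n := gen_poly_derive1n (ltW K10) gD1 n pf1.
have sf n : Ck n f.
  suff : Ck n.+1 f by exact: CkW.
  apply/CkS; split=> //; split=> [j _ x|]; first by have [_] := H j.
  by apply: derivable_continuous; have [] := H n.
split=> //; apply: (@factorial_bound_analytic _ f c ((d.+1 + k)%:R * K1)) => //.
- by rewrite mulr_gt0// ltr0n.
- exact: gen_poly_ge0 pf.
by move=> n x; rewrite derive1nSr; have [/(gen_poly_bound g1 x)] := H n.
Qed.

End GeneratedPolynomials.

(** * From increasing maps of the line to circle bijections *)

Section IncreasingLift.
Context {R : realType}.
Variable F : R -> R.
Hypotheses (cF : continuous F) (Finc : {homo F : x y / x < y})
  (F1 : forall x, F (x + 1) = F x + 1).

Lemma lift_natD x (k : nat) : F (x + k%:R) = F x + k%:R.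
Proof.
elim: k => [|k IH]; first by rewrite !addr0.
by rewrite -natr1 addrA F1 IH addrA.
Qed.

Lemma lift_intD x (n : int) : F (x + n%:~R) = F x + n%:~R.
Proof.
case: n => k; first exact: lift_natD.
rewrite NegzE mulrNz; apply/eqP; rewrite eq_sym subr_eq; apply/eqP.
by rewrite -[k.+1%:~R]/(k.+1%:R) -lift_natD subrK.
Qed.

Lemma lift_mono : {mono F : x y / x < y}.
Proof.
move=> x y; have [xy|yx|->] := ltgtP x y; rewrite ?ltxx//; first exact: Finc.
by apply/negP => /lt_trans/(_ (Finc yx)); rewrite ltxx.
Qed.

Lemma lift_surjective y : exists x, F x = y.
Proof.
pose k := Num.bound `|y - F 0|.
have yk : `|y - F 0| < k%:R.
  exact: archi_boundP.
have Nk : F (- k%:R) = F 0 - k%:R by rewrite -[LHS](addrK k%:R) -lift_natD addNr.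
have Pk : F k%:R = F 0 + k%:R by rewrite -lift_natD add0r.
have k0 : - k%:R <= k%:R :> R by rewrite ge0_cp.
have yI : Num.min (F (- k%:R)) (F k%:R) <= y <= Num.max (F (- k%:R)) (F k%:R).
  rewrite Nk Pk ge_min le_max; move: yk; rewrite ltr_norml => /andP[h1 h2].
  by apply/andP; split; apply/orP; [left|right]; lra.
by have [x _ <-] := IVT k0 (continuous_subspaceT cF) yI; exists x.
Qed.

Lemma increasing_lift_bijection : exists (f : bijection (circle R)) (G : R -> R),
  [/\ is_lift F f, is_lift G f^-1%g, cancel F G & cancel G F].
Proof.
have [G FG] := choice lift_surjective.
have GF : cancel F G.
  move=> x; have := FG (F x); have [h|h|//] := ltgtP (G (F x)) x;
    by move=> E; move: (Finc h); rewrite E ltxx.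
have Gmono x y : (G x < G y) = (x < y) by rewrite -lift_mono !FG.
have cG : continuous G.
  move=> y; apply/cvgrPdist_lt => e e0; near=> z.
  rewrite distrC ltr_distl -[_ - e]GF -[_ + e]GF !Gmono; apply/andP; split.
    near: z; apply: lt_nbhsr.
    by rewrite -[ltRHS]FG lift_mono ltrBlDr ltrDl.
  by near: z; apply: lt_nbhsl; rewrite -[ltLHS]FG lift_mono ltrDl.
have FD (p q : R) : to_circle p = to_circle q -> to_circle (F p) = to_circle (F q).
  by move=> /to_circleP[n ->]; rewrite lift_intD to_circleD_int.
have GD (p q : R) : to_circle p = to_circle q -> to_circle (G p) = to_circle (G q).
  move=> /to_circleP[n ->].
  by rewrite -{1}(FG q) -lift_intD GF to_circleD_int.
have FK : cancel (fun p : circle R => to_circle (F (repr p)))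
                 (fun p : circle R => to_circle (G (repr p))).
  move=> p; rewrite -[RHS]reprK_circle -[repr p in RHS]GF.
  by apply: GD; rewrite reprK_circle.
have GK : cancel (fun p : circle R => to_circle (G (repr p)))
                 (fun p : circle R => to_circle (F (repr p))).
  move=> p; rewrite -[RHS]reprK_circle -[repr p in RHS]FG.
  by apply: FD; rewrite reprK_circle.
exists (Bijection FK GK), G; split=> //.
  by split=> // x; apply: FD; rewrite reprK_circle.
by split=> // x; apply: GD; rewrite reprK_circle.
Unshelve. all: by end_near. Qed.

Lemma is_derive_lift_inverse (G F' : R -> R) : cancel F G -> cancel G F ->
  (forall x : R, is_derive x 1 F (F' x)) -> (forall x, F' x != 0) ->
  forall y : R, is_derive y 1 G (F' (G y))^-1.
Proof.
move=> FG GF dF F'0 y.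
have FGy : {near G y, cancel F G}.
  by near=> x; exact: FG.
have cFy : \forall x \near G y, continuous_at x F by near=> x; exact: cF.
by have := is_derive_inverse FGy cFy (dF (G y)) (F'0 (G y)); rewrite GF.
Unshelve. all: by end_near. Qed.

End IncreasingLift.

(** * Differentiation rules in pointwise form *)

Section PointwiseDerivatives.
Context {R : realType}.
Implicit Types (f g : R -> R) (x a b : R).

Lemma is_derive_val f x a b : is_derive x 1 f a -> a = b -> is_derive x 1 f b.
Proof. by move=> df <-. Qed.

Lemma is_derive_mulf f g x a b : is_derive x 1 f a -> is_derive x 1 g b ->
  is_derive x 1 (fun y => f y * g y) (a * g x + f x * b).
Proof.
by move=> df dg; apply: is_derive_val (is_deriveM df dg) _; rewrite /GRing.scale/=; ring.
Qed.

Lemma is_derive_addf f g x a b : is_derive x 1 f a -> is_derive x 1 g b ->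
  is_derive x 1 (fun y => f y + g y) (a + b).
Proof. exact: is_deriveD. Qed.

Lemma is_derive_scalef f x a b : is_derive x 1 f a ->
  is_derive x 1 (fun y => b * f y) (b * a).
Proof. by move=> df; exact: (is_deriveZ b df). Qed.

Lemma is_derive_powf f x a (n : nat) : is_derive x 1 f a ->
  is_derive x 1 (fun y => f y ^+ n.+1) (n.+1%:R * f x ^+ n * a).
Proof.
move=> df; rewrite (_ : (fun y => _) = f ^+ n.+1); last first.
  by apply/funext => y; rewrite fctE.
exact: is_deriveX.
Qed.

Lemma is_derive_invf f x a : f x != 0 -> is_derive x 1 f a ->
  is_derive x 1 (fun y => (f y)^-1) (- (f x ^- 2) * a).
Proof. by move=> f0 df; exact: is_deriveV. Qed.

End PointwiseDerivatives.

(** * Trigonometric expressions for the derivative and their bounds *)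

Section TrigonometricFamily.
Context {R : realType}.
Variables (tau eps : R) (m : nat).
Local Notation k := (m.+1%:R : R).
Implicit Types (s c x : R).

(* In the coordinate u = - cot (pi x), where s = sin (pi x) and c = cos (pi x),
   the map below is u |-> u + qpol s with s ^ 2 = 1 / (1 + u ^ 2); its derivative
   in x is npol s c / dpol s c. The suffix 1 denotes the derivative along the
   rotation field s' = pi c, c' = - pi s. *)
Definition qpol s : R := tau + eps * (s ^+ 2) ^+ m.+1.
Definition npol s c : R := 1 + 2 * eps * k * ((s ^+ 2) ^+ m.+1 * (s * c)).
Definition dpol s c : R := 1 - 2 * qpol s * (s * c) + qpol s ^+ 2 * s ^+ 2.
Definition qpol1 s c : R := 2 * pi * eps * k * ((s ^+ 2) ^+ m * (s * c)).
Definition npol1 s c : R := 2 * eps * k * pi *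
  (2 * k * (s ^+ 2) ^+ m * (s * c) ^+ 2 + (s ^+ 2) ^+ m.+1 * (c ^+ 2 - s ^+ 2)).
Definition dpol1 s c : R :=
  - 2 * (qpol1 s c * (s * c) + qpol s * pi * (c ^+ 2 - s ^+ 2))
  + 2 * qpol s * qpol1 s c * s ^+ 2 + 2 * qpol s ^+ 2 * pi * (s * c).

Section AlongRotation.
Variables (S C : R -> R) (x g : R).
Hypothesis dS : is_derive x 1 S (pi * C x * g).
Hypothesis dC : is_derive x 1 C (- pi * S x * g).

Let dS2 : is_derive x 1 (fun y => S y ^+ 2) (2 * pi * (S x * C x) * g).
Proof. by apply: is_derive_val (is_derive_powf 1 dS) _; rewrite expr1; ring. Qed.

Let dSC : is_derive x 1 (fun y => S y * C y) (pi * (C x ^+ 2 - S x ^+ 2) * g).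
Proof. by apply: is_derive_val (is_derive_mulf dS dC) _; ring. Qed.

Lemma is_derive_qpol : is_derive x 1 (fun y => qpol (S y)) (qpol1 (S x) (C x) * g).
Proof.
apply: is_derive_val (is_derive_addf (is_derive_cst tau x 1)
  (is_derive_scalef eps (is_derive_powf m dS2))) _.
by rewrite /qpol1; ring.
Qed.

Lemma is_derive_npol :
  is_derive x 1 (fun y => npol (S y) (C y)) (npol1 (S x) (C x) * g).
Proof.
apply: is_derive_val (is_derive_addf (is_derive_cst (1 : R) x 1)
  (is_derive_scalef (2 * eps * k) (is_derive_mulf (is_derive_powf m dS2) dSC))) _.
by rewrite /npol1; ring.
Qed.

Lemma is_derive_dpol :
  is_derive x 1 (fun y => dpol (S y) (C y)) (dpol1 (S x) (C x) * g).
Proof.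
have dq2 := is_derive_powf 1 is_derive_qpol.
rewrite (_ : (fun y => _) = fun y => 1 +
  (- 2 * (qpol (S y) * (S y * C y)) + qpol (S y) ^+ 2 * S y ^+ 2)); last first.
  by apply/funext => y; rewrite /dpol; ring.
apply: is_derive_val (is_derive_addf (is_derive_cst (1 : R) x 1)
  (is_derive_addf (is_derive_scalef (- 2) (is_derive_mulf is_derive_qpol dSC))
    (is_derive_mulf dq2 dS2))) _.
by rewrite /dpol1 expr1; ring.
Qed.

End AlongRotation.

Section Generated.
Variable (gen : set (R -> R)) (S C : R -> R).
Hypotheses (gS : generated gen S) (gC : generated gen C).

Ltac gentac := repeat first
  [ exact: gS | exact: gC | exact: generated_cst | apply: generatedD
  | apply: generatedX | apply: generatedM | apply: generatedN ].

Lemma generated_npol : generated gen (fun x => npol (S x) (C x)).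
Proof. by rewrite /npol; gentac. Qed.

Lemma generated_npol1 : generated gen (fun x => npol1 (S x) (C x)).
Proof. by rewrite /npol1; gentac. Qed.

Lemma generated_dpol : generated gen (fun x => dpol (S x) (C x)).
Proof. by rewrite /dpol /qpol; gentac. Qed.

Lemma generated_dpol1 : generated gen (fun x => dpol1 (S x) (C x)).
Proof. by rewrite /dpol1 /qpol /qpol1; gentac. Qed.

End Generated.

Section Bounds.
Hypotheses (tau0 : 0 < tau) (tau8 : 8 * tau <= 1) (eps0 : 0 < eps)
  (epsm : 8 * eps * k ^+ 2 <= tau).
Variables (s c : R).
Hypothesis (sc1 : s ^+ 2 + c ^+ 2 = 1).

Let k1 : 1 <= k. Proof. by rewrite ler1n. Qed.

Let epsk : 8 * (eps * k) <= tau.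
Proof.
apply: le_trans epsm; rewrite -mulrA ler_pM2l// ler_pM2l// expr2.
by rewrite ler_peMr// (le_trans ler01).
Qed.

Let eps8 : 8 * eps <= tau.
Proof. by apply: le_trans epsk; rewrite ler_pM2l// ler_peMr// ltW. Qed.

Lemma sqr_pow_le1 (n : nat) : 0 <= (s ^+ 2) ^+ n <= 1.
Proof.
have s2 : 0 <= s ^+ 2 <= 1.
  by rewrite sqr_ge0 -sc1 lerDl sqr_ge0.
by case/andP: s2 => h1 h2; rewrite exprn_ge0//= exprn_ile1.
Qed.

Lemma sc_le1 : `|s * c| <= 1.
Proof.
rewrite ler_norml; have := sqr_ge0 (s + c); have := sqr_ge0 (s - c).
rewrite (_ : (s - c) ^+ 2 = s ^+ 2 + c ^+ 2 - 2 * (s * c)); last by ring.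
rewrite (_ : (s + c) ^+ 2 = s ^+ 2 + c ^+ 2 + 2 * (s * c)); last by ring.
by rewrite sc1 => h1 h2; apply/andP; split; lra.
Qed.

Lemma cos2_le1 : `|c ^+ 2 - s ^+ 2| <= 1.
Proof.
rewrite ler_norml; have := sqr_ge0 s; have := sqr_ge0 c.
move: sc1; move: (s ^+ 2) (c ^+ 2) => a b h0 h1 h2.
by apply/andP; split; lra.
Qed.

Lemma qpol_bounds : tau <= qpol s <= 2 * tau.
Proof.
have /andP[h1 h2] := sqr_pow_le1 m.+1; rewrite /qpol lerDl mulr_ge0 ?(ltW eps0)//=.
have : eps * (s ^+ 2) ^+ m.+1 <= eps by rewrite ler_piMr// ltW.
by move: (tau0) eps8; move: (eps * _) => z *; lra.
Qed.

Let abs_mul (a b A B : R) : `|a| <= A -> `|b| <= B -> `|a * b| <= A * B.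
Proof. by move=> aA bB; rewrite normrM ler_pM. Qed.

Let abs_add (a b A B : R) : `|a| <= A -> `|b| <= B -> `|a + b| <= A + B.
Proof. by move=> aA bB; apply: le_trans (ler_normD _ _) _; exact: lerD. Qed.

Let abs_sqr (n : nat) : `|(s ^+ 2) ^+ n| <= 1.
Proof. by have /andP[h1 h2] := sqr_pow_le1 n; rewrite ger0_norm. Qed.

Let abs_q : `|qpol s| <= 2 * tau.
Proof. by have /andP[h1 h2] := qpol_bounds; rewrite ger0_norm// (le_trans (ltW tau0)). Qed.

Let abs_s2 : `|s ^+ 2| <= 1. Proof. exact: (abs_sqr 1). Qed.

Lemma npol_bounds : 2^-1 <= npol s c <= 2.
Proof.
have := abs_mul (abs_sqr m.+1) sc_le1; rewrite /npol.
move: (_ * (s * c)) => z; rewrite mulr1 ler_norml => /andP[z1 z2].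
have ek0 : 0 <= eps * k by rewrite mulr_ge0// ltW.
have h : `|eps * k * z| <= eps * k.
  by rewrite normrM ger0_norm// ler_piMr// ler_norml z1.
move: h (tau8) epsk; rewrite ler_norml -!mulrA; move: (eps * (k * z)) (eps * k).
by move=> a b /andP[h1 h2] h3 h4; apply/andP; split; lra.
Qed.

Lemma dpol_bounds : 2^-1 <= dpol s c <= 2.
Proof.
have hq := abs_mul abs_q sc_le1; have hq2 := abs_mul (abs_mul abs_q abs_q) abs_s2.
rewrite /dpol -(mulrA 2) (expr2 (qpol s)).
have b0 : 0 <= qpol s * qpol s * s ^+ 2 by rewrite -expr2 mulr_ge0 ?sqr_ge0.
move: hq hq2 b0; move: (_ * (s * c)) (_ * s ^+ 2) => a b.
have t2 : tau * tau <= tau by rewrite ler_piMr ?(ltW tau0)//; move: (tau8); lra.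
rewrite !mulr1 !ler_norml => /andP[a1 a2] /andP[b1 b2] b0.
move: (tau8) (tau0) => t1 t0; apply/andP; split; nra.
Qed.

Let abs_q1 : `|qpol1 s c| <= pi * tau.
Proof.
have := abs_mul (abs_sqr m) sc_le1; rewrite /qpol1.
move: (_ * (s * c)) => z z1; rewrite mulr1 in z1.
have ek0 : 0 <= 2 * pi * eps * k.
  by rewrite !mulr_ge0// ?pi_ge0// ltW.
rewrite normrM (ger0_norm ek0) (le_trans (ler_piMr _ z1))//.
rewrite (_ : 2 * pi * eps * k = pi * (2 * (eps * k))); last by ring.
by rewrite ler_wpM2l ?pi_ge0//; move: epsk (tau0); move: (eps * k) => w *; lra.
Qed.

(** Each of the two differentiations of the bump brings down a factor [k], and [epsm] absorbs the
    resulting [k ^ 2]: the bound is [pi eps (4 k^2 + 2 k)], at most [8 pi eps k^2]. *)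
Lemma npol1_bound : `|npol1 s c| <= pi * tau.
Proof.
rewrite /npol1.
have h1 : `|2 * k * (s ^+ 2) ^+ m * (s * c) ^+ 2| <= 2 * k.
  rewrite -mulrA normrM ger0_norm ?mulr_ge0// ler_piMr ?mulr_ge0//.
  by have := abs_mul (abs_sqr m) (abs_mul sc_le1 sc_le1); rewrite !mulr1 -expr2.
have h2 := abs_mul (abs_sqr m.+1) cos2_le1; rewrite mulr1 in h2.
have := abs_add h1 h2; move: (_ + _) => z z1.
have ek0 : 0 <= 2 * eps * k * pi by rewrite !mulr_ge0// ?pi_ge0// ltW.
rewrite normrM (ger0_norm ek0).
apply: le_trans (ler_wpM2l ek0 z1) _.
rewrite [leLHS](_ : _ = pi * (2 * eps * k * (2 * k + 1))); last by ring.
rewrite ler_wpM2l ?pi_ge0//; apply: le_trans epsm.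
rewrite [leLHS](_ : _ = eps * (2 * k * (2 * k + 1))); last by ring.
rewrite [leRHS](_ : _ = eps * (8 * k ^+ 2)); last by ring.
by rewrite ler_pM2l//; move: k1; move: (k) => K *; nra.
Qed.

Lemma dpol1_bound : `|dpol1 s c| <= 10 * pi * tau.
Proof.
have p0 := pi_ge0 R.
have pt0 : 0 <= pi * tau by rewrite mulr_ge0// ltW.
have h1 := abs_mul abs_q1 sc_le1.
have hp : `|pi : R| <= pi by rewrite ger0_norm.
have h2 := abs_mul (abs_mul abs_q hp) cos2_le1.
have h3 := abs_mul (abs_mul abs_q abs_q1) abs_s2.
have h4 := abs_mul (abs_mul (abs_mul abs_q abs_q) hp) sc_le1.
rewrite /dpol1 [X in `|X|](_ : _ =
  - 2 * (qpol1 s c * (s * c) + qpol s * pi * (c ^+ 2 - s ^+ 2))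
  + 2 * (qpol s * qpol1 s c * s ^+ 2) + 2 * (qpol s * qpol s * pi * (s * c))); last by ring.
move: h1 h2 h3 h4; rewrite !mulr1.
move: (_ * (s * c)) (_ * (c ^+ 2 - s ^+ 2)) (_ * s ^+ 2) (_ * (s * c)) => a b d e.
have t1 : tau * (pi * tau) <= pi * tau / 8.
  by rewrite mulrC ler_wpM2l//; move: (tau8); lra.
rewrite (_ : 2 * tau * (pi * tau) = 2 * (tau * (pi * tau))); last by ring.
rewrite (_ : 2 * tau * (2 * tau) * pi = 4 * (tau * (pi * tau))); last by ring.
rewrite (_ : 2 * tau * pi = 2 * (pi * tau)); last by ring.
rewrite (_ : 10 * pi * tau = 10 * (pi * tau)); last by ring.
move: pt0 t1; move: (tau * (pi * tau)) (pi * tau) => A B B0 AB.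
rewrite !ler_norml => /andP[a1 a2] /andP[b1 b2] /andP[d1 d2] /andP[e1 e2].
by apply/andP; split; lra.
Qed.

End Bounds.
End TrigonometricFamily.

(** [S] and [C] are the sine and cosine of an angle moving with speed [pi g], and [r] is a bounded
    multiple of the reciprocal that occurs in [H']. The three form a system closed under
    differentiation, which serves both the circle map and its inverse. *)
Lemma trig_ode_smooth (R : realType) (S C r g w H H' : R -> R) :
  (forall x, `|S x| <= 1) -> (forall x, `|C x| <= 1) -> (forall x, `|r x| <= 1) ->
  (forall x : R, is_derive x 1 S (pi * C x * g x)) ->
  (forall x : R, is_derive x 1 C (- pi * S x * g x)) ->
  (forall x : R, is_derive x 1 r (w x)) ->
  (forall x : R, is_derive x 1 H (H' x)) ->
  let gen := [set S; C; r] in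
  generated gen g -> generated gen w -> generated gen H' ->
  (forall n, Ck n H) /\ real_analytic H.
Proof.
move=> S1 C1 r1 dS dC dr dH gen gg gw gH'.
have genS : generated gen S by apply: generated_gen; left; left.
have genC : generated gen C by apply: generated_gen; left; right.
apply: (@generated_smooth R gen).
- by move=> h [[->|->]|->].
- have [d1 [c1 p1]] : generated gen (fun x => pi * C x * g x).
    by apply: generatedM => //; apply: generatedM => //; exact: generated_cst.
  have [d2 [c2 p2]] : generated gen (fun x => - pi * S x * g x).
    by apply: generatedM => //; apply: generatedM => //; exact: generated_cst.
  have [d3 [c3 p3]] := gw.
  have c10 := gen_poly_ge0 p1; have c20 := gen_poly_ge0 p2.
  have c30 := gen_poly_ge0 p3.
  exists (d1 + d2 + d3)%N, (c1 + c2 + c3) => h [[->|->]|->].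
  + by exists (fun x => pi * C x * g x) => //; apply: gen_polyW p1; [lia|lra].
  + by exists (fun x => - pi * S x * g x) => //; apply: gen_polyW p2; [lia|lra].
  + by exists w => //; apply: gen_polyW p3; [lia|lra].
- rewrite (_ : derive1 H = H')//.
  by apply/funext => x; exact: is_derive_derive1.
by move=> x; exact: is_derive_derivable (dH x).
Qed.

(** The algebra behind differentiating [x + atan (a / b) / p]. *)
Lemma atan_quotient_derivative (F : fieldType) (a b a' b' D N p : F) :
  b != 0 -> D != 0 -> p != 0 -> D = b ^+ 2 + a ^+ 2 ->
  p * D + (a' * b - a * b') = p * N ->
  1 + ((1 + (a / b) ^+ 2)^-1 * (a' * b^-1 + a * (- (b ^- 2) * b'))) * p^-1 = N / D.
Proof.
move=> b0 D0 p0 DE E; have -> : N = D + (a' * b - a * b') / p.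
  by apply: (mulfI p0); rewrite -E; field.
have -> : 1 + (a / b) ^+ 2 = D / b ^+ 2 by rewrite DE; field.
by field; rewrite ?b0 ?p0 ?D0.
Qed.

(** * The circle map in the angular coordinate *)

Section CircleMap.
Context {R : realType}.
Variables (tau eps : R) (m : nat).
Hypotheses (tau0 : 0 < tau) (tau8 : 8 * tau <= 1) (eps0 : 0 < eps)
  (epsm : 8 * eps * m.+1%:R ^+ 2 <= tau).
Implicit Types (x y u : R).

Let sn x : R := sin (pi * x).
Let cs x : R := cos (pi * x).

Notation q := (qpol tau eps m).
Notation nn x := (npol eps m (sn x) (cs x)).
Notation dd x := (dpol tau eps m (sn x) (cs x)).

Let sc1 x : sn x ^+ 2 + cs x ^+ 2 = 1.
Proof. by rewrite addrC cos2Dsin2. Qed.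

Let dsn x : is_derive x 1 sn (pi * cs x * 1).
Proof.
apply: is_derive_val (_ : is_derive x 1 sn (cs x * pi)) _; last by ring.
apply: (@is_derive1_comp _ sin (fun y => pi * y)).
by apply: is_derive_val (is_derive_scalef pi (is_derive_id x 1)) _; rewrite mulr1.
Qed.

Let dcs x : is_derive x 1 cs (- pi * sn x * 1).
Proof.
apply: is_derive_val (_ : is_derive x 1 cs (- sn x * pi)) _; last by ring.
apply: (@is_derive1_comp _ cos (fun y => pi * y)).
by apply: is_derive_val (is_derive_scalef pi (is_derive_id x 1)) _; rewrite mulr1.
Qed.

Let sn_le1 x : `|sn x| <= 1.
Proof. by rewrite ler_norml sin_geN1 sin_le1. Qed.

Let cs_le1 x : `|cs x| <= 1.
Proof. by rewrite ler_norml cos_geN1 cos_le1. Qed.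

(** With s = sin(pi x) and c = cos(pi x), the translation u |-> u + q sends the direction (c, s) to
    (c - q s, s), and the angle between the two has tangent q s^2 / (1 - q s c). The denominator
    stays positive because q is small, so one formula serves all [x], including the integers, where
    u is infinite. *)
Definition circle_map x : R :=
  x + atan (q (sn x) * sn x ^+ 2 / (1 - q (sn x) * (sn x * cs x))) / pi.

Let den x := 1 - q (sn x) * (sn x * cs x).

Let den_gt0 x : 2^-1 <= den x.
Proof.
have /andP[q1 q2] := qpol_bounds tau0 eps0 epsm (sc1 x).
have := sc_le1 (sc1 x); rewrite ler_norml /den => /andP[h1 h2].
have : q (sn x) * (sn x * cs x) <= q (sn x) by rewrite ler_piMr// (le_trans (ltW tau0)).
by move: q1 q2 (tau8); move: (q (sn x)) (_ * (sn x * _)) => a b *; lra.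
Qed.

Let den0 x : den x != 0.
Proof. by have := den_gt0 x => h; rewrite gt_eqF//; lra. Qed.

Let nn_bounds x : 2^-1 <= nn x <= 2. Proof. exact: (npol_bounds tau8 eps0 epsm (sc1 x)). Qed.
Let dd_bounds x : 2^-1 <= dd x <= 2.
Proof. exact: (dpol_bounds tau0 tau8 eps0 epsm (sc1 x)). Qed.

Let nn0 x : nn x != 0.
Proof. by have /andP[h _] := nn_bounds x; rewrite gt_eqF//; move: h; lra. Qed.
Let dd0 x : dd x != 0.
Proof. by have /andP[h _] := dd_bounds x; rewrite gt_eqF//; move: h; lra. Qed.

Lemma is_derive_circle_map x : is_derive x 1 circle_map (nn x / dd x).
Proof.
have pi0 : (pi : R) != 0 by rewrite gt_eqF ?pi_gt0.
have dq := is_derive_qpol tau eps m (dsn x).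
have ds2 := is_derive_powf 1 (dsn x).
have dA := is_derive_mulf dq ds2.
have dsc := is_derive_mulf dq (is_derive_mulf (dsn x) (dcs x)).
have dB : is_derive x 1 den (- (qpol1 eps m (sn x) (cs x) * (sn x * cs x) +
    q (sn x) * pi * (cs x ^+ 2 - sn x ^+ 2))).
  rewrite (_ : den = fun y => 1 + -1 * (q (sn y) * (sn y * cs y))); last first.
    by apply/funext => y; rewrite /den mulN1r.
  apply: is_derive_val (is_derive_addf (is_derive_cst (1 : R) x 1)
    (is_derive_scalef (-1) dsc)) _.
  by ring.
have dQ := is_derive_mulf dA (is_derive_invf (den0 x) dB).
have dT := is_derive1_comp (is_derive1_atan _) dQ.
have dF := is_derive_addf (is_derive_id x 1)
  (is_derive_mulf dT (is_derive_cst (pi^-1 : R) x 1)).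
apply: is_derive_val dF _; rewrite mulr0 addr0.
apply: atan_quotient_derivative => //.
  rewrite /dpol /den (_ : q (sn x) ^+ 2 * sn x ^+ 2 =
    q (sn x) ^+ 2 * sn x ^+ 2 * (sn x ^+ 2 + cs x ^+ 2)); last by rewrite sc1 mulr1.
  by ring.
rewrite expr1 /npol /dpol /den /qpol1 (exprS _ m).
apply/eqP; rewrite -subr_eq0; apply/eqP.
transitivity (pi * q (sn x) ^+ 2 * sn x ^+ 2 * (1 - (sn x ^+ 2 + cs x ^+ 2))).
  by ring.
by rewrite sc1 subrr mulr0.
Qed.

Lemma circle_map_continuous : continuous circle_map.
Proof.
apply: derivable_continuous => x; exact: is_derive_derivable (is_derive_circle_map x).
Qed.

Lemma circle_map_increasing : {homo circle_map : x y / x < y}.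
Proof.
move=> x y xy; apply: (@gtr0_derive1_incr R circle_map x y _ _ _ x y (lexx x) xy (lexx y)).
- by move=> z _; exact: is_derive_derivable (is_derive_circle_map z).
- move=> z _; rewrite (is_derive_derive1 (is_derive_circle_map z)).
  have /andP[h1 _] := nn_bounds z; have /andP[h2 _] := dd_bounds z.
  by rewrite divr_gt0//; [move: h1|move: h2]; lra.
- exact/continuous_subspaceT/circle_map_continuous.
Qed.

Lemma circle_map1 x : circle_map (x + 1) = circle_map x + 1.
Proof.
have sn1 : sn (x + 1) = - sn x by rewrite /sn mulrDr mulr1 sinDpi.
have cs1 : cs (x + 1) = - cs x by rewrite /cs mulrDr mulr1 cosDpi.
by rewrite /circle_map sn1 cs1 /qpol !sqrrN mulrNN; ring.
Qed.

Lemma circle_map_smooth : (forall n, Ck n circle_map) /\ real_analytic circle_map.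
Proof.
have dd2 x := is_derive_dpol tau eps m (dsn x) (dcs x).
(* The reciprocal of [dd x] is at most 2; the factor 1/2 makes it a generator bounded by 1. *)
pose r (x : R) : R := 2^-1 * (dd x)^-1.
have dr (x : R) : is_derive x 1 r (- 2 * r x ^+ 2 * dpol1 tau eps m (sn x) (cs x)).
  apply: is_derive_val
    (is_derive_scalef (2^-1 : R) (is_derive_invf (f := fun y => dd y) (dd0 x) (dd2 x))) _.
  by rewrite /r; field.
have r1 x : `|r x| <= 1.
  have /andP[h1 _] := dd_bounds x; have d0 : 0 < dd x by move: h1; lra.
  by rewrite /r ger0_norm ?mulr_ge0 ?invr_ge0 ?(ltW d0)// ler_pdivrMr// mul1r.
have dF x : is_derive x 1 circle_map (2 * nn x * r x).
  by apply: is_derive_val (is_derive_circle_map x) _; rewrite /r; field.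
have gen_s : generated [set sn; cs; r] sn by apply: generated_gen; left; left.
have gen_c : generated [set sn; cs; r] cs by apply: generated_gen; left; right.
have gen_r : generated [set sn; cs; r] r by apply: generated_gen; right.
apply: (trig_ode_smooth sn_le1 cs_le1 r1 dsn dcs dr dF).
- exact: generated_cst.
- apply: generatedM; last exact: generated_dpol1.
  by apply: generatedM; [exact: generated_cst|exact: generatedX].
- apply: generatedM => //.
  by apply: generatedM; [exact: generated_cst|exact: generated_npol].
Qed.

(** Along [G] the sine and cosine move with speed [dd (G x) / nn (G x)], which is polynomial in them
    and in the reciprocal of [nn (G x)]; the system is closed as for the map itself. *)
Lemma circle_map_inverse_smooth G : cancel circle_map G -> cancel G circle_map ->
  (forall n, Ck n G) /\ real_analytic G.
Proof.
move=> FG GF; pose S x := sn (G x); pose C x := cs (G x).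
pose r (x : R) : R := 2^-1 * (nn (G x))^-1; pose g x := dd (G x) * (2 * r x).
have dG x : is_derive x 1 G (g x).
  have F'0 y : nn y / dd y != 0 by rewrite mulf_neq0// invr_eq0.
  apply: is_derive_val (is_derive_lift_inverse circle_map_continuous FG GF
    is_derive_circle_map F'0 x) _.
  by rewrite /g /r invf_div; field.
have dS x : is_derive x 1 S (pi * C x * g x).
  apply: is_derive_val (is_derive1_comp (dsn (G x)) (dG x)) _.
  by rewrite mulr1.
have dC x : is_derive x 1 C (- pi * S x * g x).
  apply: is_derive_val (is_derive1_comp (dcs (G x)) (dG x)) _.
  by rewrite mulr1.
have dN x := is_derive_npol eps m (dS x) (dC x).
have dr (x : R) : is_derive x 1 r (- 2 * r x ^+ 2 * (npol1 eps m (S x) (C x) * g x)).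
  apply: is_derive_val
    (is_derive_scalef (2^-1 : R) (is_derive_invf (f := fun y => nn (G y)) (nn0 (G x)) (dN x))) _.
  by rewrite /r; field.
have r1 x : `|r x| <= 1.
  have /andP[h1 _] := nn_bounds (G x); have d0 : 0 < nn (G x) by move: h1; lra.
  by rewrite /r ger0_norm ?mulr_ge0 ?invr_ge0 ?(ltW d0)// ler_pdivrMr// mul1r.
have gen_s : generated [set S; C; r] S by apply: generated_gen; left; left.
have gen_c : generated [set S; C; r] C by apply: generated_gen; left; right.
have gen_r : generated [set S; C; r] r by apply: generated_gen; right.
have gen_g : generated [set S; C; r] g.
  apply: generatedM; first exact: generated_dpol.
  by apply: generatedM => //; exact: generated_cst.
have Sle x : `|S x| <= 1 by exact: sn_le1.
have Cle x : `|C x| <= 1 by exact: cs_le1.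
apply: (trig_ode_smooth Sle Cle r1 dS dC dr dG) => //.
apply: generatedM; last by apply: generatedM => //; exact: generated_npol1.
by apply: generatedM; [exact: generated_cst|exact: generatedX].
Qed.

Lemma derive1_circle_map : derive1 circle_map = fun x => nn x / dd x.
Proof.
by apply/funext => x; exact: is_derive_derive1 (is_derive_circle_map x).
Qed.

(** The quotient rule with [pi <= 4] gives at most [8 tau + 320 tau]. *)
Lemma derive2_circle_map_bound x : `|derive1 (derive1 circle_map) x| <= 400 * tau.
Proof.
rewrite derive1_circle_map.
have dN := is_derive_npol eps m (dsn x) (dcs x).
have dD := is_derive_dpol tau eps m (dsn x) (dcs x).
rewrite (is_derive_derive1 (is_derive_mulf dN
  (is_derive_invf (f := fun y => dd y) (dd0 x) dD))).
have n1 := npol1_bound eps0 epsm (sc1 x).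
have d1 := dpol1_bound tau0 tau8 eps0 epsm (sc1 x).
have := nn_bounds x; have := dd_bounds x; rewrite !mulr1.
move: n1 d1; move: (npol1 _ _ _ _) (dpol1 _ _ _ _ _) (nn x) (dd x) => n1 d1 n d.
move=> bn1 bd1 /andP[dl du] /andP[nl nu].
have d0 : 0 < d by move: dl; lra.
have p4 : (pi : R) <= 4 by have := pihalf_lt2 R; lra.
have pt : pi * tau <= 4 * tau by rewrite ler_pM2r.
rewrite (_ : n1 / d + _ = n1 / d - n * d1 / d ^+ 2); last by field; rewrite gt_eqF.
apply: le_trans (ler_normB _ _) _.
have dV : d^-1 <= 2 by rewrite -[leRHS]invrK lef_pV2 ?posrE// invr_gt0.
have dV2 : d ^- 2 <= 4.
  rewrite -exprVn expr2 (_ : 4 = 2 * 2); last by ring.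
  by apply: ler_pM => //; rewrite invr_ge0 ltW.
have b1 : `|n1 / d| <= 4 * tau * 2.
  rewrite normrM normfV (gtr0_norm d0); apply: ler_pM => //.
    by rewrite invr_ge0 ltW.
  exact: le_trans bn1 pt.
have b2 : `|n * d1 / d ^+ 2| <= 2 * (40 * tau) * 4.
  rewrite normrM normfV (ger0_norm (sqr_ge0 d)); apply: ler_pM => //.
    by rewrite invr_ge0 sqr_ge0.
  rewrite normrM; apply: ler_pM => //.
    by rewrite ger0_norm//; move: nl; lra.
  by apply: le_trans bd1 _; rewrite -mulrA; move: pt; move: (pi * tau) => z; lra.
by move: b1 b2; move: (`|n1 / d|) (`|_ / _|) => a b *; move: (tau0); lra.
Qed.

End CircleMap.

(** * The parabolic coordinate and the conjugacy to a map of the line *)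

Section ParabolicCoordinate.
Context {R : realType}.
Variables (tau eps : R) (m : nat).
Hypotheses (tau0 : 0 < tau) (tau8 : 8 * tau <= 1) (eps0 : 0 < eps)
  (epsm : 8 * eps * m.+1%:R ^+ 2 <= tau).
Implicit Types (x y u : R).

(* u = - cot (pi x) on the open arc 0 < x < 1 *)
Definition arc_point u : R := 2^-1 + atan u / pi.

Definition arc_bump u : R := ((1 + u ^+ 2)^-1) ^+ m.+1.

Definition line_map u : R := u + (tau + eps * arc_bump u).

Lemma oneDsqr_gt0 u : 0 < 1 + u ^+ 2.
Proof. by rewrite ltr_pwDl// sqr_ge0. Qed.

Let D0 u : 1 + u ^+ 2 != 0. Proof. by rewrite gt_eqF// oneDsqr_gt0. Qed.

Lemma arc_pointE u : pi * arc_point u = atan u + pi / 2.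
Proof.
have p0 : (pi : R) != 0 by rewrite gt_eqF ?pi_gt0.
by rewrite /arc_point; move: p0; move: (pi : R) => p p0; field.
Qed.

Lemma arc_point_bounds u : 0 < arc_point u < 1.
Proof.
have h1 := atan_gtNpi2 u; have h2 := atan_ltpi2 u; have p0 := pi_gt0 R.
rewrite -(ltr_pM2l p0) mulr0 -[X in _ && X](ltr_pM2l p0) mulr1 arc_pointE.
by apply/andP; split; lra.
Qed.

Lemma is_derive_arc_point u : is_derive u 1 arc_point ((pi * (1 + u ^+ 2))^-1).
Proof.
apply: is_derive_val (is_derive_addf (is_derive_cst (2^-1 : R) u 1)
  (is_derive_mulf (is_derive1_atan u) (is_derive_cst (pi^-1 : R) u 1))) _.
by rewrite mulr0 addr0 add0r invfM mulrC.
Qed.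

Lemma arc_point_increasing : {homo arc_point : x y / x < y}.
Proof.
move=> x y xy; rewrite ltrD2l ltr_pM2r ?invr_gt0 ?pi_gt0//.
apply: (@gtr0_derive1_incr R atan x y _ _ _ x y (lexx x) xy (lexx y)).
- by move=> z _; exact: is_derive_derivable (is_derive1_atan z).
- move=> z _; rewrite (is_derive_derive1 (is_derive1_atan z)).
  by rewrite invr_gt0 oneDsqr_gt0.
apply/continuous_subspaceT/derivable_continuous => z.
exact: is_derive_derivable (is_derive1_atan z).
Qed.

Lemma sin_arc_point u : sin (pi * arc_point u) ^+ 2 = (1 + u ^+ 2)^-1.
Proof.
by rewrite arc_pointE sinDpihalf cos_atan exprVn sqr_sqrtr// ltW// oneDsqr_gt0.
Qed.

Lemma cos_arc_point u : cos (pi * arc_point u) = - u * sin (pi * arc_point u).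
Proof.
rewrite arc_pointE cosDpihalf sinDpihalf mulNr; congr (- _).
have c0 : cos (atan u) != 0.
  by rewrite cos_atan invr_eq0 gt_eqF// sqrtr_gt0 oneDsqr_gt0.
by have := atanK u; rewrite /tan => E; rewrite -[LHS](divfK c0) E.
Qed.

Lemma sin_cos_arc_point u :
  sin (pi * arc_point u) * cos (pi * arc_point u) = - u / (1 + u ^+ 2).
Proof. by rewrite cos_arc_point -sin_arc_point; ring. Qed.

Lemma qpol_arc_point u :
  qpol tau eps m (sin (pi * arc_point u)) = tau + eps * arc_bump u.
Proof. by rewrite /qpol sin_arc_point. Qed.

Lemma is_derive_line_map u : is_derive u 1 line_map
  (npol eps m (sin (pi * arc_point u)) (cos (pi * arc_point u))).
Proof.
have d2 : is_derive u 1 (fun u : R => 1 + u ^+ 2) (2 * u).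
  apply: is_derive_val (is_derive_addf (is_derive_cst (1 : R) u 1)
    (is_derive_powf 1 (is_derive_id u 1))) _.
  by rewrite expr1; ring.
have dV := is_derive_invf (f := fun u => 1 + u ^+ 2) (D0 u) d2.
apply: is_derive_val (is_derive_addf (is_derive_id u 1)
  (is_derive_addf (is_derive_cst (tau : R) u 1)
    (is_derive_scalef eps (is_derive_powf m dV)))) _.
rewrite /npol sin_arc_point sin_cos_arc_point (exprS _ m) -exprVn.
move: (_ ^+ m) (m.+1%:R : R) => w k; move: (D0 u) => h.
by field.
Qed.

(** Both sides have the same derivative in [u] and the same value at 0, so no addition formula for
    [atan] enters. *)
Lemma circle_map_arc_point u :
  circle_map tau eps m (arc_point u) = arc_point (line_map u).
Proof.
pose h u := circle_map tau eps m (arc_point u) - arc_point (line_map u).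
have dh (v : R) : is_derive v 1 h 0.
  have dF := is_derive1_comp (is_derive_circle_map tau0 tau8 eps0 epsm (arc_point v))
    (is_derive_arc_point v).
  have dG := is_derive1_comp (is_derive_arc_point (line_map v)) (is_derive_line_map v).
  rewrite (_ : h = fun u => (circle_map tau eps m \o arc_point) u +
    -1 * (arc_point \o line_map) u); last by apply/funext => z; rewrite /h mulN1r.
  apply: is_derive_val (is_derive_addf dF (is_derive_scalef (-1) dG)) _.
  (* In the coordinate [dpol] is the ratio of the speeds of the chart at [v] and at [line_map v]. *)
  have -> : dpol tau eps m (sin (pi * arc_point v)) (cos (pi * arc_point v)) =
      (1 + line_map v ^+ 2) / (1 + v ^+ 2).
    rewrite /dpol sin_cos_arc_point sin_arc_point qpol_arc_point /line_map.
    by move: (tau + _) (D0 v) => Q V0; field.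
  have pp : (pi : R) != 0 by rewrite gt_eqF ?pi_gt0.
  move: pp (npol _ _ _ _) (D0 v) (D0 (line_map v)); move: (pi : R) => p pp N V0 L0.
  by field; rewrite ?pp ?V0 ?L0.
have h0 : h 0 = 0.
  have E0 : pi * arc_point 0 = pi / 2 by rewrite arc_pointE atan0 add0r.
  rewrite /h /circle_map E0 sin_pihalf cos_pihalf /line_map /arc_bump /arc_point /qpol.
  by rewrite atan0 mul0r addr0 !expr0n /= addr0 invr1 !mulr0 subr0 !expr1n divr1 mulr1 add0r subrr.
have : h u = h 0 by apply: is_derive_0_is_cst.
by rewrite h0 /h => /eqP; rewrite subr_eq0 => /eqP.
Qed.

Lemma circle_map0 : circle_map tau eps m 0 = 0.
Proof.
by rewrite /circle_map mulr0 sin0 cos0 !expr0n /= mulr0 mul0r atan0 mul0r addr0.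
Qed.

Lemma arc_bump_ge0 u : 0 <= arc_bump u.
Proof. by rewrite exprn_ge0// invr_ge0 ltW// oneDsqr_gt0. Qed.

Lemma arc_bump0 : arc_bump 0 = 1.
Proof. by rewrite /arc_bump expr0n /= addr0 invr1 expr1n. Qed.

(** Bernoulli's inequality for [(1 + u ^ 2) ^ (m + 1)]; the factor [m + 1] makes the bump thin. *)
Lemma arc_bump_le_inv_sqr u : u != 0 -> arc_bump u <= (m.+1%:R * u ^+ 2)^-1.
Proof.
move=> u0; have s0 : 0 < u ^+ 2 by rewrite exprn_even_gt0.
have p1 : 0 < m.+1%:R * u ^+ 2 by rewrite mulr_gt0// ltr0n.
have p2 : 0 < (1 + u ^+ 2) ^+ m.+1 by rewrite exprn_gt0// oneDsqr_gt0.
rewrite /arc_bump exprVn lef_pV2 ?posrE// {p1 p2}.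
elim: (m.+1) => [|k IH]; first by rewrite mul0r.
rewrite (exprS _ k) [leRHS]mulrDl mul1r -natr1 mulrDl mul1r lerD//.
by rewrite ler_peMr ?(ltW s0)// exprn_ege1// lerDl ltW.
Qed.

Lemma arc_bump_le1 u : arc_bump u <= 1.
Proof.
rewrite /arc_bump exprn_ile1// ?invr_ge0 ?(ltW (oneDsqr_gt0 _))//.
by rewrite invf_le1 ?oneDsqr_gt0// lerDl sqr_ge0.
Qed.

Lemma line_map_increasing : {homo line_map : x y / x < y}.
Proof.
move=> x y xy.
apply: (@gtr0_derive1_incr R line_map x y _ _ _ x y (lexx x) xy (lexx y)).
- by move=> z _; exact: is_derive_derivable (is_derive_line_map z).
- move=> z _; rewrite (is_derive_derive1 (is_derive_line_map z)).
  have sc1 : sin (pi * arc_point z) ^+ 2 + cos (pi * arc_point z) ^+ 2 = 1.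
    by rewrite addrC cos2Dsin2.
  by have /andP[h _] := npol_bounds tau8 eps0 epsm sc1; move: h; lra.
apply/continuous_subspaceT/derivable_continuous => z.
exact: is_derive_derivable (is_derive_line_map z).
Qed.

Lemma line_map_continuous : continuous line_map.
Proof.
by apply: derivable_continuous => z; exact: is_derive_derivable (is_derive_line_map z).
Qed.

Lemma circle_map_gt x : 0 < x < 1 -> x < circle_map tau eps m x < 1.
Proof.
move=> /andP[x0 x1].
have [u <-] : exists u, arc_point u = x.
  exists (tan (pi * x - pi / 2)); rewrite /arc_point tanK.
    have : (pi : R) != 0 by rewrite gt_eqF ?pi_gt0.
    by move: (pi : R) => p p0; field.
  have p0 := pi_gt0 R; rewrite in_itv/=.
  have : 0 < pi * x by rewrite mulr_gt0.
  have : pi * x < pi by rewrite gtr_pMr.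
  by move: (pi * x) => z *; apply/andP; split; lra.
rewrite circle_map_arc_point; apply/andP; split.
  apply: arc_point_increasing; rewrite ltrDl ltr_pwDl//.
  by rewrite mulr_ge0 ?(ltW eps0) ?arc_bump_ge0.
by have /andP[] := arc_point_bounds (line_map u).
Qed.

End ParabolicCoordinate.

(** * Orbits on the line and contraction of fundamental intervals *)

Section LineDynamics.
Context {R : realType}.
Variables (tau eps : R) (m : nat).
Hypotheses (tau0 : 0 < tau) (tau8 : 8 * tau <= 1) (eps0 : 0 < eps)
  (epsm : 8 * eps * m.+1%:R ^+ 2 <= tau) (mtau : 80 <= m.+1%:R * tau ^+ 2).
Implicit Types (x y z u : R) (l r n N K : nat).

Notation phi := (line_map tau eps m).
Notation hump := (arc_bump m).

Let eps8 : 8 * eps <= tau.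
Proof.
by apply: le_trans epsm; rewrite ler_peMr ?mulr_ge0 ?(ltW eps0)// exprn_ege1// ler1n.
Qed.

Lemma line_map_ge u : u + tau <= phi u.
Proof. by rewrite /line_map addrA lerDl mulr_ge0 ?(ltW eps0) ?arc_bump_ge0. Qed.

Lemma line_map_le u : phi u <= u + (tau + eps).
Proof. by rewrite /line_map !lerD2l ler_piMr ?(ltW eps0) ?arc_bump_le1. Qed.

Lemma line_map_surjective y : exists x, phi x = y.
Proof.
have h1 := line_map_ge y; have h2 := line_map_le (y - (tau + eps)).
have yy : y - (tau + eps) <= y by move: (tau0) (eps0); lra.
have mid : Num.min (phi (y - (tau + eps))) (phi y) <= y <=
    Num.max (phi (y - (tau + eps))) (phi y).
  rewrite ge_min le_max; apply/andP; split; apply/orP; [left|right].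
    by move: h2; lra.
  by move: h1 (tau0); lra.
have cphi : continuous phi by exact: line_map_continuous.
by have [x _ <-] := IVT yy (continuous_subspaceT cphi) mid; exists x.
Qed.

(** For [x >= tau / 4] one has [x + tau <= 5 x], so [1 / x^2] is at most [5 / tau] times
    [1 / x - 1 / (x + tau)], which telescopes and leaves [(5 / tau) (4 / tau)]. *)
Lemma sum_inv_sqr_le (x : nat -> R) n : tau / 4 <= x 0%N ->
  (forall j, x j + tau <= x j.+1) -> \sum_(j < n) (x j ^+ 2)^-1 <= 20 / tau ^+ 2.
Proof.
move=> x0 xS.
have xge j : tau / 4 <= x j.
  by elim: j => // j IH; have := xS j; move: (tau0) IH; lra.
have xgt j : 0 < x j by have := xge j; move: (tau0); lra.
have step j : (x j ^+ 2)^-1 <= 5 / tau * ((x j)^-1 - (x j.+1)^-1).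
  have h : (x j.+1)^-1 <= (x j + tau)^-1.
    by rewrite lef_pV2 ?posrE ?xgt ?addr_gt0 ?xgt.
  apply: (@le_trans _ _ (5 / tau * ((x j)^-1 - (x j + tau)^-1))); last first.
    by rewrite ler_wpM2l ?divr_ge0 ?(ltW tau0)// lerB.
  have := xge j; have := xgt j; move: (x j) => y y0 yt.
  have yt0 : 0 < y + tau by rewrite addr_gt0.
  rewrite (_ : 5 / tau * _ = 5 / (y * (y + tau))); last first.
    by field; rewrite !gt_eqF.
  rewrite ler_pdivlMr ?mulr_gt0// mulrC ler_pdivrMr ?exprn_gt0//.
  by rewrite expr2 mulrCA ler_pM2l//; move: yt; lra.
apply: (@le_trans _ _ (5 / tau * ((x 0%N)^-1 - (x n)^-1))).
  elim: n => [|n IH]; first by rewrite big_ord0 subrr mulr0.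
  rewrite big_ord_recr/= (le_trans (lerD IH (step n)))// -mulrDr.
  by rewrite addrA subrK.
have xn : 0 <= (x n)^-1 by rewrite invr_ge0 ltW.
have x0V : (x 0%N)^-1 <= 4 / tau.
  by rewrite -invf_div lef_pV2 ?posrE ?divr_gt0.
rewrite (_ : 20 / tau ^+ 2 = 5 / tau * (4 / tau)); last by field; rewrite gt_eqF.
by rewrite ler_wpM2l ?divr_ge0 ?(ltW tau0)//; move: xn x0V; lra.
Qed.

(** The sum is at most [20 / ((m + 1) tau^2)]; the number 80 in [mtau] is chosen to make this
    1/4. *)
Lemma sum_arc_bump_le (x : nat -> R) n : tau / 4 <= x 0%N ->
  (forall j, x j + tau <= x j.+1) ->
  \sum_(j < n) hump (x j) <= 4^-1.
Proof.
move=> x0 xS; have k0 : 0 < m.+1%:R :> R by rewrite ltr0n.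
have xge j : tau / 4 <= x j.
  by elim: j => // j IH; have := xS j; move: (tau0) IH; lra.
apply: (@le_trans _ _ (m.+1%:R^-1 * (20 / tau ^+ 2))).
  apply: le_trans (_ : m.+1%:R^-1 * \sum_(j < n) (x j ^+ 2)^-1 <= _); last first.
    by rewrite ler_pM2l ?invr_gt0//; exact: sum_inv_sqr_le.
  rewrite mulr_sumr; apply: ler_sum => j _; rewrite -invfM.
  apply: arc_bump_le_inv_sqr; rewrite gt_eqF//.
  by have := xge j; move: (tau0); lra.
rewrite mulrA (mulrC _ 20) -mulrA -invfM ler_pdivrMr ?mulr_gt0 ?exprn_gt0//.
by move: mtau; lra.
Qed.

Section Iterates.
Variable psi : R -> R.
Hypotheses (phiK : cancel phi psi) (psiK : cancel psi phi).

Lemma iter_phi_sum r y : iter r phi y =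
  y + r%:R * tau + eps * \sum_(j < r) hump (iter j phi y).
Proof.
elim: r => [|r IH]; first by rewrite big_ord0 mulr0 mul0r !addr0.
by rewrite big_ord_recr/= {1}/line_map {1}IH -natr1; ring.
Qed.

Lemma psiE y : psi y = y - tau - eps * hump (psi y).
Proof. by have := psiK y; rewrite /line_map => E; rewrite -{2}E; ring. Qed.

Lemma iter_psi_sum l y : iter l psi y =
  y - l%:R * tau - eps * \sum_(j < l) hump (iter j.+1 psi y).
Proof.
elim: l => [|l IH]; first by rewrite big_ord0 mulr0 mul0r !subr0.
by rewrite big_ord_recr/= {1}psiE {1}IH -natr1; ring.
Qed.

Lemma psi_increasing : {homo psi : x y / x < y}.
Proof.
move=> x y xy; have [//|yx|E] := ltgtP (psi x) (psi y).
  have := line_map_increasing tau8 eps0 epsm yx; rewrite !psiK => yx'.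
  by move: (lt_trans xy yx'); rewrite ltxx.
by move: xy; rewrite -(psiK x) E psiK ltxx.
Qed.

Lemma iter_increasing (F : R -> R) n : {homo F : x y / x < y} ->
  {homo iter n F : x y / x < y}.
Proof. by move=> FI; elim: n => //= n IH x y /IH/FI. Qed.

Lemma iter_phi_psi n l y : iter (n + l) phi (iter l psi y) = iter n phi y.
Proof.
elim: l => [|l IH]; first by rewrite addn0.
by rewrite addnS iterSr iterS psiK IH.
Qed.

Lemma iter_phi_psi_le i l y : (i <= l)%N ->
  iter i phi (iter l psi y) = iter (l - i) psi y.
Proof.
move=> il; rewrite -{1}(subnK il) addnC iterD.
by have := iter_phi_psi 0 i (iter (l - i) psi y).
Qed.

(* The orbit of the midpoint of the fundamental interval [0, tau + eps] stays
   away from 0, where the hump is concentrated; the orbit of 0 does not. *)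
Let b := (tau + eps) / 2.

Let b_gt : tau / 4 <= b. Proof. by rewrite /b; move: (tau0) (eps0); lra. Qed.

Lemma iter_phi_mid_le r : iter r phi b <= b + r%:R * tau + eps / 4.
Proof.
rewrite iter_phi_sum lerD2l ler_pM2l//; apply: sum_arc_bump_le => // j.
exact: line_map_ge.
Qed.

(** The bump is even, so the backward orbit is reflected into the positive half-line. Its first
    point is at most [b - tau = (eps - tau) / 2], which lies below [- tau / 4] because
    [eps <= tau / 8]. *)
Lemma iter_psi_mid_ge l : b - l%:R * tau - eps / 4 <= iter l psi b.
Proof.
rewrite iter_psi_sum lerB// ler_pM2l//.
rewrite (eq_bigr (fun j : 'I_l => hump (- iter j.+1 psi b))); last first.
  by move=> j _; rewrite /hump sqrrN.
have psi_le y : psi y <= y - tau.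
  by rewrite {1}psiE gerDl oppr_le0 mulr_ge0 ?(ltW eps0) ?arc_bump_ge0.
apply: (@sum_arc_bump_le (fun j => - iter j.+1 psi b)) => [/=|j].
  by have := psi_le b; rewrite /b; move: (tau0) (eps0) (eps8); lra.
by rewrite !iterS; have := psi_le (psi (iter j psi b)); lra.
Qed.

(** The whole [eps] is collected in the first step, at the top of the bump; hence the successor. *)
Lemma iter_phi_zero_ge r : r.+1%:R * tau + eps <= iter r.+1 phi 0.
Proof.
rewrite iter_phi_sum add0r lerD2l ler_pMr// big_ord_recl/= arc_bump0 lerDl.
by apply: sumr_ge0 => j _; exact: arc_bump_ge0.
Qed.

Lemma iter_psi_zero_le l : iter l psi 0 <= - (l%:R * tau).
Proof.
rewrite iter_psi_sum add0r gerDl oppr_le0 mulr_ge0 ?(ltW eps0)//.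
by apply: sumr_ge0 => j _; exact: arc_bump_ge0.
Qed.

(** The left part of a fundamental interval is at most [tau + eps] long and loses at least [eps / 2]
    in passing 0. *)
Definition mid_ratio : R := 1 - eps / (2 * (tau + eps)).

Lemma mid_ratio_bounds : 0 < mid_ratio < 1.
Proof.
have te : 0 < tau + eps by rewrite addr_gt0.
rewrite /mid_ratio gtrDl oppr_lt0 divr_gt0 ?mulr_gt0// andbT subr_gt0.
by rewrite ltr_pdivrMr ?mulr_gt0// mul1r; move: (tau0) (eps0); lra.
Qed.

Lemma mid_between l : iter l.+1 psi 0 < iter l.+1 psi b < iter l psi 0.
Proof.
have b0 : 0 < b by move: b_gt (tau0); lra.
rewrite (iter_increasing _ psi_increasing b0) andTb.
have -> : iter l psi 0 = iter l.+1 psi (phi 0) by rewrite iterSr phiK.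
apply: (iter_increasing _ psi_increasing).
by rewrite /line_map arc_bump0 mulr1 add0r /b; move: (tau0) (eps0); lra.
Qed.

(** In passing 0 the left part shrinks from at least [b - eps / 4] to at most [b - 3 eps / 4], while
    the right part grows from at most [tau - b + eps / 4] to at least [tau - b + 3 eps / 4]. The
    multiples of [tau] cancel, so the ratio is uniform in [l] and [r]. Products replace quotients of
    lengths. *)
Lemma fundamental_contraction l r : (0 < r)%N ->
  (iter r phi b - iter r phi 0) * (iter l psi 0 - iter l.+1 psi b) <=
  mid_ratio * ((iter l.+1 psi b - iter l.+1 psi 0) *
                 (iter r.+1 phi 0 - iter r phi b)).
Proof.
case: r => // r _; have /andP[h1 h2] := mid_between l.
have v0 := iter_phi_zero_ge r; have v2 := iter_phi_zero_ge r.+1.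
have v1 := iter_phi_mid_le r.+1; have u1 := iter_psi_mid_ge l.+1.
have u0 := iter_psi_zero_le l.+1; have u2 := iter_psi_zero_le l.
have len : iter l psi 0 - iter l.+1 psi 0 <= tau + eps.
  have -> : iter l psi 0 = phi (iter l.+1 psi 0) by rewrite iterS psiK.
  by have := line_map_le (iter l.+1 psi 0); lra.
move: h1 h2 v0 v1 v2 u0 u1 u2 len; rewrite -[l.+1%:R]natr1 -[r.+2%:R]natr1.
move: (iter r.+1 phi b) (iter r.+1 phi 0) (iter r.+2 phi 0) => v1 v0 v2.
move: (iter l.+1 psi b) (iter l.+1 psi 0) (iter l psi 0) => u1 u0 u2.
move: (r.+1%:R : R) (l%:R : R) => p k h1 h2 V0 V1 V2 U0 U1 U2 len.
have A' : v1 - v0 <= (u1 - u0) - eps / 2 by move: V0 V1 U0 U1; lra.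
have B' : u2 - u1 <= v2 - v1 by move: V1 V2 U1 U2 (eps0); lra.
have A0 : 0 < u1 - u0 by rewrite subr_gt0.
have B0 : 0 < u2 - u1 by rewrite subr_gt0.
have te : 0 < tau + eps by rewrite addr_gt0.
have Ak : (u1 - u0) - eps / 2 <= mid_ratio * (u1 - u0).
  rewrite /mid_ratio mulrBl mul1r lerD2l lerN2.
  rewrite mulrAC ler_pdivrMr ?mulr_gt0//.
  rewrite (_ : eps / 2 * (2 * (tau + eps)) = eps * (tau + eps)); last by field.
  by rewrite ler_pM2l//; move: h2 len; lra.
have /andP[c0 _] := mid_ratio_bounds.
apply: (@le_trans _ _ (mid_ratio * (u1 - u0) * (u2 - u1))).
  by rewrite ler_pM2r// (le_trans A').
by rewrite -mulrA ler_pM2l// ler_pM2l.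
Qed.

End Iterates.

(** The derivative of the chart is [1 / (pi (1 + u^2))]. Two points at distance at most [2 tau] and
    of modulus at least [T] have moduli in a ratio of at most [1 + 2 tau / T], so the mean slopes
    over the two parts differ by at most the factor [Q]. *)
Lemma arc_point_distortion (T x y z : R) : 0 < T -> x < y -> y < z ->
  z - x <= 2 * tau -> T <= x \/ z <= - T ->
  let Q := (1 + 2 * tau / T) ^+ 2 in
  (arc_point y - arc_point x) * (z - y) <=
    Q * ((y - x) * (arc_point z - arc_point y)) /\
  (y - x) * (arc_point z - arc_point y) <=
    Q * ((arc_point y - arc_point x) * (z - y)).
Proof.
move=> T0 xy yz zx Txz Q.
have mvt (p q : R) : p < q -> exists2 c, p <= c <= q &
    arc_point q - arc_point p = (pi * (1 + c ^+ 2))^-1 * (q - p).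
  move=> pq; have carc : {within `[p, q], continuous (@arc_point R)}.
    apply/continuous_subspaceT/derivable_continuous => c.
    exact: is_derive_derivable (is_derive_arc_point c).
  have [c cI ->] := MVT pq (fun c _ => is_derive_arc_point c) carc.
  by exists c => //; move: cI; rewrite in_itv/= => /andP[/ltW-> /ltW->].
have [c /andP[xc cy] ->] := mvt _ _ xy; have [d /andP[yd dz] ->] := mvt _ _ yz.
have key (s t : R) : x <= s <= z -> x <= t <= z -> 1 + s ^+ 2 <= Q * (1 + t ^+ 2).
  move=> /andP[xs sz] /andP[xt tz].
  have tT : T <= `|t|.
    by case: Txz => h; rewrite ler_normr; apply/orP; [left|right]; lra.
  have st : `|s| <= `|t| * (1 + 2 * tau / T).
    have h : `|s - t| <= 2 * tau by rewrite ler_norml; apply/andP; split; lra.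
    have h1 : `|s| <= `|t| + 2 * tau.
      by have := ler_normD (s - t) t; rewrite subrK; lra.
    apply: le_trans h1 _; rewrite mulrDr mulr1 lerD2l mulrCA.
    by rewrite ler_peMr ?mulr_ge0 ?(ltW tau0)// ler_pdivlMr// mul1r.
  have t0 : 0 <= 2 * tau / T by rewrite divr_ge0 ?mulr_ge0 ?(ltW tau0) ?(ltW T0).
  have Q1 : 1 <= Q by rewrite exprn_ege1// lerDl.
  rewrite mulrDr mulr1 lerD// -(real_normK (num_real s)) -(real_normK (num_real t)).
  by rewrite /Q -exprMn mulrC lerXn2r ?nnegrE// mulr_ge0// addr_ge0.
have pi0 := pi_gt0 R.
have inv (s t : R) : x <= s <= z -> x <= t <= z ->
    (pi * (1 + s ^+ 2))^-1 <= Q * (pi * (1 + t ^+ 2))^-1.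
  move=> hs ht; rewrite ler_pdivlMr ?mulr_gt0 ?oneDsqr_gt0// mulrC.
  rewrite ler_pdivrMr ?mulr_gt0 ?oneDsqr_gt0//.
  by rewrite mulrCA ler_pM2l//; exact: key.
have cI : x <= c <= z by rewrite xc (le_trans cy (ltW yz)).
have dI : x <= d <= z by rewrite dz (le_trans (ltW xy) yd).
have a0 : 0 <= (y - x) * (z - y) by rewrite mulr_ge0// subr_ge0 ltW.
have := ler_wpM2r a0 (inv c d cI dI); have := ler_wpM2r a0 (inv d c dI cI).
move: ((pi * (1 + c ^+ 2))^-1) ((pi * (1 + d ^+ 2))^-1) => p q h1 h2.
by split; [move: h2; congr (_ <= _); ring|move: h1; congr (_ <= _); ring].
Qed.

End LineDynamics.

(** On the i-th interval, [f ^ n] consists of [l.+1] steps up to the fundamental interval that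
    starts at 0 and of [i + K] steps beyond it. *)
Lemma split_iterate (n K i : nat) : (i < n - 2 * K)%N -> exists l,
  [/\ n - K - i = l.+1, n = l.+1 + (i + K), K <= l & i < n - K]%N.
Proof. by move=> iN; exists (n - K - i).-1; split; lia. Qed.

(** * Linear growth of the logarithmic variation *)

Section VariationGrowth.
Context {R : realType}.

Lemma circle_var_oscillation (psi : R -> R) (t : nat -> R) (n : nat) (eta : R) :
  circle_bv psi -> (forall i, t i <= t i.+1) -> t n <= t 0%N + 1 ->
  (forall i, (i < n)%N -> exists v w,
    [/\ t i <= v, v <= w, w <= t i.+1 & eta <= `|psi w - psi v|]) ->
  eta * n%:R <= circle_var psi.
Proof.
move=> bv tS tn osc.
(* A turn also constrains [v n], so from index [n] on the left endpoint is [t i]: then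
   [v n = t n <= t 0 + 1 <= v 0 + 1]. *)
pose P i (q : R * R) := [/\ t i <= q.1, q.1 <= q.2, q.2 <= t i.+1,
  (i < n)%N -> eta <= `|psi q.2 - psi q.1| & (n <= i)%N -> q.1 = t i].
have exP i : exists q, P i q.
  have [iN|Ni] := ltnP i n; last first.
    by exists (t i, t i.+1); split=> //= iN; move: iN; rewrite ltnNge Ni.
  have [v [w [tv vw wt h]]] := osc i iN; exists (v, w); split=> //= ni.
  by move: iN; rewrite ltnNge ni.
have [p pP] := choice exP.
have tu : turn (fst \o p) (snd \o p) n.
  split=> [i /=|/=].
    have [h1 h2 h3 _ _] := pP i; have [h4 _ _ _ _] := pP i.+1.
    by rewrite h2 (le_trans h3).
  have [_ _ _ _ ->//] := pP n.
  by have [h _ _ _ _] := pP 0%N; apply: le_trans tn _; rewrite lerD2r.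
apply: le_trans (circle_var_ge bv tu).
rewrite -[n in leLHS]card_ord -sumr_const mulr_sumr; apply: ler_sum => i _.
by rewrite mulr1; have [_ _ _ h _] := pP i; exact: h.
Qed.

Lemma is_lift_expg (F : R -> R) (f : bijection (circle R)) n :
  is_lift F f -> is_lift (iter n F) (f ^+ n)%g.
Proof.
move=> Ff; elim: n => [|n IH]; first by rewrite expg0; exact: is_lift_one.
by rewrite expgS; apply: is_lift_comp IH.
Qed.

Lemma Diffk_expg k (f : bijection (circle R)) n : Diffk k f -> Diffk k (f ^+ n)%g.
Proof.
move=> fk; elim: n => [|n IH]; first by rewrite expg0; exact: Diffk_one.
by rewrite expgS; exact: Diffk_mul.
Qed.

Lemma Diffk_zexp k (f : bijection (circle R)) n : Diffk k f -> Diffk k (zexp f n).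
Proof.
by case: n => n fk /=; [exact: Diffk_expg|apply/Diffk_inv/Diffk_expg].
Qed.

Lemma is_derive_of_lift (F : R -> R) (f : bijection (circle R)) (x : R) :
  is_lift F f -> Diffk 1 f -> is_derive x 1 F (dlift f x).
Proof.
move=> Ff f1; have [n E] := is_lift_uniq (is_lift_lift Ff) Ff.
rewrite (_ : F = fun x => Defs.lift f x + n%:~R); last exact/funext.
by apply: is_derive_addc; exact: is_derive_lift.
Qed.

Variables (tau eps : R) (m : nat).
Hypotheses (tau0 : 0 < tau) (tau8 : 8 * tau <= 1) (eps0 : 0 < eps)
  (epsm : 8 * eps * m.+1%:R ^+ 2 <= tau) (mtau : 80 <= m.+1%:R * tau ^+ 2).
Variable f : bijection (circle R).
Hypotheses (Ff : is_lift (circle_map tau eps m) f) (f2 : Diffk 2 f).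

Notation F := (circle_map tau eps m).
Notation phi := (line_map tau eps m).
Notation kappa := (mid_ratio tau eps).

Let eps8 : 8 * eps <= tau.
Proof.
by apply: le_trans epsm; rewrite ler_peMr ?mulr_ge0 ?(ltW eps0)// exprn_ege1// ler1n.
Qed.

Lemma iter_circle_map_arc_point n u : iter n F (arc_point u) = arc_point (iter n phi u).
Proof. by elim: n => //= n ->; exact: circle_map_arc_point. Qed.

(** The two squares are the chart distortions before and after the iterate, at [K] steps from 0.
    With [d = 2 / K <= 1] their product is at most [1 + 15 d], and [60 / (1 - kappa) <= K] means
    [15 d <= (1 - kappa) / 2]. *)
Lemma distortion_constant : exists K : nat, (0 < K)%N /\
  (1 + 2 * tau / (K%:R * tau)) ^+ 2 * (1 + 2 * tau / (K%:R * tau)) ^+ 2 * kappa <=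
  (1 + kappa) / 2.
Proof.
have /andP[k0 k1] := mid_ratio_bounds tau0 eps0.
have k1' : 0 < 1 - kappa by rewrite subr_gt0.
pose K := (Num.bound (60 / (1 - kappa))).+1; exists K; split=> //.
have K0 : 0 < K%:R :> R by rewrite ltr0n.
have KK : 60 / (1 - kappa) <= K%:R.
  apply: (@le_trans _ _ (Num.bound (60 / (1 - kappa)))%:R); last by rewrite ler_nat.
  by rewrite ltW// archi_boundP// divr_ge0// ltW.
rewrite (_ : 2 * tau / (K%:R * tau) = 2 / K%:R); last first.
  by move: (K%:R : R) K0 => k k0'; field; rewrite !gt_eqF.
set d := 2 / K%:R.
have d0 : 0 <= d by rewrite divr_ge0// ltW.
have dk : 30 * d <= 1 - kappa.
  rewrite /d mulrA ler_pdivrMr//; move: KK; rewrite ler_pdivrMr//.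
  by rewrite (mulrC K%:R); lra.
move: dk d0 k0 k1; move: d (mid_ratio _ _) => d k dk d0 k0 k1.
have d1 : d <= 1 by lra.
have d2 : d * d <= d by rewrite ler_piMr.
have d3 : d * d * (d * d) <= d by rewrite (le_trans _ d2)// ler_piMr ?mulr_ge0// (le_trans d2).
have d4 : d * d * d <= d by rewrite (le_trans _ d2)// ler_piMr ?mulr_ge0.
have h : (1 + d) ^+ 2 * (1 + d) ^+ 2 <= 1 + 15 * d.
  rewrite (_ : _ * _ = 1 + 4 * d + 6 * (d * d) + 4 * (d * d * d) + d * d * (d * d)); last by ring.
  by lra.
apply: le_trans (ler_wpM2r (ltW k0) h) _; rewrite mulrDl mul1r.
have : 15 * d * k <= 15 * d by rewrite ler_piMr ?mulr_ge0// ltW.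
by lra.
Qed.

(* In the coordinate u the iterate maps the fundamental interval
   [psi^(l+1) 0, psi^l 0] near the repelling side to [phi^r 0, phi^(r+1) 0] near
   the attracting side, and it contracts the part left of the marked point more
   than the part right of it, while the chart distorts ratios only slightly. *)
Lemma local_oscillation (psi : R -> R) (K l r : nat) : cancel phi psi -> cancel psi phi ->
  (0 < K)%N -> (1 + 2 * tau / (K%:R * tau)) ^+ 2 * (1 + 2 * tau / (K%:R * tau)) ^+ 2 * kappa <=
  (1 + kappa) / 2 -> (K <= l)%N -> (K <= r)%N ->
  exists v w, [/\ arc_point (iter l.+1 psi 0) <= v, v <= w,
    w <= arc_point (iter l psi 0) &
    dlift (f ^+ (l.+1 + r))%g v <= (1 + kappa) / 2 * dlift (f ^+ (l.+1 + r))%g w].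
Proof.
move=> phiK psiK K0 Kd Kl Kr; set g := (f ^+ _)%g.
pose b := (tau + eps) / 2.
pose u0 := iter l.+1 psi 0; pose u1 := iter l.+1 psi b; pose u2 := iter l psi 0.
pose v0 := iter r phi 0; pose v1 := iter r phi b; pose v2 := iter r.+1 phi 0.
pose H := iter (l.+1 + r) F.
have Hg : is_lift H g by exact: is_lift_expg.
have g1 : Diffk 1 g by apply: Diffk_expg; exact: Diffk_le f2.
have dH (x : R) : is_derive x 1 H (dlift g x) by exact: is_derive_of_lift.
have H0 : H (arc_point u0) = arc_point v0.
  by rewrite /H iter_circle_map_arc_point addnC (iter_phi_psi psiK).
have H1 : H (arc_point u1) = arc_point v1.
  by rewrite /H iter_circle_map_arc_point addnC (iter_phi_psi psiK).
have H2 : H (arc_point u2) = arc_point v2.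
  by rewrite /H iter_circle_map_arc_point addSnnS addnC (iter_phi_psi psiK).
have /andP[u01 u12] := mid_between tau0 tau8 eps0 epsm phiK psiK l.
rewrite -/b -/u0 -/u1 -/u2 in u01 u12.
have b0 : 0 < b by rewrite divr_gt0// addr_gt0.
have phiI := line_map_increasing tau8 eps0 epsm.
have v01 : v0 < v1 by apply: iter_increasing.
have v12 : v1 < v2.
  rewrite /v2 iterSr; apply: iter_increasing => //.
  by rewrite /line_map arc_bump0 mulr1 add0r /b; move: (tau0) (eps0); lra.
have lenu : u2 - u0 <= 2 * tau.
  have -> : u2 = phi u0 by rewrite /u0 iterS psiK.
  by have := line_map_le tau m eps0 u0; move: (eps8) (tau0); lra.
have lenv : v2 - v0 <= 2 * tau.
  by rewrite /v2 iterS; have := line_map_le tau m eps0 v0; move: (eps8) (tau0); lra.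
have T0 : 0 < K%:R * tau by rewrite mulr_gt0// ltr0n.
have uT : u2 <= - (K%:R * tau).
  apply: le_trans (iter_psi_zero_le eps0 psiK l) _.
  by rewrite lerN2 ler_pM2r// ler_nat.
have vT : K%:R * tau <= v0.
  have rE : r = r.-1.+1 by rewrite prednK// (leq_trans K0 Kr).
  rewrite /v0 rE; apply: le_trans (iter_phi_zero_ge tau m eps0 r.-1).
  by rewrite -rE (@le_trans _ _ (r%:R * tau))// ?lerDl ?(ltW eps0)// ler_pM2r// ler_nat.
have [hu _] := arc_point_distortion tau0 T0 u01 u12 lenu (or_intror uT).
have [_ hu'] := arc_point_distortion tau0 T0 u01 u12 lenu (or_intror uT).
have [hv _] := arc_point_distortion tau0 T0 v01 v12 lenv (or_introl vT).
have con := fundamental_contraction tau0 tau8 eps0 epsm mtau phiK psiK l (leq_trans K0 Kr).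
rewrite -/b -/u0 -/u1 -/u2 -/v0 -/v1 -/v2 in con.
have cH : continuous H.
  by apply: derivable_continuous => x; exact: is_derive_derivable (dH x).
have x01 := arc_point_increasing u01; have x12 := arc_point_increasing u12.
have [v vI Ev] := MVT x01 (fun x _ => dH x) (continuous_subspaceT cH).
have [w wI Ew] := MVT x12 (fun x _ => dH x) (continuous_subspaceT cH).
exists v, w; move: vI wI; rewrite !in_itv/= => /andP[hv1 hv2] /andP[hw1 hw2].
split; [exact: ltW|by rewrite ltW// (lt_trans hv2)|exact: ltW|].
rewrite H0 H1 in Ev; rewrite H1 H2 in Ew.
have dw := dlift_gt0 w g1.
move: Kd hv hu' con Ev Ew dw; rewrite -/b.
set Q := (1 + _) ^+ 2 => Kd.
have Q0 : 0 < Q.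
  by rewrite exprn_gt0// ltr_pwDl// divr_ge0 ?mulr_ge0 ?(ltW tau0)// ltW.
have /andP[k0 _] := mid_ratio_bounds tau0 eps0.
have A0 : 0 < u1 - u0 by rewrite subr_gt0.
have B0 : 0 < u2 - u1 by rewrite subr_gt0.
have A'0 : 0 < v1 - v0 by rewrite subr_gt0.
have B'0 : 0 < v2 - v1 by rewrite subr_gt0.
have X0 : 0 < arc_point u1 - arc_point u0 by rewrite subr_gt0.
have Y0 : 0 <= arc_point u2 - arc_point u1 by rewrite subr_ge0 ltW.
move: Kd Q0 k0 A0 B0 A'0 B'0 X0 Y0; clear.
move: (arc_point u1 - arc_point u0) (arc_point u2 - arc_point u1) => X Y.
move: (arc_point v1 - arc_point v0) (arc_point v2 - arc_point v1) => X' Y'.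
move: (u1 - u0) (u2 - u1) (v1 - v0) (v2 - v1) Q kappa => A B A' B' Q k.
move: (dlift g v) (dlift g w) => p q.
move=> Kd Q0 k0 A0 B0 A'0 B'0 X0 Y0 hX' hX con Ep Eq q0.
(* By the mean value theorem [X' = p X] and [Y' = q Y]. Multiplication by the positive [X B' A B]
   lets the two distortion bounds and the contraction be combined without division. *)
apply: le_trans (_ : Q * Q * k * q <= _); last by rewrite ler_pM2r.
have pos : 0 < X * B' * (A * B) by rewrite !mulr_gt0.
rewrite -(ler_pM2r pos).
have h1 : p * X * B' <= Q * (A' * (q * Y)) by rewrite -Ep -Eq.
have AB0 : 0 <= A * B by rewrite mulr_ge0// ltW.
have h2 := ler_wpM2r AB0 h1.
rewrite (_ : p * (X * B' * (A * B)) = p * X * B' * (A * B)); last by ring.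
apply: le_trans h2 _.
rewrite (_ : Q * (A' * (q * Y)) * (A * B) = Q * q * ((A' * B) * (A * Y))); last by ring.
rewrite (_ : Q * Q * k * q * (X * B' * (A * B)) =
  Q * q * ((k * (A * B')) * (Q * (X * B)))); last by ring.
rewrite ler_pM2l ?mulr_gt0//.
by apply: ler_pM => //; rewrite ?mulr_ge0// ltW.
Qed.

Lemma log_var_growth : exists c C : R, 0 < c /\
  forall n, c * n%:R - C <= log_var (f ^+ n)%g 1%g.
Proof.
have [K [K0 Kd]] := distortion_constant.
have surj y : exists x, phi x = y by exact: line_map_surjective.
have [psi psiK] := choice surj.
have phiK : cancel phi psi.
  move=> x; have phiI := line_map_increasing tau8 eps0 epsm.
  have := psiK (phi x); have [h|h|//] := ltgtP (psi (phi x)) x;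
    by move=> E; move: (phiI _ _ h); rewrite E ltxx.
have /andP[k0 k1] := mid_ratio_bounds tau0 eps0.
have k'1 : 0 < (1 + kappa) / 2 < 1 by apply/andP; split; lra.
have /andP[k'0 k'lt] := k'1.
pose eta := - ln ((1 + kappa) / 2).
have eta0 : 0 < eta by rewrite oppr_gt0 ln_lt0.
(* The [K] intervals within [K] steps of 0 before the iterate, and the [K] whose images are, are
   given up because the chart distorts too much there; this costs the additive constant. *)
exists eta, (eta * (2 * K)%:R); split=> // n.
have [nK|Kn] := leqP n (2 * K).
  apply: le_trans (circle_var_ge0 _); rewrite -mulrBr.
  by rewrite pmulr_rle0// subr_le0 ler_nat.
rewrite -mulrBr -natrB ?(ltnW Kn)//.
have g2 : Diffk 2 (f ^+ n)%g by exact: Diffk_expg.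
have g1 : Diffk 1 (f ^+ n)%g by exact: Diffk_le g2.
have gac := Diffk_Diff1AC (leqnn 2) g2.
have E : (fun x => ln (dlift (f ^+ n)%g x) - ln (dlift 1%g x)) =
    (fun x => ln (dlift (f ^+ n)%g x)).
  by apply/funext => x; rewrite (dlift_one x) ln1 subr0.
rewrite /log_var E.
(* These are points of the orbit of 0, in increasing order; all lie in the chart [0 < x < 1], hence
   within one turn. *)
pose t i := arc_point (iter i phi (iter (n - K) psi 0)).
apply: (@circle_var_oscillation _ t).
- exact: Diff1AC_circle_bv.
- move=> i; apply/ltW/arc_point_increasing; rewrite iterS.
  by have := line_map_ge tau m eps0 (iter i phi (iter (n - K) psi 0)); move: (tau0); lra.
- have /andP[_ h] := arc_point_bounds (iter (n - 2 * K) phi (iter (n - K) psi 0)).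
  have /andP[h' _] := arc_point_bounds (iter 0 phi (iter (n - K) psi 0)).
  by rewrite /t; lra.
move=> i iN; have [l [lE nE Kl iK]] := split_iterate iN.
have [v [w [tv vw wt H]]] := local_oscillation phiK psiK K0 Kd Kl (leq_addl i K).
exists v, w; split=> //.
- by rewrite /t (iter_phi_psi_le psiK) ?(ltnW iK)// lE.
- by rewrite /t (iter_phi_psi_le psiK)// subnS lE.
rewrite -nE in H.
move: H (dlift_gt0 v g1) (dlift_gt0 w g1); move: (dlift _ v) (dlift _ w) => p q pq p0 q0.
have : ln p <= ln ((1 + kappa) / 2) + ln q.
  by rewrite -lnM ?posrE// ler_ln ?posrE// mulr_gt0.
rewrite /eta; move: (ln p) (ln q) (ln _) => a b d h.
by apply: le_trans (ler_norm _); lra.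
Qed.

End VariationGrowth.

(** * Properties of the diffeomorphism and choice of parameters *)

Section ParabolicDiffeomorphism.
Context {R : realType}.

Lemma to_circle0 : to_circle (0 : R) = 0.
Proof. by rewrite -(subrr (0 : R)) to_circleB subrr. Qed.

Lemma circle_fundamental (p : circle R) : exists2 x : R, 0 <= x < 1 & to_circle x = p.
Proof.
pose x := repr p; exists (x - (Num.floor x)%:~R).
  by have /andP[h1 h2] := floor_itv x; rewrite intrD mulr1z in h2; apply/andP; split; lra.
by rewrite -mulrNz to_circleD_int reprK_circle.
Qed.

Lemma circle_dist_le (p q : circle R) (x : R) : to_circle x = p - q ->
  circle_dist p q <= `|x|.
Proof.
move=> xpq; apply: inf_lbound; last by exists x.
by exists 0 => _ [y _ <-].
Qed.

(** The lift chosen in the definition is [F + n] for an unknown integer [n], so the translation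
    limit is [n], which vanishes on the circle. *)
Lemma rotation_number_fixed0 (F : R -> R) (f : bijection (circle R)) :
  is_lift F f -> (forall x (n : int), F (x + n%:~R) = F x + n%:~R) -> F 0 = 0 ->
  rotation_number f = 0.
Proof.
move=> Ff FD F0; have [n E] := liftE Ff; rewrite /rotation_number.
have it k : iter k (Defs.lift f) 0 = k%:R * n%:~R.
  elim: k => [|k IH]; first by rewrite mul0r.
  rewrite iterS IH E -[k%:R * n%:~R]add0r.
  rewrite (_ : k%:R * n%:~R = (k%:Z * n)%:~R :> R); last by rewrite intrM.
  by rewrite FD F0 add0r intrM -natr1 mulrDl mul1r.
have cv : (fun k : nat => iter k (Defs.lift f) 0 / k%:R) @ \oo --> (n%:~R : R).
  (* The shift skips the index 0, where the quotient by 0 takes the default value 0. *)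
  rewrite -cvg_shiftS; apply: cvg_near_cst; apply: nearW => k /=.
  by rewrite -iterS it mulrAC divff ?pnatr_eq0// mul1r.
rewrite (cvg_lim (@Rhausdorff R) cv).
by rewrite -[n%:~R]add0r to_circleD_int to_circle0.
Qed.

Lemma linear_growth_C_undistorted (r : regularity) (f : bijection (circle R)) (c C : R) :
  (forall n, Diff r (zexp f n)) -> admissible (Diff r) (rho r) (@log_var R) ->
  0 < c -> (forall n : nat, c * n%:R - C <= log_var (f ^+ n)%g 1%g) ->
  C_undistorted r f.
Proof.
move=> Hz adm c0 grow; split; first by have := Hz 1; rewrite /= expg1.
move=> [_ [[d [dmax nqi]]|tor]].
  exact/nqi/(linear_growth_qi Hz dmax adm c0 grow).
by have [sP _ _] := adm; exact: (linear_growth_not_torsion Hz sP c0 grow tor).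
Qed.

Variables (tau eps : R) (m : nat).
Hypotheses (tau0 : 0 < tau) (tau8 : 8 * tau <= 1) (eps0 : 0 < eps)
  (epsm : 8 * eps * m.+1%:R ^+ 2 <= tau) (mtau : 80 <= m.+1%:R * tau ^+ 2).

Notation F := (circle_map tau eps m).

Lemma derive1_circle_map0 : derive1 F 0 = 1.
Proof.
rewrite (derive1_circle_map tau0 tau8 eps0 epsm) mulr0 sin0.
rewrite /npol /dpol /qpol expr0n /= exprS !mul0r !mulr0 addr0 subr0 addr0.
by rewrite divr1.
Qed.

Let dF (x : R) : is_derive x 1 F (derive1 F x).
Proof.
rewrite (is_derive_derive1 (is_derive_circle_map tau0 tau8 eps0 epsm x)).
exact: is_derive_circle_map.
Qed.

Lemma derive1_circle_map_near1 x : 0 <= x <= 1 -> `|derive1 F x - 1| <= 400 * tau.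
Proof.
move=> /andP[x0 x1].
have [sm _] := circle_map_smooth tau0 tau8 eps0 epsm.
have /CkS[_ /CkS[d2 _]] := sm 2.
have [||z _] := @MVT_segment R (derive1 F) (derive1 (derive1 F)) 0 x x0.
- by move=> z _; exact: derivable_is_derive1.
- exact/continuous_subspaceT/derivable_continuous.
rewrite derive1_circle_map0 => ->; rewrite subr0 normrM (ger0_norm x0).
rewrite -[leRHS]mulr1; apply: ler_pM => //.
exact: derive2_circle_map_bound.
Qed.

Lemma circle_map_near_id x : 0 <= x <= 1 -> `|F x - x| <= 400 * tau.
Proof.
move=> /andP[x0 x1].
pose h y := F y + -1 * y.
have dh (y : R) : is_derive y 1 h (derive1 F y + -1 * 1).
  by apply: is_derive_addf (dF y) _; apply: is_derive_scalef; exact: is_derive_id.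
have [|z zI] := @MVT_segment R h (fun y => derive1 F y + -1 * 1) 0 x x0.
  by apply/continuous_subspaceT/derivable_continuous => y; exact: is_derive_derivable (dh y).
rewrite /h circle_map0 !mulr0 addr0 !subr0 mulN1r mulr1 => ->.
rewrite normrM (ger0_norm x0) -[leRHS]mulr1; apply: ler_pM => //.
apply: derive1_circle_map_near1; move: zI; rewrite in_itv/= => /andP[-> zx].
exact: le_trans zx x1.
Qed.

Lemma circle_map_diffeo : exists f : bijection (circle R),
  [/\ is_lift F f, forall k, Diffk k f & analytic_diffeo f].
Proof.
have Finc := circle_map_increasing tau0 tau8 eps0 epsm.
have cF : continuous F by exact: circle_map_continuous.
have [f [G [Ff Gf FG GF]]] := increasing_lift_bijection cF Finc (circle_map1 tau eps m).
have [sF aF] := circle_map_smooth tau0 tau8 eps0 epsm.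
have [sG aG] := circle_map_inverse_smooth tau0 tau8 eps0 epsm FG GF.
have fop : orientation_preserving f by exists F.
exists f; split=> //.
  by move=> k; split=> //; [exists F|exists G].
by split=> //; [exists F|exists G].
Qed.

Section Properties.
Variable f : bijection (circle R).
Hypotheses (Ff : is_lift F f) (fk : forall k, Diffk k f).

Let dliftE x : dlift f x = derive1 F x.
Proof. exact/esym/is_derive_derive1/(is_derive_of_lift x Ff (fk 1)). Qed.

Lemma circle_map_not_hyperbolic p : ~ hyperbolic_fixed_point f p.
Proof.
have [x /andP[x0 x1] <-] := circle_fundamental p.
move=> [fp]; apply; rewrite circle_derive1E; last exact: fk.
have [_ Fx] := Ff; move: fp; rewrite -Fx => /to_circleP[n E].
suff -> : x = 0 by rewrite dliftE derive1_circle_map0.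
apply/eqP; rewrite eq_le x0 andbT leNgt; apply/negP => xgt.
have x01 : 0 < x < 1 by rewrite xgt.
have /andP[h1 h2] := circle_map_gt tau0 tau8 eps0 epsm x01.
have n0 : 0 < n by rewrite -(ltr_int R); move: h1; rewrite E ltrDl.
have n1 : n < 1 by rewrite -(ltr_int R); move: h2 xgt; rewrite E; lra.
by move: n1; rewrite ltNge -gtz0_ge1 n0.
Qed.

(** Each of the three terms is at most [400 * tau]: the bound on the second derivative is integrated
    from [F' 0 = 1], then from [F 0 = 0]. *)
Lemma circle_map_rho1AC : (rho1AC 1%g f <= (1200 * tau)%:E)%E.
Proof.
have t0 : 0 <= 400 * tau by rewrite mulr_ge0 ?ler0n ?(ltW tau0).
have one1 : Diffk 1 (1%g : bijection (circle R)) by exact: Diffk_one.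
rewrite rho1ACE//.
rewrite (_ : 1200 * tau = 400 * tau + 400 * tau + 400 * tau); last by ring.
rewrite !EFinD; apply: leeD; first apply: leeD.
- apply: ge_ereal_sup => _ [p _ <-]; rewrite lee_fin.
  have [x /andP[x0 x1] <-] := circle_fundamental p; have [_ Fx] := Ff.
  apply: le_trans (_ : `|x - F x| <= _).
    by apply: circle_dist_le; rewrite to_circleB Fx.
  by rewrite distrC circle_map_near_id// x0 ltW.
- apply: ge_ereal_sup => _ [p _ <-]; rewrite lee_fin.
  have [x /andP[x0 x1] <-] := circle_fundamental p.
  rewrite !circle_derive1E//.
  by rewrite dlift_one dliftE distrC derive1_circle_map_near1// x0 ltW.
apply: (@le_trans _ _ (\int[lebesgue_measure]_(x in `[0%R, 1%R]) cst (400 * tau)%:E x)%E).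
  apply: ge0_le_integral_subset => x xI; last by rewrite lee_fin.
  split=> //; rewrite lee_fin//.
  have -> : derive1 (dlift (1%g : bijection (circle R))) x = 0.
    rewrite (_ : dlift 1%g = cst (1 : R)); first exact: derive1_cst.
    by apply/funext => y; exact: dlift_one.
  have -> : dlift f = derive1 F by apply/funext.
  by rewrite sub0r normrN; exact: derive2_circle_map_bound.
rewrite integral_cst; last exact: measurable_itv.
rewrite [X in (_ * X <= _)%E](_ : _ = 1%E) ?mule1//.
apply: etrans (lebesgue_measure_itv `[0%R, 1%R]) _.
by rewrite /= lte_fin ltr01 oppr0 adde0.
Qed.

End Properties.
End ParabolicDiffeomorphism.

Lemma parabolic_undistorted_near_identity (R : realType) (e : R) : 0 < e ->
  exists f : bijection (circle R),
  [/\ analytic_diffeo f, rotation_number f = 0,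
      forall p, ~ hyperbolic_fixed_point f p,
      C_undistorted C1AC f /\ (forall k : nat, (2 <= k)%N -> C_undistorted (Cint k) f)
    & Diff1AC f /\ (rho1AC 1%g f < e%:E)%E].
Proof.
(* The second bound makes [1200 * tau] at most [e / 2]. *)
move=> e0; pose tau : R := Num.min 8^-1 (e / 2400).
have tau0 : 0 < tau by rewrite lt_min invr_gt0 ltr0n/= divr_gt0 ?ltr0n.
have tau8 : 8 * tau <= 1.
  have : tau <= 8^-1 by rewrite ge_min lexx.
  by lra.
have taue : 1200 * tau < e.
  have : tau <= e / 2400 by rewrite ge_min lexx orbT.
  by lra.
(* [m] meets the requirement on the sums of bumps, and [eps] is the largest value that the second
   derivative estimate permits. *)
pose m := Num.bound (80 / tau ^+ 2); pose eps := tau / (8 * m.+1%:R ^+ 2).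
have k0 : 0 < m.+1%:R :> R by rewrite ltr0n.
have eps0 : 0 < eps by rewrite divr_gt0// mulr_gt0// exprn_gt0.
have epsm : 8 * eps * m.+1%:R ^+ 2 <= tau.
  rewrite /eps mulrAC mulrC divfK// gt_eqF// mulr_gt0// exprn_gt0//.
have mtau : 80 <= m.+1%:R * tau ^+ 2.
  rewrite -ler_pdivrMr ?exprn_gt0//.
  apply: (@le_trans _ _ m%:R); last by rewrite ler_nat.
  by rewrite ltW// archi_boundP// divr_ge0// ltW// exprn_gt0.
have [f [Ff fk fan]] := circle_map_diffeo tau0 tau8 eps0 epsm.
have [c [C [c0 grow]]] := log_var_growth tau0 tau8 eps0 epsm mtau Ff (fk 2%N).
exists f; split=> //.
- apply: (rotation_number_fixed0 Ff); last exact: circle_map0.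
  exact/lift_intD/circle_map1.
- exact: (circle_map_not_hyperbolic tau0 tau8 eps0 epsm Ff fk).
- split=> [|k k2].
    have fz n : Diff C1AC (zexp f n).
      exact/(Diffk_Diff1AC (leqnn 2))/Diffk_zexp.
    exact: linear_growth_C_undistorted fz log_var_admissible_Diff1AC c0 grow.
  have fz n : Diff (Cint k) (zexp f n) by exact: Diffk_zexp.
  exact: linear_growth_C_undistorted fz (log_var_admissible_Diffk k2) c0 grow.
- split; first exact: Diffk_Diff1AC (leqnn 2) (fk 2%N).
  apply: le_lt_trans (circle_map_rho1AC tau0 tau8 eps0 epsm Ff fk) _.
  by rewrite lte_fin.
Qed.

Theorem theorem1p4 (R : realType) :
  let parabolic_undistorted (f : bijection (circle R)) : Prop :=
    [/\ analytic_diffeo f,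
        rotation_number f = 0,
        forall p, ~ hyperbolic_fixed_point f p,
        C_undistorted C1AC f
      & forall k : nat, (2 <= k)%N -> C_undistorted (Cint k) f] in
  (exists f, parabolic_undistorted f) /\
  (forall U : set (bijection (circle R)), nbhs_in Diff1AC rho1AC 1%g U ->
     exists2 f, U f & parabolic_undistorted f).
Proof.
move=> parabolic_undistorted; split.
  have [f [fan rot hyp [fac fk] _]] := parabolic_undistorted_near_identity (@ltr01 R).
  by exists f; split.
move=> U [e e0 eU].
have [f [fan rot hyp [fac fk] fe]] := parabolic_undistorted_near_identity e0.
by exists f; [exact: eU|split].
Qed.
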